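(* Let $d\ge 3$, $0<\alpha<2$, and let the real-valued potential $V\in L^\infty(\mathbb{R}^d)\cap L^1(\mathbb{R}^d)$ satisfy $V(x)\to 0$ as $|x|\to\infty$. Suppose that $\|V\|_\infty$ and $\|V\|_1$ are small enough such that $$2C_{d,\alpha}^2\left[\frac{8\cdot 5^d\,\omega_d^2}{d^2(2^\alpha-1)^2}\|V\|_\infty^2+\|V\|_1^2\right]<1,\qquad C_{d,\alpha}=\frac{\Gamma((d-\alpha)/2)}{\pi^{d/2}2^\alpha\Gamma(\alpha/2)}.$$ Then $H=H_0+V$ with $H_0=(-\Delta)^{\alpha/2}$ on $L^2(\mathbb{R}^d)$ has no non-positive eigenvalue; in particular, zero is not an eigenvalue of $H$.
   Context: $\omega_d$ is the surface area of the unit sphere in $\mathbb{R}^d$ (so $\omega_d/d$ is the volume of the unit ball of $\mathbb{R}^d$); $\Gamma$ is the Gamma function. $(-\Delta)^{\alpha/2}$ is the Fourier multiplier with symbol $|\xi|^\alpha$, and $H$ is self-adjoint on $\mathrm{Dom}(H_0)$. *)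

(* Defs.v *)
From HB Require Import structures.
From mathcomp Require Import all_boot all_order all_algebra.
From mathcomp Require Import complex.
From mathcomp Require Import all_classical all_reals all_analysis.
Set Implicit Arguments.
Unset Strict Implicit.
Unset Printing Implicit Defensive.
Import Order.TTheory GRing.Theory Num.Theory.
Import numFieldNormedType.Exports.
Local Open Scope classical_set_scope.
Local Open Scope ring_scope.
Local Open Scope complex_scope.

(* With the product sigma-algebra, i.e. the Borel sets of R^d. *)
Notation Rn R d := (d.-tuple (measurableTypeR R)).

Section LebesgueStep.
Context {R : realType} {d : nat}.
Variable mu : {sigma_finite_measure set (Rn R d) -> \bar R}.

Definition cons_point (p : measurableTypeR R * Rn R d) : Rn R d.+1 :=
  [tuple of p.1 :: p.2].

Definition uncons_point (x : Rn R d.+1) : measurableTypeR R * Rn R d :=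
  (thead x, [tuple of behead x]).

Lemma measurable_cons_point : measurable_fun setT cons_point.
Proof. exact: measurable_cons. Qed.

Lemma measurable_uncons_point : measurable_fun setT uncons_point.
Proof.
apply: measurable_fun_pair; first exact: (measurable_tnth ord0).
exact: measurable_behead.
Qed.

Lemma cons_pointK : cancel cons_point uncons_point.
Proof.
case=> a x; rewrite /uncons_point /cons_point theadE.
by congr pair; apply: val_inj.
Qed.

Definition lebesgue_step : set (Rn R d.+1) -> \bar R :=
  pushforward (@lebesgue_measure R \x mu)%E cons_point.

Let step0 : lebesgue_step set0 = 0%E.
Proof. by rewrite /lebesgue_step /pushforward preimage_set0 measure0. Qed.

Let step_ge0 A : (0 <= lebesgue_step A)%E.
Proof. by rewrite /lebesgue_step /pushforward measure_ge0. Qed.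

Let step_sigma_additive : semi_sigma_additive lebesgue_step.
Proof.
move=> F mF tF mUF; rewrite /lebesgue_step /pushforward preimage_bigcup.
have mpre (A : set (Rn R d.+1)) : measurable A ->
    measurable (cons_point @^-1` A).
  by move=> mA; rewrite -[X in measurable X]setTI; exact: measurable_cons_point.
apply: measure_semi_sigma_additive.
- by move=> n; exact: mpre.
- apply/trivIsetP => /= i j _ _ ij; rewrite -preimage_setI.
  by move/trivIsetP : tF => /(_ _ _ _ _ ij) ->//; rewrite preimage_set0.
- by rewrite -preimage_bigcup; exact: mpre.
Qed.

HB.instance Definition _ := isMeasure.Build _ _ _ lebesgue_step
  step0 step_ge0 step_sigma_additive.

Let step_sigma_finite : sigma_finite setT lebesgue_step.
Proof.
have /sigma_finiteP[F [TF ndF Foo]] := sigma_finiteT (@lebesgue_measure R).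
have /sigma_finiteP[G [TG ndG Goo]] := sigma_finiteT mu.
exists (fun n => uncons_point @^-1` (F n `*` G n)).
  rewrite -preimage_bigcup (_ : \bigcup_n _ = setT) ?preimage_setT//.
  rewrite -subTset => -[a x] _.
  have [i _ Fia] : (\bigcup_i F i) a by rewrite -TF.
  have [j _ Gjx] : (\bigcup_j G j) x by rewrite -TG.
  exists (maxn i j) => //; split => /=.
    by move: a Fia; exact/subsetPset/ndF/leq_maxl.
  by move: x Gjx; exact/subsetPset/ndG/leq_maxr.
move=> n; have [mF Fn] := Foo n; have [mG Gn] := Goo n.
have mFG : measurable (F n `*` G n) by exact: measurableX.
split; first by rewrite -[X in measurable X]setTI; exact: measurable_uncons_point.
rewrite /lebesgue_step /pushforward -comp_preimage.
rewrite (_ : uncons_point \o cons_point = id); last first.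
  by apply/funext => x; exact: cons_pointK.
by rewrite preimage_id product_measure1E// lte_mul_pinfty// ge0_fin_numE.
Qed.

HB.instance Definition _ := Measure_isSigmaFinite.Build _ _ _ lebesgue_step
  step_sigma_finite.

End LebesgueStep.

Fixpoint lebesgue_Rn (R : realType) (d : nat) :
    {sigma_finite_measure set (Rn R d) -> \bar R} :=
  if d is d'.+1 then lebesgue_step (lebesgue_Rn R d')
  else \d_([tuple] : Rn R 0).

Section Euclidean.
Context {R : realType} {d : nat}.
Implicit Types (x y : Rn R d) (A : set (Rn R d)).

Definition dotp x y : R := \sum_(i < d) (tnth x i : R) * (tnth y i : R).

Definition enorm x : R := Num.sqrt (dotp x x).

Definition scalep (r : R) x : Rn R d := [tuple r * (tnth x i : R) | i < d].

Definition unit_sphere : set (Rn R d) := [set x | enorm x = 1].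

Definition cone A : set (Rn R d) :=
  [set y | exists r x, [/\ 0 <= r <= 1, A x & y = scalep r x]].

(* The surface measure on the unit sphere, normalised by polar coordinates
   dx = r^(d-1) dr dsigma: the cone over A has volume sigma(A) / d. *)
Definition surface_measure A : \bar R :=
  (d%:R%:E * lebesgue_Rn R d (cone A))%E.

End Euclidean.

Definition sphere_area (R : realType) (d : nat) : R :=
  fine (surface_measure (@unit_sphere R d)).

Definition Gamma (R : realType) (s : R) : R :=
  \int[@lebesgue_measure R]_(t in `]0, +oo[) (t `^ (s - 1) * expR (- t)).

Section ComplexFunctions.
Context {R : realType} {d : nat}.
Local Notation mu := (lebesgue_Rn R d).
Implicit Types f g : Rn R d -> R[i].

Definition cmeasurable f :=
  measurable_fun setT (fun x => complex.Re (f x)) /\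
  measurable_fun setT (fun x => complex.Im (f x)).

Definition L2norm f : \bar R := Lnorm mu 2%:E (fun x => (Normc.normc (f x))%:E).

Definition inL2 f := cmeasurable f /\ (L2norm f < +oo)%E.

Definition ae_eq_cfun f g := {ae mu, forall x, f x = g x}.

Definition cintegral (D : set (Rn R d)) f : R[i] :=
  (\int[mu]_(x in D) complex.Re (f x)) +i*
  (\int[mu]_(x in D) complex.Im (f x)).

Definition expi (t : R) : R[i] := cos t +i* sin t.

(* (2 pi)^(-d/2) times the integral over the ball |x| <= r of
   e^(-i x.xi) f(x) dx *)
Definition truncated_fourier (r : R) f : Rn R d -> R[i] := fun xi =>
  ((2 * pi) `^ (- (d%:R / 2)))%:C *
  cintegral [set x | enorm x <= r] (fun x => expi (- dotp x xi) * f x).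

(* Fourier-Plancherel transform on L^2: g is the L^2-limit of the transforms of
   the truncations of f, which are in L^1.  It is a relation, functional up to
   almost everywhere equality. *)
Definition is_fourier f g :=
  [/\ inL2 f, inL2 g &
   L2norm (fun xi => truncated_fourier n%:R f xi - g xi) @[n --> \oo] --> 0%E].

End ComplexFunctions.

(* An unbounded operator on L^2(R^d) is given by its graph, which is closed
   under almost everywhere equality: T f g means that f is in the domain of T
   and T f = g. *)
Definition operator (R : realType) (d : nat) :=
  (Rn R d -> R[i]) -> (Rn R d -> R[i]) -> Prop.

Section Operators.
Context {R : realType} {d : nat}.
Local Notation mu := (lebesgue_Rn R d).

(* The domain is the maximal one: the f in L^2 with m * fhat in L^2. *)
Definition fourier_multiplier (m : Rn R d -> R) : operator R d := fun f g =>
  exists fhat, is_fourier f fhat /\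
    is_fourier g (fun xi => (m xi)%:C * fhat xi).

Definition fractional_laplacian (alpha : R) : operator R d :=
  fourier_multiplier (fun xi => enorm xi `^ alpha).

(* T + V; V is bounded in the intended use, so the domain is that of T. *)
Definition add_potential (T : operator R d) (V : Rn R d -> R) : operator R d :=
  fun f g => exists2 h, T f h &
    inL2 g /\ ae_eq_cfun g (fun x => h x + (V x)%:C * f x).

Definition eigenvalue_of (T : operator R d) (lambda : R[i]) :=
  exists f, [/\ inL2 f, ~ ae_eq_cfun f (fun=> 0) &
    T f (fun x => lambda * f x)].

Definition vanishes_at_infinity (V : Rn R d -> R) :=
  forall e : R, 0 < e -> exists M : R, forall x, M < enorm x -> `|V x| < e.

(* Real-valued; only meaningful when V is in L^p. *)
Definition Lp_norm (p : \bar R) (V : Rn R d -> R) : R :=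
  fine (Lnorm mu p (EFin \o V)).

End Operators.

Definition riesz_constant (R : realType) (d : nat) (alpha : R) : R :=
  Gamma ((d%:R - alpha) / 2) /
  (pi `^ (d%:R / 2) * 2 `^ alpha * Gamma (alpha / 2)).

(* Main.v *)
(** Proof idea. Let [f] be an eigenfunction for [lambda <= 0], with Fourier
    transform [fhat], and let [g = V f].  The equation reads
    [ghat = (lambda - |xi|^alpha) fhat], hence [|fhat| <= |xi|^(-alpha) |ghat|].
    With [phi = |V| f], Parseval and AM-GM give
      int |V| |f|^2 = <phi, f> <= int |phihat| |fhat|
        <= (1/2) int |xi|^(-alpha) (|phihat|^2 + |ghat|^2),
    and both terms are Riesz energies,
      int |xi|^(-alpha) |ghat|^2
        <= C_{d,alpha} int int |x - y|^(alpha - d) |g(x)| |g(y)|.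
    The Schur test bounds the latter by
    [sup_x int |x - y|^(alpha - d) |V(y)| dy * int |V| |f|^2], and the supremum is
    estimated by dyadic annuli for [|x - y| <= 1] and by [||V||_1] outside.  The
    smallness assumption makes the resulting constant less than one, so
    [V f = 0], then [fhat = 0] and [f = 0].  Complex functions are handled through
    their real and imaginary parts: [ft a b] and [ft b (- a)] are the parts of
    the transform of [a + i b].  All the Fourier analysis is done by inserting
    the Gaussian [e^(-t |xi|^2)], whose transform is the heat kernel: [t -> 0]
    gives the Parseval inequalities, and integrating against [t^(alpha/2-1)]
    gives the Riesz energy. *)

(* Two products occur because [V] may change sign: <V f, f> has no sign, whereas <|V| f, f> is the
   weighted mass that has to vanish. The eigenvalue equation, on the other hand, controls fhat only
   through the transform of V f. Both products have the same modulus, hence the same bound on their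
   Riesz energies. The transform of f is given only as an L^2 limit of transforms of truncations,
   while V f is integrable and has a transform defined by an integral at every point. Whatever
   relates the two is therefore proved for truncations first, and the error of the passage to the
   limit is controlled by Bessel's inequality. The main estimates are inequalities between integrals
   of non-negative functions with values in the extended reals, so Tonelli and Fatou apply to them
   without any finiteness. The weighted mass itself must be finite, because [N <= c N] with [c < 1]
   gives [N = 0] only then; this is where [V] bounded and f in L^2 are used together. *)
Require Import Defs.
From mathcomp Require Import all_boot all_order all_algebra.
From mathcomp Require Import complex ring lra.
From mathcomp Require Import all_classical all_reals all_analysis.
From mathcomp Require Import measurable_realfun lebesgue_integral_under.
From mathcomp Require Import lebesgue_integral_differentiation.
Set Implicit Arguments.
Unset Strict Implicit.
Unset Printing Implicit Defensive.
Import Order.TTheory GRing.Theory Num.Theory.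
Import numFieldNormedType.Exports.
Local Open Scope classical_set_scope.
Local Open Scope ring_scope.

(* Hook of [meas_step], rebound as further measurable operations become available. *)
Ltac meas_tuple := fail.

(** The second-order patterns [@?f] read the component functions off the pointwise body, so that no
    [apply] has to guess how to decompose it. *)
Ltac meas_step := first
  [ assumption | exact: measurable_cst | exact: measurable_id
  | exact: measurable_fst | exact: measurable_snd
  | lazymatch goal with
    | |- measurable_fun _ (fun x => (@?f x)%:E) => apply/measurable_EFinP
    | |- measurable_fun _ (EFin \o ?f) => apply/measurable_EFinP
    | |- measurable_fun _ (fun x => (@?f x) + (@?g x)) =>
        first [apply: (measurable_funD (f := f) (g := g)) | apply: (emeasurable_funD (f := f)
          (g := g))]
    | |- measurable_fun _ (fun x => (@?f x) - (@?g x)) =>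
        apply: (measurable_funB (f := f) (g := g))
    | |- measurable_fun _ (fun x => - (@?f x)) => apply: (measurable_funN (f := f))
    | |- measurable_fun _ (fun x => (@?f x) * (@?g x)) =>
        first [apply: (measurable_funM (f := f) (g := g)) | apply: (emeasurable_funM (f := f)
          (g := g))]
    | |- measurable_fun _ (fun x => (@?f x) ^+ ?n) => apply: (measurable_funX (f := f) n)
    | |- measurable_fun _ (fun x => `|@?f x|) =>
        apply: (measurableT_comp (@normr_measurable _ setT) (g := f))
    | |- measurable_fun _ (fun x => `|@?f x|%E) =>
        apply: (measurableT_comp (@abse_measurable _ setT) (g := f))
    | |- measurable_fun _ (fun x => ((@?f x) + (@?g x))%E) =>
        apply: (emeasurable_funD (f := f) (g := g))
    | |- measurable_fun _ (fun x => ((@?f x) * (@?g x))%E) =>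
        apply: (emeasurable_funM (f := f) (g := g))
    | |- measurable_fun _ (fun x => expR (@?f x)) =>
        apply: (measurableT_comp (@measurable_expR _) (g := f))
    | |- measurable_fun _ (fun x => (@?f x) `^ ?p) =>
        apply: (measurableT_comp (@measurable_powR _ p) (g := f))
    | |- measurable_fun _ (fun x => cos (@?f x)) =>
        apply: (measurableT_comp (continuous_measurable_fun (@continuous_cos _)) (g := f))
    | |- measurable_fun _ (fun x => sin (@?f x)) =>
        apply: (measurableT_comp (continuous_measurable_fun (@continuous_sin _)) (g := f))
    | |- measurable_fun _ (fun x => (@?f x).1) =>
        apply: (measurableT_comp measurable_fst (g := f))
    | |- measurable_fun _ (fun x => (@?f x).2) =>
        apply: (measurableT_comp measurable_snd (g := f))
    | |- measurable_fun _ (fun x => tnth (@?f x) ?i) =>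
        apply: (measurableT_comp (measurable_tnth i) (g := f))
    | |- measurable_fun _ (fun x => ?h (@?f x)) =>
       match goal with H : measurable_fun _ h |- _ => apply: (measurableT_comp H (g := f)) end
    end
  | meas_tuple ].
Ltac meas := rewrite /=; repeat meas_step.

(** * Iterated integrals: Tonelli, and Fubini under a product majorant *)

Section product_integrals.
Context d1 d2 (X : measurableType d1) (Y : measurableType d2) (R : realType).
Variable m1 : {sigma_finite_measure set X -> \bar R}.
Variable m2 : {sigma_finite_measure set Y -> \bar R}.

Lemma ge0_integral_swap (F : X -> Y -> \bar R) :
  measurable_fun setT (fun z : X * Y => F z.1 z.2) ->
  (forall x y, 0 <= F x y)%E ->
  (\int[m1]_x \int[m2]_y F x y = \int[m2]_y \int[m1]_x F x y)%E.
Proof.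
move=> mF F0.
by rewrite (@fubini_tonelli _ _ _ _ _ m1 m2 (fun z => F z.1 z.2))// => -[].
Qed.

Lemma ge0_measurable_integral2 (F : X -> Y -> \bar R) :
  measurable_fun setT (fun z : X * Y => F z.1 z.2) ->
  (forall x y, 0 <= F x y)%E -> measurable_fun setT (fun x => \int[m2]_y F x y)%E.
Proof.
move=> mF F0.
by apply: (measurable_fun_fubini_tonelli_F (fun z => F z.1 z.2)) => // -[].
Qed.

Lemma ge0_measurable_integral1 (F : X -> Y -> \bar R) :
  measurable_fun setT (fun z : X * Y => F z.1 z.2) ->
  (forall x y, 0 <= F x y)%E -> measurable_fun setT (fun y => \int[m1]_x F x y)%E.
Proof.
move=> mF F0.
by apply: (measurable_fun_fubini_tonelli_G (fun z => F z.1 z.2)) => // -[].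
Qed.

(** No integrability is assumed: Tonelli handles the positive and the negative part separately, and
    [fine] is measurable whatever the difference of the two integrals is. *)
Lemma measurable_Rintegral2 (F : X -> Y -> R) :
  measurable_fun setT (fun z : X * Y => F z.1 z.2) ->
  measurable_fun setT (fun x => \int[m2]_y F x y).
Proof.
move=> mF; apply: measurableT_comp => //.
pose g (z : X * Y) := (F z.1 z.2)%:E.
have mg : measurable_fun setT g by apply/measurable_EFinP.
under eq_fun do rewrite integralE.
apply: emeasurable_funB.
- apply: (ge0_measurable_integral2 (F := fun x y => ((fun y' => (F x y')%:E)^\+ y)%E)) => //.
  have := measurable_funepos mg; congr (measurable_fun _ _); by apply/funext => -[x y];
    rewrite /g !funeposE.
- apply: (ge0_measurable_integral2 (F := fun x y => ((fun y' => (F x y')%:E)^\- y)%E)) => //.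
  have := measurable_funeneg mg; congr (measurable_fun _ _); by apply/funext => -[x y];
    rewrite /g !funenegE.
Qed.

Section dominated.
Variables (H : X -> Y -> R) (A : X -> R) (B : Y -> R).
Hypotheses (mH : measurable_fun setT (fun z : X * Y => H z.1 z.2))
  (iA : m1.-integrable setT (EFin \o A)) (iB : m2.-integrable setT (EFin \o B))
  (HAB : forall x y, `|H x y| <= A x * B y).

Let mH2 x : measurable_fun setT (H x).
Proof. exact: (measurableT_comp mH (measurable_pair1 x)). Qed.

(** A majorant in product form makes every section integrable, not only almost every one.
    Real-valued inner integrals thus never hide an infinite value. *)
Lemma dominated_integrable2 x : m2.-integrable setT (EFin \o H x).
Proof.
apply: (@le_integrable _ _ _ m2 setT measurableT (EFin \o H x)
  (fun y => (A x)%:E * (B y)%:E)%E).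
- exact/measurable_EFinP.
- by move=> y _; rewrite /= lee_fin (le_trans (HAB x y))// ler_norm.
- exact: integrableZl.
Qed.

Lemma dominated_integrable_prod :
  (m1 \x m2)%E.-integrable setT (fun z => (H z.1 z.2)%:E).
Proof.
apply/(@integrable12ltyP _ _ X Y R m1 m2); first exact/measurable_EFinP.
have iB' : (\int[m2]_y `|(B y)%:E| < +oo)%E by case/integrableP : iB.
have mA : measurable_fun setT A by have /integrableP[/measurable_EFinP] := iA.
have mB : measurable_fun setT B by have /integrableP[/measurable_EFinP] := iB.
apply: (@le_lt_trans _ _ (\int[m1]_x (`|(A x)%:E| * \int[m2]_y `|(B y)%:E|))%E).
  apply: ge0_le_integral => //.
  - by move=> x _; exact: integral_ge0.
  - apply: (ge0_measurable_integral2 (F := fun x y => `|(H x y)%:E|%E)) => //.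
    by apply: measurableT_comp => //; exact/measurable_EFinP.
  - apply: emeasurable_funM => //.
    by apply: measurableT_comp => //; exact/measurable_EFinP.
  move=> x _; rewrite -ge0_integralZl//; last first.
    by apply: measurableT_comp => //; exact/measurable_EFinP.
  apply: ge0_le_integral => //.
  - by apply: measurableT_comp => //; apply/measurable_EFinP; exact: mH2.
  - apply: emeasurable_funM => //.
    by apply: measurableT_comp => //; exact/measurable_EFinP.
  by move=> y _; rewrite /= -EFinM lee_fin -normrM (le_trans (HAB x y))// ler_norm.
rewrite ge0_integralZr//.
- by case/integrableP : iA => _ iA'; rewrite lte_mul_pinfty// ?integral_ge0// ge0_fin_numE//
  integral_ge0.
- by apply: measurableT_comp => //; exact/measurable_EFinP.
- by rewrite integral_ge0.
Qed.

Lemma dominated_integrable_Rintegral2 :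
  m1.-integrable setT (fun x => (\int[m2]_y H x y)%:E).
Proof.
have := integrable_fubini_F dominated_integrable_prod.
apply: eq_integrable => // x _; rewrite /fubini_F /= fineK//.
exact: integrable_fin_num (dominated_integrable2 x).
Qed.

End dominated.
End product_integrals.

Section product_integrals_swap.
Context d1 d2 (X : measurableType d1) (Y : measurableType d2) (R : realType).
Variable m1 : {sigma_finite_measure set X -> \bar R}.
Variable m2 : {sigma_finite_measure set Y -> \bar R}.

Lemma Rintegral_swap (H : X -> Y -> R) (A : X -> R) (B : Y -> R) :
  measurable_fun setT (fun z : X * Y => H z.1 z.2) ->
  m1.-integrable setT (EFin \o A) -> m2.-integrable setT (EFin \o B) ->
  (forall x y, `|H x y| <= A x * B y) ->
  \int[m1]_x \int[m2]_y H x y = \int[m2]_y \int[m1]_x H x y.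
Proof.
move=> mH iA iB HAB.
have mH' : measurable_fun setT (fun z : Y * X => H z.2 z.1).
  apply: (measurableT_comp (f := fun z : X * Y => H z.1 z.2)
    (g := fun z : Y * X => (z.2, z.1))) => //; exact: measurable_fun_pair.
have HBA y x : `|H x y| <= B y * A x by rewrite mulrC.
congr fine.
transitivity (\int[m1]_x \int[m2]_y (H x y)%:E)%E.
  apply: eq_integral => x _; rewrite fineK//; apply: integrable_fin_num => //.
  exact: dominated_integrable2 HAB x.
rewrite (@Fubini _ _ X Y R m1 m2 (fun z => (H z.1 z.2)%:E))//; last first.
  exact: dominated_integrable_prod HAB.
apply: eq_integral => y _; rewrite fineK//; apply: integrable_fin_num => //.
exact: (dominated_integrable2 (m2 := m1) mH' iA HBA y).
Qed.

End product_integrals_swap.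
Arguments ge0_measurable_integral1 {d1 d2 X Y R m1} F.
Arguments ge0_measurable_integral2 {d1 d2 X Y R m2} F.
Arguments measurable_Rintegral2 {d1 d2 X Y R m2} F.

(** * Limits of integrals: dominated convergence and Fatou *)

Lemma cvg_integral_dominated d (T : measurableType d) (R : realType)
    (mu : {measure set T -> \bar R}) (f_ : nat -> T -> \bar R) (f g : T -> \bar R) :
  (forall n, measurable_fun setT (f_ n)) -> measurable_fun setT f ->
  {ae mu, forall x, f_ ^~ x @ \oo --> f x} ->
  mu.-integrable setT g ->
  (forall x n, `|f_ n x| <= g x)%E ->
  (\int[mu]_x f_ n x @[n --> \oo] --> \int[mu]_x f x)%E.
Proof.
move=> mf_ mf ff ig fg.
have ff' : {ae mu, forall x, setT x -> f_ ^~ x @ \oo --> f x}.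
  by apply: filterS ff => x + _.
have fg' : {ae mu, forall x n, setT x -> (`|f_ n x| <= g x)%E}.
  by apply: aeW => x n _; exact: fg.
by have [] := dominated_convergence measurableT mf_ mf ff' ig fg'.
Qed.

(** Fatou's lemma, in the form in which upper bounds are carried to a pointwise limit without a
    dominating function. The bounds [u] may themselves vary and converge. *)
Lemma ge0_integral_le_cvg d (T : measurableType d) (R : realType)
    (mu : {measure set T -> \bar R}) (f_ : nat -> T -> \bar R) (f : T -> \bar R)
    (u : nat -> \bar R) (l : \bar R) :
  (forall n, measurable_fun setT (f_ n)) -> (forall n x, 0 <= f_ n x)%E ->
  (forall x, f_ ^~ x @ \oo --> f x) ->
  (forall n, \int[mu]_x f_ n x <= u n)%E -> u @ \oo --> l ->
  (\int[mu]_x f x <= l)%E.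
Proof.
move=> mf f0 ff fu ul.
have fE x : limn_einf (f_ ^~ x) = f x.
  by rewrite is_cvg_limn_einfE; [exact/cvg_lim/ff|apply/cvg_ex; eexists; exact: ff].
under eq_integral do rewrite -fE.
apply: le_trans (fatou _ _ _ _) _ => //.
have <- : limn_einf u = l.
  by rewrite is_cvg_limn_einfE; [exact/cvg_lim/ul|apply/cvg_ex; eexists; exact: ul].
rewrite !limn_einf_lim; apply: lee_lim; [exact: is_cvg_einfs|exact: is_cvg_einfs|].
apply: nearW => n; apply: le_ereal_inf_tmp => _ [k /= nk <-].
by apply: ge_ereal_inf; exists (\int[mu]_x f_ k x)%E; [exists k|exact: fu].
Qed.

Lemma ge0_le_integralT d (T : measurableType d) (R : realType)
    (mu : {measure set T -> \bar R}) (f g : T -> \bar R) :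
  measurable_fun setT f -> measurable_fun setT g ->
  (forall x, 0 <= f x)%E -> (forall x, f x <= g x)%E ->
  (\int[mu]_x f x <= \int[mu]_x g x)%E.
Proof. by move=> mf mg f0 fg; apply: ge0_le_integral. Qed.

Lemma ge0_integralDT d (T : measurableType d) (R : realType)
    (mu : {measure set T -> \bar R}) (f g : T -> \bar R) :
  measurable_fun setT f -> measurable_fun setT g ->
  (forall x, 0 <= f x)%E -> (forall x, 0 <= g x)%E ->
  (\int[mu]_x (f x + g x) = \int[mu]_x f x + \int[mu]_x g x)%E.
Proof. by move=> mf mg f0 g0; apply: ge0_integralD. Qed.

Lemma ge0_integralZlT d (T : measurableType d) (R : realType)
    (mu : {measure set T -> \bar R}) (f : T -> \bar R) (k : \bar R) :
  measurable_fun setT f -> (forall x, 0 <= f x)%E -> (0 <= k)%E ->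
  (\int[mu]_x (k * f x) = k * \int[mu]_x f x)%E.
Proof. by move=> mf f0 k0; apply: ge0_integralZl. Qed.

(** * Lebesgue measure on R^d *)

Section lebesgue_Rn_cons.
Context {R : realType} (d : nat).
Local Notation leb := (@lebesgue_measure R).

Lemma tnth_cons0 (a : R) (x : Rn R d) : tnth (cons_point (a, x)) ord0 = a.
Proof. by []. Qed.

Lemma tnth_consS (a : R) (x : Rn R d) i :
  tnth (cons_point (a, x)) (lift ord0 i) = tnth x i.
Proof. by rewrite tnthS; congr tnth; exact/val_inj. Qed.

Lemma dotp_cons (a b : R) (x y : Rn R d) :
  dotp (cons_point (a, x)) (cons_point (b, y)) = a * b + dotp x y.
Proof.
rewrite /dotp big_ord_recl !tnth_cons0; congr +%R.
by apply: eq_bigr => i _; rewrite !tnth_consS.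
Qed.

Lemma cons_pointS (x : Rn R d.+1) : exists a y, x = cons_point (a, y).
Proof.
exists (thead x), [tuple of behead x]; rewrite [LHS]tuple_eta.
exact/val_inj.
Qed.

Lemma ge0_integral_cons (F : Rn R d.+1 -> \bar R) :
  measurable_fun setT F -> (forall x, 0 <= F x)%E ->
  (\int[lebesgue_Rn R d.+1]_x F x =
   \int[leb]_a \int[lebesgue_Rn R d]_x F (cons_point (a, x)))%E.
Proof.
move=> mF F0.
have mc := @measurable_cons_point R d.
transitivity (\int[leb \x lebesgue_Rn R d]_z (F \o @cons_point R d) z)%E.
  by rewrite [LHS](ge0_integral_pushforward mc)// => x _.
by rewrite fubini_tonelli1//; [exact: measurableT_comp|move=> x; exact: F0].
Qed.

End lebesgue_Rn_cons.

Lemma integral_Rn0 {R : realType} (F : Rn R 0 -> \bar R) :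
  (\int[lebesgue_Rn R 0]_x F x = F [tuple])%E.
Proof.
have F0 x : F x = F [tuple] by congr F; apply: eq_from_tnth => -[].
transitivity (\int[lebesgue_Rn R 0]_x cst (F [tuple]) x)%E; first by apply: eq_integral => x _;
  rewrite F0.
by rewrite integral_cst// /= diracT mule1.
Qed.

(** * Affine changes of variable *)

Section affine.
Context {R : realType}.
Local Notation leb := (@lebesgue_measure R).

(** One operation for translations ([r = 1]), differences ([r = -1], see [subp]) and the scaling of
    the heat kernel ([r = Num.sqrt t]). *)
Definition affine d (r : R) (c z : Rn R d) : Rn R d :=
  [tuple (tnth c i : R) + r * (tnth z i : R) | i < d].

Lemma tnth_affine d r (c z : Rn R d) i :
  tnth (affine r c z) i = (tnth c i : R) + r * (tnth z i : R).
Proof. by rewrite tnth_mktuple. Qed.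

Lemma affine_cons d r a b (c z : Rn R d) :
  affine r (cons_point (a, c)) (cons_point (b, z)) =
  cons_point (a + r * b, affine r c z).
Proof.
apply: eq_from_tnth => i; rewrite tnth_affine.
have [->|[j ->]] : i = ord0 \/ exists j, i = lift ord0 j.
  by case: (unliftP ord0 i) => [j|] ->; [right; exists j|left].
  by rewrite !tnth_cons0.
by rewrite !tnth_consS tnth_affine.
Qed.

Lemma measurable_affine_comp dX (X : measurableType dX) d r (f g : X -> Rn R d) :
  measurable_fun setT f -> measurable_fun setT g ->
  measurable_fun setT (fun x => affine r (f x) (g x)).
Proof.
move=> mf mg; apply/measurable_fun_tnthP => i.
rewrite (_ : _ \o _ = fun x => (tnth (f x) i : R) + r * (tnth (g x) i : R)); last first.
  by apply/funext => x /=; rewrite tnth_affine.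
by meas.
Qed.

Lemma measurable_affine d r (c : Rn R d) : measurable_fun setT (affine r c).
Proof. exact: measurable_affine_comp. Qed.

Lemma measurable_dotp_comp dX (X : measurableType dX) d (f g : X -> Rn R d) :
  measurable_fun setT f -> measurable_fun setT g ->
  measurable_fun setT (fun x => dotp (f x) (g x)).
Proof.
move=> mf mg; apply: measurable_sum => i.
by meas.
Qed.

Lemma measurable_enorm_comp dX (X : measurableType dX) d (f : X -> Rn R d) :
  measurable_fun setT f -> measurable_fun setT (fun x => enorm (f x)).
Proof.
move=> mf; apply: (measurableT_comp (f := @Num.sqrt R)).
  by apply: continuous_measurable_fun; exact: sqrt_continuous.
exact: measurable_dotp_comp.
Qed.

(** Lebesgue measure is determined by its values on half-open intervals, and [r] times its image
    under the affine map takes the same values there. *)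
Lemma ge0_integral_affine1 (F : R -> \bar R) (c r : R) : 0 < r ->
  measurable_fun setT F -> (forall x, 0 <= F x)%E ->
  (\int[leb]_x F x = r%:E * \int[leb]_x F (c + r * x)%R)%E.
Proof.
move=> r0 mF F0.
have mphi : measurable_fun setT (fun x : measurableTypeR R => c + r * x : measurableTypeR R).
  by meas.
have [P PE] : exists P : {measure set (measurableTypeR R) -> \bar R},
    P = pushforward leb (fun x : measurableTypeR R => c + r * x : measurableTypeR R) :> (set _
      -> \bar R).
  by unshelve (eexists (pushforward leb (fun x : measurableTypeR R => c + r * x :
    measurableTypeR R) : {measure set _ -> \bar R})).
pose nu := mscale (NngNum (ltW r0)) P.
have leb_nu A : measurable A -> leb A = nu A.
  apply: lebesgue_measure_unique => _ [[a b] _ <-] /=.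
  rewrite /nu /mscale /= PE /pushforward.
  rewrite (_ : _ @^-1` _ = `](a - c) / r, (b - c) / r]%classic); last first.
    apply/seteqP; split => x /=; rewrite !in_itv/= ltr_pdivrMr// ler_pdivlMr//; lra.
  rewrite !lebesgue_measure_itv/= !lte_fin.
  rewrite ltr_pM2r ?invr_gt0// ltrD2r; case: ifPn => ab; last by rewrite mule0.
  by rewrite -!EFinD -EFinM; congr EFin; field; rewrite gt_eqF.
rewrite (eq_measure_integral nu); last by move=> A mA _; exact: leb_nu.
rewrite ge0_integral_mscale//; congr (_ * _)%E.
rewrite (eq_measure_integral (pushforward leb (fun x : measurableTypeR R => c + r * x :
  measurableTypeR R)))//; last by rewrite PE.
by rewrite ge0_integral_pushforward// => x _.
Qed.

(** Induction on the dimension: each coordinate split off by [ge0_integral_cons] contributes one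
    factor [r]. *)
Lemma ge0_integral_affine d (F : Rn R d -> \bar R) (c : Rn R d) (r : R) : 0 < r ->
  measurable_fun setT F -> (forall x, 0 <= F x)%E ->
  (\int[lebesgue_Rn R d]_x F x = (r ^+ d)%:E * \int[lebesgue_Rn R d]_x F (affine r c x))%E.
Proof.
move=> r0; elim: d F c => [|d IH] F c mF F0.
  by rewrite !integral_Rn0 expr0 mul1e; congr F; apply: eq_from_tnth => -[].
have [a [y ->]] := cons_pointS c.
have mFc := measurableT_comp mF (@measurable_cons_point R d).
have mFc2 (b : R) : measurable_fun setT (fun x => F (cons_point (b, x))).
  exact: (measurableT_comp mFc (measurable_pair1 b)).
have mFa : measurable_fun setT (fun z : R * Rn R d =>
    F (cons_point (z.1, affine r y z.2))).
  apply: (measurableT_comp (f := F \o @cons_point R d)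
    (g := fun z : R * Rn R d => (z.1, affine r y z.2))) => //.
  by apply: measurable_fun_pair => //; exact: measurable_affine_comp.
rewrite !ge0_integral_cons//; last first.
  exact: measurableT_comp (measurable_affine _ _).
pose G b := (\int[lebesgue_Rn R d]_x F (cons_point (b, affine r y x)))%E.
have mG : measurable_fun setT G.
  exact: (ge0_measurable_integral2 (fun b x => F (cons_point (b, affine r y x)))).
have G0 b : (0 <= G b)%E by exact: integral_ge0.
have rd0 : (0 <= (r ^+ d)%:E)%E by rewrite lee_fin exprn_ge0// ltW.
transitivity (\int[leb]_b ((r ^+ d)%:E * G b))%E.
  by apply: eq_integral => b _; rewrite (IH _ y).
have -> := ge0_integralZl leb measurableT mG (fun b _ => G0 b) rd0.
have -> := @ge0_integral_affine1 G a r r0 mG G0.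
rewrite muleA -EFinM mulrC -exprS; congr (_ * _)%E; apply: eq_integral => b _.
by apply: eq_integral => x _; rewrite affine_cons.
Qed.

End affine.

Ltac meas_tuple ::= lazymatch goal with
    | |- measurable_fun _ (fun x => affine ?r (@?f x) (@?g x)) =>
        apply: (measurable_affine_comp r (f := f) (g := g))
    | |- measurable_fun _ (fun x => dotp (@?f x) (@?g x)) =>
        apply: (measurable_dotp_comp (f := f) (g := g))
    | |- measurable_fun _ (fun x => enorm (@?f x)) => apply: (measurable_enorm_comp (f := f))
    end.

(** * Volumes of balls and the area of the unit sphere *)

Section balls.
Context {R : realType}.
Local Notation leb := (@lebesgue_measure R).

Lemma enorm_ge0 d (x : Rn R d) : 0 <= enorm x. Proof. exact: sqrtr_ge0. Qed.

Lemma dotp_ge0 d (x : Rn R d) : 0 <= dotp x x.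
Proof. by apply: sumr_ge0 => i _; rewrite -expr2 sqr_ge0. Qed.

Lemma enorm_sqr d (x : Rn R d) : enorm x ^+ 2 = dotp x x.
Proof. by rewrite sqr_sqrtr// dotp_ge0. Qed.

Lemma le_tnth_enorm d (x : Rn R d) i : `|tnth x i| <= enorm x.
Proof.
rewrite -ler_sqr ?nnegrE ?enorm_ge0// enorm_sqr real_normK ?num_real//.
rewrite /dotp (bigD1 i)//= -expr2 lerDl.
by apply: sumr_ge0 => j _; rewrite -expr2 sqr_ge0.
Qed.

Definition origin d : Rn R d := [tuple 0 | i < d].

Lemma tnth_origin d i : tnth (origin d) i = 0.
Proof. by rewrite tnth_mktuple. Qed.

Lemma enorm_eq0 d (x : Rn R d) : (enorm x == 0) = (x == origin d).
Proof.
apply/eqP/eqP => [x0|->].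
  apply: eq_from_tnth => i; rewrite tnth_origin; apply/eqP; rewrite -normr_eq0.
  by rewrite eq_le normr_ge0 -x0 le_tnth_enorm.
rewrite /enorm (_ : dotp _ _ = 0) ?sqrtr0// /dotp big1// => i _.
by rewrite tnth_origin mul0r.
Qed.

Lemma enorm_scalep d (r : R) (x : Rn R d) : 0 <= r -> enorm (scalep r x) = r * enorm x.
Proof.
move=> r0; rewrite /enorm (_ : dotp _ _ = r ^+ 2 * dotp x x).
  by rewrite sqrtrM ?sqr_ge0// sqrtr_sqr ger0_norm.
rewrite /dotp mulr_sumr; apply: eq_bigr => i _; rewrite !tnth_mktuple.
by rewrite mulrACA expr2.
Qed.

Lemma measurable_enorm_le d r : measurable [set x : Rn R d | enorm x <= r].
Proof.
rewrite (_ : [set _ | _] = (fun x : Rn R d => enorm x) @^-1` `]-oo, r]%classic); last first.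
  by apply/seteqP; split => x /=; rewrite in_itv.
rewrite -[X in measurable X]setTI.
by apply: measurable_enorm_comp => //; exact: measurable_id.
Qed.

(** This ties [sphere_area], which is defined through cones, to the volume of the unit ball. In
    positive dimension the origin also lies in the cone, as 0 times some unit vector. *)
Lemma cone_unit_sphere d : (0 < d)%N ->
  cone (@unit_sphere R d) = [set x | enorm x <= 1].
Proof.
move=> d0; apply/seteqP; split => x /=.
  by move=> [r [y [/andP[r0 r1] y1 ->]]]; rewrite enorm_scalep// y1 mulr1.
move=> x1; have [x0|x0] := eqVneq x (origin d).
  exists 0, [tuple (i == Ordinal d0)%:R | i < d]; split => //.
  - by rewrite lexx ler01.
  - rewrite /unit_sphere /= /enorm /dotp (bigD1 (Ordinal d0))//= !tnth_mktuple eqxx mulr1.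
    rewrite big1 ?addr0 ?sqrtr1// => i i0.
    by rewrite !tnth_mktuple (negPf i0) mulr0.
  - rewrite x0; apply: eq_from_tnth => i.
    by rewrite tnth_origin tnth_mktuple mul0r.
have nx0 : enorm x != 0 by rewrite enorm_eq0.
exists (enorm x), (scalep (enorm x)^-1 x); split.
- by rewrite enorm_ge0.
- by rewrite /unit_sphere /= enorm_scalep ?invr_ge0 ?enorm_ge0// mulVf.
- by apply: eq_from_tnth => i; rewrite !tnth_mktuple mulVKf.
Qed.

(** [sphere_area] is taken with [fine], so its link with the ball requires a finite volume. The ball
    lies in [[-1, 1]] times the unit ball of one dimension less. *)
Lemma unit_ball_lty d : (lebesgue_Rn R d [set x | (enorm x <= 1)%R] < +oo)%E.
Proof.
elim: d => [|d IH].
  rewrite /= diracE; by case: (_ \in _); rewrite ltry.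
have mc := @measurable_cons_point R d.
apply: (@le_lt_trans _ _ ((leb \x lebesgue_Rn R d)%E
   (`[(-1)%R, 1%R]%classic `*` [set x : Rn R d | (enorm x <= 1)%R])))%E.
  rewrite /= /lebesgue_step /pushforward; apply: le_measure.
  - rewrite inE -[X in measurable X]setTI; apply: mc => //.
    exact: measurable_enorm_le.
  - by rewrite inE; apply: measurableX => //; exact: measurable_enorm_le.
  - move=> -[a x] /= h; split => /=.
      rewrite in_itv/= -ler_norml; apply: le_trans h.
      exact: (le_tnth_enorm (cons_point (a, x)) ord0).
    apply: le_trans h; rewrite /enorm dotp_cons ler_wsqrtr//.
    by rewrite lerDr -expr2 sqr_ge0.
rewrite product_measure1E//; last exact: measurable_enorm_le.
rewrite lte_mul_pinfty//.
suff : leb `[(-1)%R, 1%R]%classic \is a fin_num by [].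
by rewrite lebesgue_measure_itv/=; case: ifPn.
Qed.

Lemma unit_ball_volume d : (0 < d)%N ->
  lebesgue_Rn R d [set x | enorm x <= 1] = (sphere_area R d / d%:R)%:E.
Proof.
move=> d0; rewrite /sphere_area /surface_measure cone_unit_sphere//.
have := unit_ball_lty d; rewrite -ge0_fin_numE// => fin.
rewrite -(fineK fin) -EFinM /= mulrC mulKf// pnatr_eq0 -lt0n//.
Qed.

Definition subp d (x y : Rn R d) : Rn R d := affine (-1) x y.

Lemma tnth_subp d (x y : Rn R d) i : tnth (subp x y) i = (tnth x i : R) - (tnth y i : R).
Proof. by rewrite tnth_affine mulN1r. Qed.

Lemma measurable_subp_le d (x : Rn R d) (r : R) :
  measurable [set y | enorm (subp x y) <= r].
Proof.
rewrite (_ : [set _ | _] = (fun y : Rn R d => enorm (subp x y)) @^-1` `]-oo, r]%classic);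
  last first.
  by apply/seteqP; split => y /=; rewrite in_itv.
rewrite -[X in measurable X]setTI.
by apply: measurable_enorm_comp => //; exact: measurable_affine.
Qed.

Lemma measurable_point d (x : Rn R d) : measurable [set x].
Proof.
rewrite (_ : [set x] = [set y | enorm (subp x y) <= 0]); first exact: measurable_subp_le.
apply/seteqP; split => y /=.
  move=> ->; rewrite le_eqVlt enorm_eq0; apply/orP; left; apply/eqP.
  by apply: eq_from_tnth => i; rewrite tnth_subp tnth_origin subrr.
move=> h; have /eqP : enorm (subp x y) == 0 by rewrite eq_le h enorm_ge0.
move=> /eqP; rewrite enorm_eq0 => /eqP h0; apply: eq_from_tnth => i.
by have := congr1 (fun z : Rn R d => tnth z i) h0; rewrite tnth_subp tnth_origin => /subr0_eq.
Qed.

Lemma ball_volume d (x : Rn R d) (r : R) : (0 < d)%N -> 0 < r ->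
  lebesgue_Rn R d [set y | enorm (subp x y) <= r] = (r ^+ d * (sphere_area R d / d%:R))%:E.
Proof.
move=> d0 r0.
have mA := measurable_subp_le x r.
rewrite -(setIT [set y | _]) -integral_indic//.
rewrite (@ge0_integral_affine _ _ _ x r)//; last by apply/measurable_EFinP;
  exact: measurable_indic.
rewrite EFinM; congr (_ * _)%E; rewrite -unit_ball_volume//.
rewrite -[in RHS](setIT [set x0 | _]) -integral_indic//; last exact: measurable_enorm_le.
apply: eq_integral => z _; congr EFin; rewrite !indicE; congr ((_ : bool)%:R).
apply/idP/idP; rewrite !inE/= => h.
  move: h; rewrite (_ : enorm _ = r * enorm z) ?ger_pMr//.
  rewrite -enorm_scalep ?(ltW r0)// /enorm; congr Num.sqrt.
  rewrite /dotp; apply: eq_bigr => i _; rewrite tnth_subp tnth_affine tnth_mktuple; ring.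
rewrite (_ : enorm _ = r * enorm z) ?ger_pMr//.
rewrite -enorm_scalep ?(ltW r0)// /enorm; congr Num.sqrt.
rewrite /dotp; apply: eq_bigr => i _; rewrite tnth_subp tnth_affine tnth_mktuple; ring.
Qed.

(** Used to discard the frequency 0 and the diagonal of the Riesz kernel, where [powR] takes a
    conventional value. *)
Lemma lebesgue_Rn_set1 d (x : Rn R d) : (0 < d)%N -> lebesgue_Rn R d [set x] = 0%E.
Proof.
case: d x => // d x _; have [a [y ->]] := cons_pointS x.
rewrite /= /lebesgue_step /pushforward.
rewrite (_ : _ @^-1` _ = [set a] `*` [set y]); last first.
  apply/seteqP; split => -[b z] /=.
    by move/(congr1 (@uncons_point R d)); rewrite !cons_pointK => -[-> ->].
  by move=> [-> ->].
have my := measurable_point y.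
rewrite product_measure1E//; set m := (X in (X * _)%E).
have -> : m = 0%E by exact: lebesgue_measure_set1.
by rewrite mul0e.
Qed.

End balls.

(** * Gaussian integrals *)

Section gauss_cos.
Context {R : realType}.
Local Notation leb := (@lebesgue_measure R).

(** Integration by parts on the whole line: the fundamental theorem on bounded intervals, whose
    boundary terms tend to zero, and dominated convergence of the integrals over these intervals. *)
Lemma integral_derivative_eq0 (g g' : R -> R) :
  (forall x : R, is_derive x 1 g (g' x)) -> continuous g' ->
  leb.-integrable setT (EFin \o g') ->
  g n%:R @[n --> \oo] --> 0 -> g (- n%:R) @[n --> \oo] --> 0 ->
  \int[leb]_x g' x = 0.
Proof.
move=> dg cg' ig' gp gn.
(* With [n.+1] the interval is nondegenerate for every [n], as the fundamental theorem requires. *)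
pose I n : set R := `[- n.+1%:R, n.+1%:R]%classic.
have cg : continuous g.
  by move=> x; apply/differentiable_continuous/derivable1_diffP; case: (dg x).
have IE n : (\int[leb]_(x in I n) (g' x)%:E = (g n.+1%:R)%:E - (g (- n.+1%:R))%:E)%E.
  apply: continuous_FTC2 => //.
  - by rewrite (@lt_trans _ _ 0)// ?oppr_lt0 ltr0n.
  - exact: continuous_subspaceT.
  - split.
    + by move=> x _; case: (dg x).
    + exact/cvg_at_right_filter/cg.
    + exact/cvg_at_left_filter/cg.
  - by move=> x _; rewrite derive1E; case: (dg x).
have [mg' _] := integrableP _ _ _ ig'.
have mI n : measurable (I n) by exact: measurable_itv.
have : (\int[leb]_(x in I n) (g' x)%:E @[n --> \oo] --> \int[leb]_x (g' x)%:E)%E.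
  have -> : (fun n => \int[leb]_(x in I n) (g' x)%:E)%E =
    (fun n => \int[leb]_x (((EFin \o g') \_ (I n)) x))%E.
    by apply/funext => n; rewrite integral_mkcond.
  apply: (@cvg_integral_dominated _ _ _ leb _ _ (fun x => `|(g' x)%:E|%E)) => //.
  - by move=> n; apply/(measurable_restrict _ (mI n) measurableT); rewrite setTI;
    exact: measurable_funTS.
  - apply: aeW => x; apply: cvg_near_cst.
    exists (Num.bound `|x|) => // n /= nx; rewrite patchE mem_set// /I /= in_itv/=.
    rewrite -ler_norml (le_trans (ltW (archi_boundP (normr_ge0 x))))//.
    by rewrite ler_nat (leq_trans nx).
  - exact: integrable_abse.
  - move=> x n; rewrite patchE; case: ifPn => // _.
    by rewrite abse0.
under eq_fun do rewrite IE.
have : ((g n.+1%:R)%:E - (g (- n.+1%:R))%:E)%E @[n --> \oo] --> (0 - 0)%:E.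
  apply: cvg_EFin; first exact: nearW.
  by apply: cvgB; [move: gp|move: gn]; rewrite -cvg_shiftS.
rewrite subr0 => h1 h2.
by rewrite /Rintegral (cvg_unique _ h2 h1).
Qed.

Lemma ge0_integral_gauss (t : R) : 0 < t ->
  (\int[leb]_x (expR (- t * x ^+ 2))%:E = (Num.sqrt (pi / t))%:E)%E.
Proof.
move=> t0.
have st0 : 0 < Num.sqrt t by rewrite sqrtr_gt0.
have := @integralT_gauss R.
rewrite (@ge0_integral_affine1 _ _ 0 (Num.sqrt t))//; last 2 first.
- by apply/measurable_EFinP; exact: measurable_gauss_fun.
- by move=> x; rewrite lee_fin gauss_fun_ge0.
have -> : (\int[leb]_x (gauss_fun (0 + Num.sqrt t * x)%R)%:E =
    \int[leb]_x (expR (- t * x ^+ 2))%:E)%E.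
  apply: eq_integral => x _; congr EFin.
  by rewrite /gauss_fun add0r exprMn sqr_sqrtr ?ltW// mulNr.
move=> h; rewrite sqrtrM ?pi_ge0// sqrtrV ?ltW// EFinM -h.
by rewrite muleAC -EFinM mulfV ?gt_eqF// mul1e.
Qed.

Lemma integrable_gauss (t : R) : 0 < t ->
  leb.-integrable setT (fun x => (expR (- t * x ^+ 2))%:E).
Proof.
move=> t0; apply/integrableP; split; first by meas.
under eq_integral do rewrite gee0_abs ?lee_fin ?expR_ge0//.
by rewrite ge0_integral_gauss// ltry.
Qed.

(** Half of the exponent absorbs the factor: with b = t x^2 / 2, |x| <= 1 + x^2 = 1 + (2 / t) b <=
    (1 + 2 / t) (1 + b), and 1 + b <= e^b. The result is an integrable majorant for differentiation
    under the integral. *)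
Lemma norm_mul_gauss_le (t x : R) : 0 < t ->
  `|x| * expR (- t * x ^+ 2) <= (1 + 2 / t) * expR (- (t / 2) * x ^+ 2).
Proof.
move=> t0.
have -> : expR (- t * x ^+ 2) = expR (- (t / 2) * x ^+ 2) * expR (- (t / 2) * x ^+ 2).
  by rewrite -expRD; congr expR; field.
rewrite mulrA ler_wpM2r ?expR_ge0//.
have -> : expR (- (t / 2) * x ^+ 2) = (expR (t / 2 * x ^+ 2))^-1.
  by rewrite -expRN mulNr.
rewrite ler_pdivrMr ?expR_gt0//.
have h := expR_ge1Dx (t / 2 * x ^+ 2).
have x2 : `|x| <= 1 + x ^+ 2.
  rewrite -[x ^+ 2]real_normK ?num_real//; set y := `|x|; nra.
apply: le_trans x2 _.
have -> : 1 + x ^+ 2 = 1 + (2 / t) * (t / 2 * x ^+ 2) by field; rewrite gt_eqF.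
have : 0 <= t / 2 * x ^+ 2 by rewrite mulr_ge0 ?sqr_ge0// divr_ge0// ltW.
have : 0 <= 2 / t by rewrite divr_ge0// ltW.
set a := 2 / t; set b := t / 2 * _; move: h; rewrite -/b; set e := expR b.
move=> *; nra.
Qed.

Lemma integrable_gauss_bounded (t : R) (h : R -> R) : 0 < t ->
  measurable_fun setT h -> (forall x, `|h x| <= 1) ->
  leb.-integrable setT (fun x => (expR (- t * x ^+ 2) * h x)%:E).
Proof.
move=> t0 mh h1; apply: (le_integrable _ _ _ (integrable_gauss t0)) => //.
  by meas.
move=> x _; rewrite /= lee_fin normrM !(ger0_norm (expR_ge0 _)).
by rewrite ler_piMr ?expR_ge0.
Qed.

Lemma integrable_xgauss_bounded (t : R) (h : R -> R) : 0 < t ->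
  measurable_fun setT h -> (forall x, `|h x| <= 1) ->
  leb.-integrable setT (fun x => (x * expR (- t * x ^+ 2) * h x)%:E).
Proof.
move=> t0 mh h1.
have t20 : 0 < t / 2 by rewrite divr_gt0.
apply: (@le_integrable _ _ _ leb setT measurableT _
  (fun x => ((1 + 2 / t)%:E * (expR (- (t / 2) * x ^+ 2))%:E)%E)).
- by meas.
- have t1 : 0 <= 1 + 2 / t by rewrite addr_ge0// divr_ge0// ltW.
  move=> x _; rewrite /= lee_fin !normrM (ger0_norm t1) !(ger0_norm (expR_ge0 _)).
  apply: le_trans (norm_mul_gauss_le x t0).
  by rewrite ler_piMr// mulr_ge0// expR_ge0.
- apply: integrableZl => //; exact: integrable_gauss.
Qed.

(** Up to sign, the derivative in [z] of the Gaussian cosine integral. *)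
Let gsin (t z c : R) := \int[leb]_x (x * expR (- t * x ^+ 2) * sin (z * x + c)).

Lemma norm_cos_le1 (x : R) : `|cos x| <= 1. Proof. exact: cos_max. Qed.

Lemma norm_sin_le1 (x : R) : `|sin x| <= 1.
Proof. by rewrite -cosBpihalf cos_max. Qed.

Lemma is_derive_integral_gauss_cos (t z c : R) : 0 < t ->
  is_derive z (1 : R) (fun z => \int[leb]_x (expR (- t * x ^+ 2) * cos (z * x + c)))
    (- gsin t z c).
Proof.
move=> t0.
pose f (z x : R) := expR (- t * x ^+ 2) * cos (z * x + c).
pose G (x : R) := (1 + 2 / t) * expR (- (t / 2) * x ^+ 2).
have df (y x : R) : is_derive y (1 : R) (f^~ x) (- (x * expR (- t * x ^+ 2) * sin (y * x + c))).
  by apply: is_derive_eq; rewrite /GRing.scale /=; ring.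
have partE (y x : R) : partial1of2 f y x = - (x * expR (- t * x ^+ 2) * sin (y * x + c)).
  by rewrite partial1of2E; case: (df y x).
have Iz : `](z - 1), (z + 1)[%classic z.
  by rewrite /= in_itv/= ltrBlDr ltrDl ltr01.
have intf (x : R) : `](z - 1), (z + 1)[%classic x -> leb.-integrable setT (EFin \o f x).
  move=> _; apply: integrable_gauss_bounded => //; first by meas.
  by move=> y; exact: norm_cos_le1.
have derf (x y : R) : `](z - 1), (z + 1)[%classic x -> setT y -> derivable (f^~ y) x 1.
  by move=> _ _; case: (df x y).
have G0 x : 0 <= G x.
  by rewrite mulr_ge0 ?expR_ge0// addr_ge0// divr_ge0// ltW.
have iG : leb.-integrable setT (EFin \o G).
  have t20 : 0 < t / 2 by rewrite divr_gt0.
  exact: (integrableZl measurableT (1 + 2 / t) (integrable_gauss t20)).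
have GB (x y : R) : `](z - 1), (z + 1)[%classic x -> setT y -> `|partial1of2 f x y| <= G y.
  move=> _ _; rewrite partE normrN !normrM [X in _ * X * _]ger0_norm ?expR_ge0//.
  apply: le_trans (norm_mul_gauss_le y t0).
  by rewrite ler_piMr ?norm_sin_le1// mulr_ge0// expR_ge0.
have h1 := derivable_under_integral measurableT Iz intf derf G0 iG GB.
have h2 := differentiation_under_integral measurableT Iz intf derf G0 iG GB.
apply: DeriveDef; first exact: h1.
rewrite -derive1E h2 /gsin /=.
rewrite -mulN1r -RintegralZl//; last first.
  apply: integrable_xgauss_bounded => //; first by meas.
  by move=> x; exact: norm_sin_le1.
by apply: eq_Rintegral => x _; rewrite partE mulN1r.
Qed.

Lemma cvg_expR_sqr_n (t : R) : 0 < t -> expR (- t * n%:R ^+ 2) @[n --> \oo] --> (0 : R).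
Proof.
move=> t0.
apply/cvgrPdist_le => e e0.
(* For [n >= 1], e^(-t n^2) <= 1 / (t n^2) <= 1 / (t n), which is at most [e] once n >= 1 / (t e).
   The added 1 makes [n] positive. *)
exists (Num.bound (1 / (t * e)) + 1)%N => // n /= nN.
rewrite sub0r normrN ger0_norm ?expR_ge0//.
have n0 : (0 < n)%N by apply: leq_trans nN; rewrite addn1.
have h := expR_ge1Dx (t * n%:R ^+ 2).
rewrite mulNr expRN.
have n1 : (1 : R) <= n%:R by rewrite ler1n.
have : 1 / (t * e) <= n%:R.
  apply: ltW; apply: lt_le_trans (archi_boundP _) _.
    by rewrite divr_ge0// mulr_ge0// ltW.
  by rewrite ler_nat (leq_trans _ nN)// addn1.
rewrite ler_pdivrMr ?mulr_gt0// => h1.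
rewrite -[e]invrK lef_pV2 ?posrE ?expR_gt0 ?invr_gt0//.
apply: le_trans h; rewrite -[X in X <= _]mul1r ler_pdivrMr//; nra.
Qed.

(** The derivative of e^(-t x^2) sin(z x + c) integrates to zero. Its two terms express the
    derivative of the cosine integral through that integral. *)
Lemma gsinE (t z c : R) : 0 < t ->
  2 * t * gsin t z c = z * \int[leb]_x (expR (- t * x ^+ 2) * cos (z * x + c)).
Proof.
move=> t0.
pose g (x : R) := expR (- t * x ^+ 2) * sin (z * x + c).
pose g' (x : R) := - (2 * t) * (x * expR (- t * x ^+ 2) * sin (z * x + c))
    + z * (expR (- t * x ^+ 2) * cos (z * x + c)).
have i1 : leb.-integrable setT (fun x => (x * expR (- t * x ^+ 2) * sin (z * x + c))%:E).
  by apply: integrable_xgauss_bounded => //; [meas|move=> x; exact: norm_sin_le1].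
have i2 : leb.-integrable setT (fun x => (expR (- t * x ^+ 2) * cos (z * x + c))%:E).
  by apply: integrable_gauss_bounded => //; [meas|move=> x; exact: norm_cos_le1].
have i1' := integrableZl measurableT (- (2 * t)) i1.
have i2' := integrableZl measurableT z i2.
have : \int[leb]_x g' x = 0.
  apply: (@integral_derivative_eq0 g) => //.
  - move=> x; apply: is_derive_eq.
    by rewrite /g' /GRing.scale /=; ring.
  - have cE : continuous (fun x : R => expR (- t * x ^+ 2)).
      move=> x; apply: continuous_comp; last exact: continuous_expR.
      by apply: cvgM; [exact: cvg_cst|exact: exprn_continuous].
    have cL : continuous (fun x : R => z * x + c).
      by move=> x; apply: cvgD; [apply: cvgM; [exact: cvg_cst|exact: cvg_id]|exact: cvg_cst].
    move=> x; apply: cvgD; (apply: cvgM; first exact: cvg_cst).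
      apply: cvgM; first by apply: cvgM; [exact: cvg_id|exact: cE].
      by apply: continuous_comp; [exact: cL|exact: continuous_sin].
    apply: cvgM; first exact: cE.
    by apply: continuous_comp; [exact: cL|exact: continuous_cos].
  - have := integrableD measurableT i1' i2'; apply: eq_integrable => //.
  - apply: (@squeeze_cvgr _ _ _ _ (fun n => - expR (- t * n%:R ^+ 2)) (fun n => expR (- t *
    n%:R ^+ 2))).
    + apply: nearW => n; rewrite -ler_norml /g normrM ger0_norm ?expR_ge0//.
      by rewrite ler_piMr ?expR_ge0 ?norm_sin_le1.
    + by rewrite -oppr0; apply: cvgN; exact: cvg_expR_sqr_n.
    + exact: cvg_expR_sqr_n.
  - apply: (@squeeze_cvgr _ _ _ _ (fun n => - expR (- t * n%:R ^+ 2)) (fun n => expR (- t *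
    n%:R ^+ 2))).
    + apply: nearW => n; rewrite -ler_norml /g normrM ger0_norm ?expR_ge0// sqrrN.
      by rewrite ler_piMr ?expR_ge0 ?norm_sin_le1.
    + by rewrite -oppr0; apply: cvgN; exact: cvg_expR_sqr_n.
    + exact: cvg_expR_sqr_n.
rewrite /g' RintegralD// !RintegralZl// -/(gsin t z c) mulNr => /eqP.
by rewrite addrC subr_eq0 => /eqP.
Qed.

(** As a function of [z], the integral F satisfies F' = - z / (2 t) F, so F e^(z^2 / (4 t)) is
    constant and is evaluated at 0. The phase [c] serves twice: [c = - pi / 2] turns the cosine into
    a sine, and in several dimensions it receives the contribution of the other coordinates. *)
Lemma integral_gauss_cos (t z c : R) : 0 < t ->
  \int[leb]_x (expR (- t * x ^+ 2) * cos (z * x + c)) =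
  cos c * Num.sqrt (pi / t) * expR (- (z ^+ 2 / (4 * t))).
Proof.
move=> t0.
pose F z := \int[leb]_x (expR (- t * x ^+ 2) * cos (z * x + c)).
have dF y : is_derive y (1 : R) F (- (y / (2 * t) * F y)).
  have := is_derive_integral_gauss_cos y c t0.
  have -> : gsin t y c = y / (2 * t) * F y.
    rewrite mulrAC -(gsinE _ _ t0) mulrC mulKf// gt_eqF// mulr_gt0//.
  by [].
have dK y : is_derive y (1 : R) (fun y => F y * expR (y ^+ 2 / (4 * t))) 0.
  apply: is_derive_eq; rewrite /GRing.scale /=; field.
  by rewrite gt_eqF.
have F0E : F 0 = cos c * Num.sqrt (pi / t).
  rewrite /F; under eq_Rintegral do rewrite mul0r add0r mulrC.
  rewrite RintegralZl//; last exact: integrable_gauss.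
  by rewrite /Rintegral ge0_integral_gauss.
have := is_derive_0_is_cst z 0 dK.
rewrite /= expr0n /= mul0r expR0 mulr1 F0E expRN => <-.
by rewrite mulfK// gt_eqF// expR_gt0.
Qed.

End gauss_cos.

Section gauss_Rn.
Context {R : realType}.
Local Notation leb := (@lebesgue_measure R).

Lemma Rintegral_cons d (f : Rn R d.+1 -> R) (A : R -> R) (B : Rn R d -> R) :
  measurable_fun setT f ->
  leb.-integrable setT (EFin \o A) -> (lebesgue_Rn R d).-integrable setT (EFin \o B) ->
  (forall a x, `|f (cons_point (a, x))| <= A a * B x) ->
  \int[lebesgue_Rn R d.+1]_x f x = \int[leb]_a \int[lebesgue_Rn R d]_x f (cons_point (a, x)).
Proof.
move=> mf iA iB fAB; congr fine.
have mc := @measurable_cons_point R d.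
have mH : measurable_fun setT (fun z : measurableTypeR R * Rn R d => f (cons_point (z.1, z.2))).
  apply: (measurableT_comp mf (g := fun z : measurableTypeR R * Rn R d => cons_point (z.1, z.2))).
  by rewrite (_ : (fun z => _) = @cons_point R d)//; apply/funext => -[].
have iH := dominated_integrable_prod mH iA iB fAB.
transitivity (\int[leb \x lebesgue_Rn R d]_z (EFin \o f \o @cons_point R d) z)%E.
  have mE : measurable_fun setT (EFin \o f) by apply/measurable_EFinP.
  have iE : (leb \x lebesgue_Rn R d)%E.-integrable (@cons_point R d @^-1` setT)
      (EFin \o f \o @cons_point R d).
    by rewrite preimage_setT; apply: eq_integrable iH => // -[a x] _.
  by rewrite [LHS](integral_pushforward mc mE iE measurableT) preimage_setT.
rewrite -(@integral12_prod_meas1 _ _ _ _ _ leb (lebesgue_Rn R d)); last first.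
  by apply: eq_integrable iH => // -[a x] _.
apply: eq_integral => a _; rewrite /fubini_F /= fineK//; apply: integrable_fin_num => //.
exact: (dominated_integrable2 mH iB fAB a).
Qed.

Lemma ge0_integral_gauss_Rn d (t : R) : 0 < t ->
  (\int[lebesgue_Rn R d]_x (expR (- t * dotp x x))%:E = (Num.sqrt (pi / t) ^+ d)%:E)%E.
Proof.
move=> t0; elim: d => [|d IH].
  by rewrite integral_Rn0 /dotp big_ord0 mulr0 expR0 expr0.
rewrite ge0_integral_cons//; last by meas.
transitivity (\int[leb]_a ((Num.sqrt (pi / t) ^+ d)%:E * (expR (- t * a ^+ 2))%:E))%E.
  apply: eq_integral => a _; rewrite -IH muleC -ge0_integralZl//; last by meas.
  by apply: eq_integral => x _; rewrite -EFinM -expRD dotp_cons mulrDr expr2.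
have K0 : (0 <= (Num.sqrt (pi / t) ^+ d)%:E)%E by rewrite lee_fin exprn_ge0// sqrtr_ge0.
rewrite ge0_integralZl//; last by meas.
by rewrite ge0_integral_gauss// -EFinM mulrC exprS.
Qed.

Lemma integrable_gauss_Rn d (t : R) : 0 < t ->
  (lebesgue_Rn R d).-integrable setT (fun x => (expR (- t * dotp x x))%:E).
Proof.
move=> t0; apply/integrableP; split; first by meas.
under eq_integral do rewrite gee0_abs ?lee_fin ?expR_ge0//.
by rewrite ge0_integral_gauss_Rn// ltry.
Qed.

(** For a fixed first coordinate [a], the term [b * a] joins the phase and the induction hypothesis
    applies to the inner integral; no addition formula is needed. *)
Lemma integral_gauss_cos_Rn d (t c : R) (z : Rn R d) : 0 < t ->
  \int[lebesgue_Rn R d]_x (expR (- t * dotp x x) * cos (dotp z x + c)) =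
  cos c * Num.sqrt (pi / t) ^+ d * expR (- (dotp z z / (4 * t))).
Proof.
move=> t0; elim: d z c => [|d IH] z c.
  by rewrite /Rintegral integral_Rn0 /dotp !big_ord0 /= !mulr0 mul0r add0r oppr0 expR0 !mulr1
    mul1r.
have [b [w ->]] := cons_pointS z.
rewrite (@Rintegral_cons _ _ (fun a => expR (- t * a ^+ 2)) (fun x => expR (- t * dotp x x)));
  [|by meas|exact: integrable_gauss|exact: integrable_gauss_Rn|]; last first.
  move=> a x; rewrite normrM ger0_norm ?expR_ge0// -expRD dotp_cons -expr2 -mulrDr.
  by rewrite ler_piMr ?expR_ge0// norm_cos_le1.
transitivity (\int[leb]_a (Num.sqrt (pi / t) ^+ d * expR (- (dotp w w / (4 * t))) *
    (expR (- t * a ^+ 2) * cos (b * a + c)))).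
  apply: eq_Rintegral => a _.
  have -> : Num.sqrt (pi / t) ^+ d * expR (- (dotp w w / (4 * t))) *
    (expR (- t * a ^+ 2) * cos (b * a + c)) = expR (- t * a ^+ 2) *
    (cos (b * a + c) * Num.sqrt (pi / t) ^+ d * expR (- (dotp w w / (4 * t)))) by ring.
  rewrite -IH -RintegralZl//; last first.
    apply: (le_integrable _ _ _ (@integrable_gauss_Rn d t t0)) => //; first by meas.
    move=> x _; rewrite /= lee_fin normrM !(ger0_norm (expR_ge0 _)).
    by rewrite ler_piMr ?expR_ge0// norm_cos_le1.
  apply: eq_Rintegral => x _; rewrite mulrA -expRD !dotp_cons -expr2 -mulrDr.
  by congr (_ * cos _); ring.
rewrite RintegralZl//; last first.
  by apply: integrable_gauss_bounded => //; [meas|move=> x; exact: norm_cos_le1].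
rewrite integral_gauss_cos// dotp_cons.
have -> : - ((b * b + dotp w w) / (4 * t)) = - (dotp w w / (4 * t)) + - (b ^+ 2 / (4 * t)) by
  ring.
by rewrite expRD [_ ^+ d.+1]exprS; ring.
Qed.

End gauss_Rn.

(** * Fourier integrals and the heat kernel *)

Section integrable_lemmas.
Context d (T : measurableType d) (R : realType) (mu : {measure set T -> \bar R}).
Local Notation I f := (mu.-integrable setT (fun x => (f x)%:E)).

Lemma integrable_bounded_mul (h a : T -> R) (M : R) :
  measurable_fun setT h -> (forall x, `|h x| <= M) -> I a -> I (fun x => h x * a x).
Proof.
move=> mh hM ia.
have ma : measurable_fun setT a by have /integrableP[/measurable_EFinP] := ia.
apply: (le_integrable measurableT _ _ (integrableZl measurableT M ia)).
  by meas.
move=> x _; rewrite /= lee_fin !normrM ler_wpM2r//.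
by rewrite (le_trans (hM x))// ler_norm.
Qed.

Lemma integrable_addr (f g : T -> R) : I f -> I g -> I (fun x => f x + g x).
Proof. by move=> fi gi; have := integrableD measurableT fi gi. Qed.

Lemma integrable_oppr (f : T -> R) : I f -> I (fun x => - f x).
Proof. by move=> fi; have := integrableN fi. Qed.

Lemma integrable_normr (f : T -> R) : I f -> I (fun x => `|f x|).
Proof. by move=> fi; have := integrable_abse fi. Qed.

End integrable_lemmas.

Section fourier.
Context {R : realType} {d : nat}.
Local Notation mu := (lebesgue_Rn R d).
Local Notation I f := (mu.-integrable setT (fun x => (f x)%:E)).
Implicit Types (a b : Rn R d -> R) (x y z xi : Rn R d).

Lemma dotp_subpl x y z : dotp (subp x y) z = dotp x z - dotp y z.
Proof.
rewrite /dotp -sumrB; apply: eq_bigr => i _.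
by rewrite tnth_subp mulrBl.
Qed.

Definition fourier_const : R := (2 * pi) `^ (- (d%:R / 2)).

Lemma fourier_const_ge0 : 0 <= fourier_const.
Proof. exact: powR_ge0. Qed.

Definition ft a b xi : R :=
  fourier_const * \int[mu]_x (cos (dotp x xi) * a x + sin (dotp x xi) * b x).

Definition heat (t : R) x y : R :=
  (Num.sqrt (4 * pi * t) ^+ d)^-1 * expR (- (dotp (subp x y) (subp x y) / (4 * t))).

Lemma heat_ge0 t x y : 0 <= heat t x y.
Proof. by rewrite mulr_ge0 ?expR_ge0// invr_ge0 exprn_ge0// sqrtr_ge0. Qed.

(** Pairing two transforms produces [fourier_const ^+ 2], and (2 pi)^(-d) (pi / t)^(d/2) = (4 pi
    t)^(-d/2). *)
Lemma fourier_const_heat t z : 0 < t ->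
  fourier_const ^+ 2 * (Num.sqrt (pi / t) ^+ d * expR (- (dotp z z / (4 * t)))) =
  (Num.sqrt (4 * pi * t) ^+ d)^-1 * expR (- (dotp z z / (4 * t))).
Proof.
move=> t0; rewrite mulrA; congr (_ * _).
have -> : fourier_const ^+ 2 = ((2 * pi) ^+ d)^-1.
  rewrite /fourier_const powRN -powR_mulrn ?invr_ge0 ?powR_ge0//.
  rewrite -powRN -powRrM.
  rewrite (_ : _ * 2%:R = - d%:R); last by field.
  by rewrite powRN powR_mulrn// mulr_ge0// pi_ge0.
rewrite -exprVn -exprMn -exprVn; congr (_ ^+ d).
have pi0 := pi_gt0 R.
have h1 : 0 <= (2 * pi)^-1 * Num.sqrt (pi / t).
  by rewrite mulr_ge0 ?sqrtr_ge0// invr_ge0 mulr_ge0// ltW.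
have h2 : 0 <= (Num.sqrt (4 * pi * t))^-1 by rewrite invr_ge0 sqrtr_ge0.
have h3 : 0 <= pi / t by rewrite divr_ge0// ltW.
have h4 : 0 <= 4 * pi * t by rewrite !mulr_ge0// ltW.
(* Both sides are non-negative, so comparing squares removes the roots. *)
apply/eqP; rewrite -(@eqrXn2 _ 2)//.
rewrite exprMn exprVn [X in _ == X]exprVn !sqr_sqrtr//.
apply/eqP; clear -t0 pi0; move: (pi : R) pi0 => p p0.
by field; rewrite !gt_eqF.
Qed.

Lemma measurable_ft a b : measurable_fun setT a -> measurable_fun setT b ->
  measurable_fun setT (ft a b).
Proof.
move=> ma mb; apply: measurable_funM => //.
apply: (measurable_Rintegral2 (fun xi x => cos (dotp x xi) * a x + sin (dotp x xi) * b x)).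
by meas.
Qed.

Lemma integrable_ft a b xi : I a -> I b ->
  I (fun x => cos (dotp x xi) * a x + sin (dotp x xi) * b x).
Proof.
move=> ia ib; apply: integrable_addr; apply: (integrable_bounded_mul (M := 1)) => //.
- by meas.
- by move=> x; exact: norm_cos_le1.
- by meas.
- by move=> x; exact: norm_sin_le1.
Qed.

Lemma norm_trig_le (th a b : R) : `|cos th * a + sin th * b| <= `|a| + `|b|.
Proof.
rewrite (le_trans (ler_normD _ _))// !normrM lerD// ler_piMl//.
  exact: norm_cos_le1.
exact: norm_sin_le1.
Qed.

Lemma norm_ft_le a b xi : I a -> I b ->
  `|ft a b xi| <= fourier_const * \int[mu]_x (`|a x| + `|b x|).
Proof.
move=> ia ib; rewrite normrM ger0_norm ?fourier_const_ge0// ler_wpM2l ?fourier_const_ge0//.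
rewrite (le_trans (le_normr_Rintegral _ (integrable_ft xi ia ib)))//.
apply: le_Rintegral => //.
- exact: integrable_normr (integrable_ft xi ia ib).
- by apply: integrable_addr; exact: integrable_normr.
- by move=> x _; exact: norm_trig_le.
Qed.

(** One Fubini exchange: the transform of a + i b is unfolded against bounded factors [D1], [D2]. In
    [ft_pairing] it is applied twice, first with the other transform as [D1], [D2], then with the
    trigonometric factors that the first application leaves behind. *)
Lemma ft_pairing_swap (w D1 D2 a b : Rn R d -> R) (M : R) :
  I w -> (forall xi, 0 <= w xi) -> measurable_fun setT D1 -> measurable_fun setT D2 ->
  (forall xi, `|D1 xi| <= M) -> (forall xi, `|D2 xi| <= M) -> I a -> I b ->
  I (fun x => fourier_const * \int[mu]_xi (w xi *
     ((cos (dotp x xi) * a x + sin (dotp x xi) * b x) * D1 xi +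
      (cos (dotp x xi) * b x - sin (dotp x xi) * a x) * D2 xi))) /\
  \int[mu]_xi (w xi * (ft a b xi * D1 xi + ft b (fun x => - a x) xi * D2 xi)) =
  \int[mu]_x (fourier_const * \int[mu]_xi (w xi *
     ((cos (dotp x xi) * a x + sin (dotp x xi) * b x) * D1 xi +
      (cos (dotp x xi) * b x - sin (dotp x xi) * a x) * D2 xi))).
Proof.
move=> iw w0 mD1 mD2 D1M D2M ia ib.
have ma : measurable_fun setT a by have /integrableP[/measurable_EFinP] := ia.
have mb : measurable_fun setT b by have /integrableP[/measurable_EFinP] := ib.
have mw : measurable_fun setT w by have /integrableP[/measurable_EFinP] := iw.
have M0 : 0 <= M by apply: le_trans (D1M [tuple 0 | _ < d]).
pose H xi x := w xi * ((cos (dotp x xi) * a x + sin (dotp x xi) * b x) * D1 xi +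
      (cos (dotp x xi) * b x - sin (dotp x xi) * a x) * D2 xi).
have mH : measurable_fun setT (fun z : Rn R d * Rn R d => H z.1 z.2) by rewrite /H; meas.
have iab : I (fun x => `|a x| + `|b x|) by apply: integrable_addr; exact: integrable_normr.
have iwM : I (fun xi => 2 * M * w xi) by exact: (integrableZl measurableT (2 * M) iw).
have HAB xi x : `|H xi x| <= (2 * M * w xi) * (`|a x| + `|b x|).
  rewrite /H normrM (ger0_norm (w0 _)).
  have -> : 2 * M * w xi * (`|a x| + `|b x|) =
    w xi * ((`|a x| + `|b x|) * M + (`|a x| + `|b x|) * M) by ring.
  rewrite ler_wpM2l// (le_trans (ler_normD _ _))// !normrM lerD// ler_pM//.
    exact: norm_trig_le.
  rewrite -mulrN addrC [X in _ <= X]addrC -[X in _ <= _ + X]normrN addrC [X in _ <= X]addrC.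
  by rewrite [X in _ <= X]addrC norm_trig_le.
have mH' : measurable_fun setT (fun z : Rn R d * Rn R d => H z.2 z.1) by rewrite /H; meas.
have HBA x xi : `|H xi x| <= (`|a x| + `|b x|) * (2 * M * w xi) by rewrite mulrC.
have iH := dominated_integrable_Rintegral2 mH' iab iwM HBA.
split; first exact: (integrableZl measurableT fourier_const iH).
rewrite RintegralZl//.
have -> : \int[mu]_x \int[mu]_xi (w xi *
     ((cos (dotp x xi) * a x + sin (dotp x xi) * b x) * D1 xi +
      (cos (dotp x xi) * b x - sin (dotp x xi) * a x) * D2 xi)) =
   \int[mu]_xi \int[mu]_x H xi x.
  by rewrite (Rintegral_swap mH iwM iab HAB).
rewrite -RintegralZl//; last exact: (dominated_integrable_Rintegral2 mH iwM iab HAB).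
apply: eq_Rintegral => xi _; rewrite /H.
have i1 := integrable_ft xi ia ib.
have i2 := integrable_ft xi ib (integrable_oppr ia).
transitivity (fourier_const * \int[mu]_x
   ((w xi * D1 xi) * (cos (dotp x xi) * a x + sin (dotp x xi) * b x) +
    (w xi * D2 xi) * (cos (dotp x xi) * b x + sin (dotp x xi) * (- a x)))).
  rewrite RintegralD//; last 2 first.
  - exact: (integrableZl measurableT (w xi * D1 xi) i1).
  - exact: (integrableZl measurableT (w xi * D2 xi) i2).
  by rewrite !RintegralZl// /ft; ring.
rewrite -RintegralZl//; last first.
  apply: integrable_addr.
  - exact: (integrableZl measurableT (w xi * D1 xi) i1).
  - exact: (integrableZl measurableT (w xi * D2 xi) i2).
rewrite -RintegralZl//; last exact: (dominated_integrable2 mH iab HAB xi).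
by apply: eq_Rintegral => x _; ring.
Qed.

(** Once both transforms are unfolded, the integral over xi is the Gaussian against e^(-i (x - y) .
    xi), that is, the heat kernel. The integrand is the real part of one transform times the
    conjugate of the other. *)
Lemma ft_pairing (t : R) a b a' b' : 0 < t -> I a -> I b -> I a' -> I b' ->
  \int[mu]_xi (expR (- t * dotp xi xi) *
    (ft a b xi * ft a' b' xi + ft b (fun x => - a x) xi * ft b' (fun x => - a' x) xi)) =
  \int[mu]_x \int[mu]_y (heat t x y * (a x * a' y + b x * b' y)).
Proof.
move=> t0 ia ib ia' ib'.
have ma' : measurable_fun setT a' by have /integrableP[/measurable_EFinP] := ia'.
have mb' : measurable_fun setT b' by have /integrableP[/measurable_EFinP] := ib'.
have mNa' : measurable_fun setT (fun x => - a' x) by meas.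
have ig := @integrable_gauss_Rn R d t t0.
have g0 xi : 0 <= expR (- t * dotp xi xi) by exact: expR_ge0.
have ftM' xi : `|ft a' b' xi| <= fourier_const * \int[mu]_x (`|a' x| + `|b' x|).
  exact: norm_ft_le.
have ftM xi : `|ft b' (fun x => - a' x) xi| <= fourier_const * \int[mu]_x (`|a' x| + `|b' x|).
  rewrite (le_trans (norm_ft_le _ ib' (integrable_oppr ia')))//.
  rewrite le_eqVlt; apply/orP; left; apply/eqP; congr (_ * _).
  by apply: eq_Rintegral => x _; rewrite normrN addrC.
have [_ ->] := ft_pairing_swap ig g0 (measurable_ft ma' mb') (measurable_ft mb' mNa') ftM' ftM
  ia ib.
apply: eq_Rintegral => x _.
set u := fun xi => cos (dotp x xi) * a x + sin (dotp x xi) * b x.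
set v := fun xi => cos (dotp x xi) * b x - sin (dotp x xi) * a x.
transitivity (fourier_const * \int[mu]_xi (expR (- t * dotp xi xi) *
   (ft a' b' xi * u xi + ft b' (fun x => - a' x) xi * v xi))).
  by congr (_ * _); apply: eq_Rintegral => xi _; rewrite /u /v; ring.
have uM xi : `|u xi| <= `|a x| + `|b x| by exact: norm_trig_le.
have vM xi : `|v xi| <= `|a x| + `|b x|.
  by rewrite /v addrC -mulrN addrC -(normrN (a x)) [X in _ <= X]addrC norm_trig_le.
have mu_ : measurable_fun setT u by rewrite /u; meas.
have mv : measurable_fun setT v by rewrite /v; meas.
have [iy ->] := ft_pairing_swap ig g0 mu_ mv uM vM ia' ib'.
rewrite -RintegralZl//.
apply: eq_Rintegral => y _.
(* [P] and [Q] are the real and imaginary parts of a x + i b x times the conjugate of a' y + i b' y.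
   The sine that multiplies [Q] is written as a cosine of phase - pi / 2, so the same formula shows
   that its Gaussian integral vanishes. *)
pose z := subp x y; pose P := a x * a' y + b x * b' y; pose Q := b x * a' y - a x * b' y.
transitivity (fourier_const * (fourier_const * \int[mu]_xi
   (P * (expR (- t * dotp xi xi) * cos (dotp z xi + 0)) +
    Q * (expR (- t * dotp xi xi) * cos (dotp z xi + - (pi / 2)))))).
  congr (_ * (_ * _)); apply: eq_Rintegral => xi _.
  rewrite cosBpihalf addr0 /z dotp_subpl cosB sinB /u /v /P /Q; ring.
have ic c : I (fun xi => expR (- t * dotp xi xi) * cos (dotp z xi + c)).
  apply: eq_integrable (integrable_bounded_mul (M := 1) (h := fun xi => cos (dotp z xi + c)) _
    _ ig) => //.
  - by move=> xi _; rewrite mulrC.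
  - by meas.
  - by move=> xi; exact: norm_cos_le1.
have ie c K : \int[mu]_xi (K * (expR (- t * dotp xi xi) * cos (dotp z xi + c))) =
    K * (cos c * Num.sqrt (pi / t) ^+ d * expR (- (dotp z z / (4 * t)))).
  by rewrite RintegralZl//; [rewrite integral_gauss_cos_Rn|exact: ic].
rewrite RintegralD//; last 2 first.
- exact: (integrableZl measurableT P (ic 0)).
- exact: (integrableZl measurableT Q (ic (- (pi / 2)))).
rewrite !ie cos0 cosN cos_pihalf !mul0r mulr0 addr0 mul1r.
by rewrite /heat -fourier_const_heat// -/z -/P; ring.
Qed.

End fourier.

Section Rintegral_bounds.
Context d (T : measurableType d) (R : realType) (mu : {measure set T -> \bar R}).

(** Measurability suffices: if [f] is not integrable, the right-hand side is infinite. *)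
Lemma le_normr_Rintegral_ge0 (f : T -> R) : measurable_fun setT f ->
  ((`|\int[mu]_x f x|)%:E <= \int[mu]_x (`|f x|)%:E)%E.
Proof.
move=> mf; have [foo|] := ltP (\int[mu]_x (`|f x|)%:E)%E +oo%E; last first.
  by rewrite leye_eq => /eqP ->; rewrite leey.
have If : mu.-integrable setT (EFin \o f) by apply/integrableP; split => //;
  exact/measurable_EFinP.
rewrite EFin_normr_Rintegral//.
exact: le_abse_integral measurableT (measurable_int _ If).
Qed.

Lemma ge0_EFin_Rintegral (f : T -> R) : mu.-integrable setT (EFin \o f) ->
  (\int[mu]_x f x)%:E = (\int[mu]_x (f x)%:E)%E.
Proof. by move=> If; rewrite fineK//; exact: integrable_fin_num. Qed.

End Rintegral_bounds.

Lemma amgm_norm (R : realDomainType) (u v : R) : 2 * (`|u| * `|v|) <= u ^+ 2 + v ^+ 2.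
Proof.
rewrite -(real_normK (num_real u)) -(real_normK (num_real v)).
have := sqr_ge0 (`|u| - `|v|); nra.
Qed.

(** * Heat kernel: scaling, unit mass, and Bessel's inequality *)

Section heat.
Context {R : realType} {d : nat}.
Local Notation mu := (lebesgue_Rn R d).
Local Notation I f := (mu.-integrable setT (fun x => (f x)%:E)).
Implicit Types (a b : Rn R d -> R) (x y z xi : Rn R d).

Lemma dotp_subpC x y : dotp (subp x y) (subp x y) = dotp (subp y x) (subp y x).
Proof. by apply: eq_bigr => i _; rewrite !tnth_subp; ring. Qed.

Lemma heatC (t : R) x y : heat t x y = heat t y x.
Proof. by rewrite /heat dotp_subpC. Qed.

Lemma heat_affine (t : R) x z : 0 < t ->
  Num.sqrt t ^+ d * heat t x (affine (Num.sqrt t) x z) = heat 1 (origin d) z.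
Proof.
move=> t0; rewrite /heat mulrA; congr (_ * expR (- _)).
  rewrite mulr1 -exprVn -exprMn -exprVn; congr (_ ^+ d).
  rewrite [X in (Num.sqrt X)^-1]mulrC [in LHS]sqrtrM ?ltW//.
  by rewrite invfM mulrA mulfV ?mul1r// gt_eqF// sqrtr_gt0.
have -> : dotp (subp x (affine (Num.sqrt t) x z)) (subp x (affine (Num.sqrt t) x z)) = t * dotp
  z z.
  rewrite /dotp mulr_sumr; apply: eq_bigr => i _.
  rewrite !tnth_subp !tnth_affine -[in RHS](sqr_sqrtr (ltW t0)); ring.
have -> : dotp (subp (origin d) z) (subp (origin d) z) = dotp z z.
  by apply: eq_bigr => i _; rewrite !tnth_subp !tnth_origin; ring.
by rewrite mulr1; field; rewrite gt_eqF.
Qed.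

Lemma measurable_heat dX (X : measurableType dX) (t : R) (f g : X -> Rn R d) :
  measurable_fun setT f -> measurable_fun setT g ->
  measurable_fun setT (fun s => heat t (f s) (g s)).
Proof. by move=> mf mg; rewrite /heat /subp; meas. Qed.

(** The substitution y = x + sqrt t z moves the dependence on [t] from the kernel into the argument
    of [F]. Letting [t] tend to 0 then becomes a question about small translations of [F]. *)
Lemma ge0_integral_heat_affine (t : R) x (F : Rn R d -> R) : 0 < t ->
  measurable_fun setT F -> (forall x, 0 <= F x) ->
  (\int[mu]_y (heat t x y * F y)%:E =
   \int[mu]_z (heat 1 (origin d) z * F (affine (Num.sqrt t) x z))%:E)%E.
Proof.
move=> t0 mF F0; have st0 : 0 < Num.sqrt t by rewrite sqrtr_gt0.
have mh : measurable_fun setT (fun y => (heat t x y * F y)%:E).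
  by apply/measurable_EFinP/measurable_funM => //; exact: measurable_heat.
have h0 y : (0 <= (heat t x y * F y)%:E)%E by rewrite lee_fin mulr_ge0// heat_ge0.
rewrite (@ge0_integral_affine _ _ _ x (Num.sqrt t) st0 mh h0) -ge0_integralZl//.
- apply: eq_integral => z _; rewrite -EFinM; congr EFin.
  by rewrite mulrA heat_affine.
- exact: (measurableT_comp mh (measurable_affine _ _)).
Qed.

Lemma integral_heat (t : R) x : 0 < t -> (\int[mu]_y (heat t x y)%:E = 1)%E.
Proof.
move=> t0.
have -> : (\int[mu]_y (heat t x y)%:E = \int[mu]_y (heat t x y * 1)%:E)%E.
  by apply: eq_integral => y _; rewrite mulr1.
rewrite ge0_integral_heat_affine//.
have q0 : (0 : R) < 4^-1 by rewrite invr_gt0.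
have -> : (\int[mu]_z (heat 1 (origin d) z * 1)%:E =
   \int[mu]_z (((Num.sqrt (4 * pi * 1) ^+ d)^-1)%:E * (expR (- 4^-1 * dotp z z))%:E))%E.
  apply: eq_integral => z _; rewrite mulr1 -EFinM /heat; congr (_ * expR _)%:E.
  have -> : dotp (subp (origin d) z) (subp (origin d) z) = dotp z z.
    by apply: eq_bigr => i _; rewrite !tnth_subp !tnth_origin; ring.
  by rewrite mulr1 mulNr mulrC.
have c0 : (0 <= ((Num.sqrt (4 * pi * 1 : R) ^+ d)^-1)%:E)%E.
  by rewrite lee_fin invr_ge0 exprn_ge0// sqrtr_ge0.
rewrite ge0_integralZl//; last by meas.
rewrite ge0_integral_gauss_Rn// -EFinM invrK mulr1 [pi * 4]mulrC mulVf//.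
by rewrite expf_neq0// gt_eqF// sqrtr_gt0 mulr_gt0// pi_gt0.
Qed.

(** The diagonal case of [ft_pairing], with absolute values inside. Both sides become integrals of
    non-negative functions, to which Tonelli and Fatou apply. *)
Lemma le_ft_energy (t : R) a b : 0 < t -> I a -> I b ->
  (\int[mu]_xi (expR (- t * dotp xi xi) *
     (ft a b xi ^+ 2 + ft b (fun x => - a x) xi ^+ 2))%:E <=
   \int[mu]_x \int[mu]_y (heat t x y * (`|a x| * `|a y| + `|b x| * `|b y|))%:E)%E.
Proof.
move=> t0 ia ib.
have ma : measurable_fun setT a by have /integrableP[/measurable_EFinP] := ia.
have mb : measurable_fun setT b by have /integrableP[/measurable_EFinP] := ib.
have mNa : measurable_fun setT (fun x => - a x) by meas.
have m1 := measurable_ft ma mb.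
have m2 := measurable_ft mb mNa.
have := ft_pairing t0 ia ib ia ib.
under eq_Rintegral do rewrite -!expr2.
set q := fun xi => ft a b xi ^+ 2 + ft b (fun x => - a x) xi ^+ 2 => E.
pose M1 := @fourier_const R d * \int[mu]_x (`|a x| + `|b x|).
pose M2 := @fourier_const R d * \int[mu]_x (`|b x| + `|- a x|).
have qM xi : `|q xi| <= M1 ^+ 2 + M2 ^+ 2.
  rewrite ger0_norm ?addr_ge0 ?sqr_ge0// lerD// -real_normK ?num_real//.
    by rewrite ler_sqr ?nnegrE ?norm_ft_le// (le_trans _ (norm_ft_le xi ia ib)).
  rewrite ler_sqr ?nnegrE ?norm_ft_le//; first exact: integrable_oppr.
  exact: le_trans (norm_ft_le xi ib (integrable_oppr ia)).
have iq : I (fun xi => expR (- t * dotp xi xi) * q xi).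
  apply: eq_integrable (integrable_bounded_mul _ qM (@integrable_gauss_Rn R d t t0)) => //.
    by move=> x _ /=; rewrite mulrC.
  by rewrite /q; meas.
rewrite -ge0_EFin_Rintegral// E.
apply: (@le_trans _ _ (`|\int[mu]_x \int[mu]_y (heat t x y * (a x * a y + b x * b y))|%:E)).
  by rewrite lee_fin ler_norm.
have mh : measurable_fun setT (fun z : Rn R d * Rn R d => heat t z.1 z.2 * (a z.1 * a z.2 + b
  z.1 * b z.2)).
  by apply: measurable_funM; [exact: measurable_heat|meas].
have mh' : measurable_fun setT (fun z : Rn R d * Rn R d => heat t z.1 z.2 * (`|a z.1| * `|a
  z.2| + `|b z.1| * `|b z.2|)).
  by apply: measurable_funM; [exact: measurable_heat|meas].
have mh2 : measurable_fun setT (fun x => \int[mu]_y (heat t x y * (a x * a y + b x * b y))).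
  exact: (measurable_Rintegral2 (fun x y => heat t x y * (a x * a y + b x * b y))).
apply: le_trans (le_normr_Rintegral_ge0 _ mh2) _.
apply: ge0_le_integral => //.
- by meas.
- apply: (ge0_measurable_integral2 (fun x y => (heat t x y * (`|a x| * `|a y| + `|b x| * `|b
  y|))%:E)).
    exact/measurable_EFinP.
  by move=> x y; rewrite lee_fin mulr_ge0 ?heat_ge0// addr_ge0// mulr_ge0.
move=> x _; apply: le_trans (le_normr_Rintegral_ge0 _ _) _.
  by apply: measurable_funM; [exact: measurable_heat|meas].
apply: ge0_le_integral => //.
- by apply/measurable_EFinP; apply: (measurableT_comp (@normr_measurable _ setT));
  apply: measurable_funM; [exact: measurable_heat|meas].
- by apply/measurable_EFinP; apply: measurable_funM; [exact: measurable_heat|meas].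
move=> y _; rewrite lee_fin normrM (ger0_norm (heat_ge0 _ _ _)) ler_wpM2l ?heat_ge0//.
by rewrite (le_trans (ler_normD _ _))// !normrM.
Qed.

(** With the Gaussian inserted, AM-GM splits the heat form into a term in [x] and a term in [y]. By
    symmetry and unit mass of the kernel, each integrates to half of the right-hand side; Fatou then
    removes the Gaussian. *)
Lemma ft_bessel a b : I a -> I b ->
  (\int[mu]_xi (ft a b xi ^+ 2 + ft b (fun x => - a x) xi ^+ 2)%:E <=
   \int[mu]_x (a x ^+ 2 + b x ^+ 2)%:E)%E.
Proof.
move=> ia ib.
have ma : measurable_fun setT a by have /integrableP[/measurable_EFinP] := ia.
have mb : measurable_fun setT b by have /integrableP[/measurable_EFinP] := ib.
have mNa : measurable_fun setT (fun x => - a x) by meas.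
have m1 := measurable_ft ma mb.
have m2 := measurable_ft mb mNa.
set q := fun xi => ft a b xi ^+ 2 + ft b (fun x => - a x) xi ^+ 2.
pose r x := a x ^+ 2 + b x ^+ 2.
have r0 x : 0 <= r x by rewrite addr_ge0// sqr_ge0.
have q0 x : 0 <= q x by rewrite addr_ge0// sqr_ge0.
have mr : measurable_fun setT r by rewrite /r; meas.
have mq : measurable_fun setT q by rewrite /q; meas.
have le t : 0 < t -> (\int[mu]_xi (expR (- t * dotp xi xi) * q xi)%:E <= \int[mu]_x (r x)%:E)%E.
  move=> t0; apply: le_trans (le_ft_energy t0 ia ib) _.
  have mh1 : measurable_fun setT (fun z : Rn R d * Rn R d => (heat t z.1 z.2 * (2^-1 * r
    z.1))%:E).
    by apply/measurable_EFinP/measurable_funM; [exact: measurable_heat|meas].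
  have mh2 : measurable_fun setT (fun z : Rn R d * Rn R d => (heat t z.1 z.2 * (2^-1 * r
    z.2))%:E).
    by apply/measurable_EFinP/measurable_funM; [exact: measurable_heat|meas].
  have h1 x y : (0 <= (heat t x y * (2^-1 * r x))%:E)%E.
    by rewrite lee_fin mulr_ge0 ?heat_ge0// mulr_ge0.
  have h2 x y : (0 <= (heat t x y * (2^-1 * r y))%:E)%E.
    by rewrite lee_fin mulr_ge0 ?heat_ge0// mulr_ge0.
  have half : (\int[mu]_x \int[mu]_y (heat t x y * (2^-1 * r x))%:E = \int[mu]_x (2^-1 * r
    x)%:E)%E.
    apply: eq_integral => x _.
    transitivity (\int[mu]_y ((2^-1 * r x)%:E * (heat t x y)%:E))%E.
      by apply: eq_integral => y _; rewrite mulrC EFinM.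
    rewrite ge0_integralZl//.
    - by rewrite integral_heat// mule1.
    - by apply/measurable_EFinP; exact: measurable_heat.
    - by move=> y _; rewrite lee_fin heat_ge0.
    - by rewrite lee_fin mulr_ge0.
  have half2 : (\int[mu]_x \int[mu]_y (heat t x y * (2^-1 * r y))%:E = \int[mu]_x (2^-1 * r
    x)%:E)%E.
    have -> := @ge0_integral_swap _ _ _ _ _ mu mu (fun x y => (heat t x y * (2^-1 * r y))%:E)
      mh2 h2.
    by rewrite -half; apply: eq_integral => x _; apply: eq_integral => y _; rewrite heatC.
  apply: (@le_trans _ _ (\int[mu]_x (\int[mu]_y (heat t x y * (2^-1 * r x))%:E +
     \int[mu]_y (heat t x y * (2^-1 * r y))%:E))%E).
    apply: ge0_le_integral => //.
    - by move=> x _; apply: integral_ge0 => y _; rewrite lee_fin mulr_ge0 ?heat_ge0//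
      addr_ge0// mulr_ge0.
    - apply: (ge0_measurable_integral2 (fun x y => (heat t x y * (`|a x| * `|a y| + `|b x| *
      `|b y|))%:E)).
        by apply/measurable_EFinP/measurable_funM; [exact: measurable_heat|meas].
      by move=> x y; rewrite lee_fin mulr_ge0 ?heat_ge0// addr_ge0// mulr_ge0.
    - apply: emeasurable_funD.
        exact: (ge0_measurable_integral2 (fun x y => (heat t x y * (2^-1 * r x))%:E)).
      exact: (ge0_measurable_integral2 (fun x y => (heat t x y * (2^-1 * r y))%:E)).
    move=> x _; rewrite -ge0_integralD//; last 2 first.
    - exact: (measurableT_comp mh1 (measurable_pair1 x)).
    - exact: (measurableT_comp mh2 (measurable_pair1 x)).
    apply: ge0_le_integral => //.
    - by move=> y _; rewrite lee_fin mulr_ge0 ?heat_ge0// addr_ge0// mulr_ge0.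
    - by apply/measurable_EFinP/measurable_funM; [exact: measurable_heat|meas].
    - apply: emeasurable_funD.
        exact: (measurableT_comp mh1 (measurable_pair1 x)).
      exact: (measurableT_comp mh2 (measurable_pair1 x)).
    move=> y _; rewrite -EFinD lee_fin -mulrDr ler_wpM2l ?heat_ge0// /r.
    have := lerD (amgm_norm (a x) (a y)) (amgm_norm (b x) (b y)); lra.
  rewrite ge0_integralD//; last 4 first.
  - by move=> x _; exact: integral_ge0.
  - exact: (ge0_measurable_integral2 (fun x y => (heat t x y * (2^-1 * r x))%:E)).
  - by move=> x _; exact: integral_ge0.
  - exact: (ge0_measurable_integral2 (fun x y => (heat t x y * (2^-1 * r y))%:E)).
  rewrite half half2 -ge0_integralD//; last 4 first.
  - by move=> x _; rewrite lee_fin mulr_ge0.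
  - by meas.
  - by move=> x _; rewrite lee_fin mulr_ge0.
  - by meas.
  rewrite le_eqVlt; apply/orP; left; apply/eqP; apply: eq_integral => x _.
  by rewrite -EFinD; congr EFin; field.
pose t n : R := n.+1%:R^-1.
have t0 n : 0 < t n by rewrite invr_gt0.
pose F n xi := (expR (- t n * dotp xi xi) * q xi)%:E.
apply: (@ge0_integral_le_cvg _ _ _ mu F _ (cst (\int[mu]_x (r x)%:E)%E)).
- by move=> n; rewrite /F; meas.
- by move=> n x; rewrite lee_fin mulr_ge0 ?expR_ge0.
- move=> xi; apply: cvg_EFin; first exact: nearW.
  rewrite -[X in _ --> X]mul1r; apply: cvgM; last exact: cvg_cst.
  rewrite -expR0; apply: continuous_cvg; first exact: continuous_expR.
  rewrite -(mul0r (dotp xi xi)); apply: cvgM; last exact: cvg_cst.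
  by rewrite -oppr0; apply: cvgN; exact: cvg_harmonic.
- by move=> n; exact: le.
- exact: cvg_cst.
Qed.

End heat.

(** * Continuity of translations *)

Section ereal_cvg0.
Context {R : realType}.

Lemma ecvg0_le (x : nat -> \bar R) (e : R) : 0 < e -> x @ \oo --> 0%E ->
  \forall n \near \oo, (x n <= e%:E)%E.
Proof.
move=> e0 /fine_cvgP[fx /cvgrPdist_le /(_ _ e0) h].
near=> n.
have fn : x n \is a fin_num by near: n.
have : `|0 - (fine \o x) n| <= e by near: n.
by rewrite -(fineK fn) lee_fin /= sub0r normrN; apply: le_trans; exact: ler_norm.
Unshelve. all: by end_near. Qed.

(** The density argument in the abstract: [e] is the error of an approximation, and the vanishing
    sequence [v] belongs to the approximant, hence may depend on [e]. *)
Lemma ecvg0_approx (x : nat -> \bar R) : (forall n, 0 <= x n)%E ->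
  (forall e, 0 < e -> exists2 v : nat -> \bar R, v @ \oo --> 0%E &
     forall n, (x n <= e%:E + v n)%E) ->
  x @ \oo --> 0%E.
Proof.
move=> x0 H.
have le e : 0 < e -> \forall n \near \oo, (x n <= e%:E)%E.
  move=> e0; have e20 : 0 < e / 2 by rewrite divr_gt0.
  have [v v0 xv] := H _ e20; have := ecvg0_le e20 v0.
  apply: filterS => n vn; rewrite (le_trans (xv n))// [e in leRHS](splitr e) EFinD.
  exact: leeD.
have fin : \forall n \near \oo, x n \is a fin_num.
  by have := le 1 ltr01; apply: filterS => n xn; rewrite ge0_fin_numE// (le_lt_trans xn)// ltry.
apply/fine_cvgP; split => //; apply/cvgrPdist_le => e e0.
near=> n.
rewrite sub0r normrN ger0_norm ?fine_ge0// -lee_fin fineK; last by near: n.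
by near: n; exact: le.
Unshelve. all: by end_near. Qed.

End ereal_cvg0.

Section translation1.
Context {R : realType}.
Local Notation leb := (@lebesgue_measure R).

Lemma ge0_integral_translation1 (c : R) (F : R -> \bar R) :
  measurable_fun setT F -> (forall x, 0 <= F x)%E ->
  (\int[leb]_x F (c + 1 * x)%R = \int[leb]_x F x)%E.
Proof. by move=> mF F0; rewrite [RHS](@ge0_integral_affine1 _ _ c 1)// mul1e. Qed.

(** [u] is cut off to a bounded interval and replaced there by a continuous function, with total L^1
    error e / 2. By translation invariance the translate has the same error, and for the approximant
    dominated convergence applies. *)
Lemma cvg_translation1 (u : R -> R) (h : nat -> R) :
  leb.-integrable setT (fun x => (u x)%:E) -> h @ \oo --> 0 ->
  (\int[leb]_x (`|u (h n + 1 * x)%R - u x|)%:E @[n --> \oo] --> 0)%E.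
Proof.
move=> iu h0; apply: ecvg0_approx => [n|e e0]; first by exact: integral_ge0.
have mu : measurable_fun setT u by have /integrableP[/measurable_EFinP] := iu.
have e40 : 0 < e / 4 by rewrite divr_gt0.
pose I n : set R := `[- n%:R, n%:R]%classic.
have mI n : measurable (I n) by exact: measurable_itv.
have tail : (\int[leb]_x (`|u x - (u \_ (I n)) x|)%:E @[n --> \oo] --> 0)%E.
  rewrite [X in _ --> X](_ : _ = \int[leb]_x (cst 0%E) x)%E; last by rewrite integral0.
  apply: (@cvg_integral_dominated _ _ _ leb _ _ (fun x => (`|u x|)%:E)) => //.
  - move=> n; apply/measurable_EFinP/(measurableT_comp (@normr_measurable _ setT)).
    apply: measurable_funB => //.
    by apply/(measurable_restrict _ (mI n) measurableT); rewrite setTI; exact: measurable_funTS.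
  - apply: aeW => x; apply: cvg_near_cst; exists (Num.bound `|x|) => // n /= nx.
    rewrite patchE mem_set ?subrr ?normr0// /I /= in_itv/=.
    rewrite -ler_norml (le_trans (ltW (archi_boundP (normr_ge0 x))))//.
    by rewrite ler_nat.
  - exact: integrable_normr.
  - move=> x n; rewrite gee0_abs ?lee_fin// patchE; case: ifPn => _.
      by rewrite subrr normr0.
    by rewrite subr0.
have [N _ /(_ N (leqnn N)) hN] := ecvg0_le e40 tail.
have IN : (leb (I N) < +oo)%E.
  by rewrite lebesgue_measure_itv/=; case: ifPn => _; rewrite ?ltry// -EFinD ltry.
have iuN : leb.-integrable (I N) (EFin \o u).
  by apply: integrableS iu; [exact: measurableT|exact: mI|].
have [g_ [cg_ ig_ g_u]] := approximation_continuous_integrable (mI N) IN iuN.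
have [N' _ /(_ N' (leqnn N')) hN'] := ecvg0_le e40 g_u.
move: (cg_ N') hN'; move: (g_ N') => g cg hg {g_ cg_ ig_ g_u}.
(* [w] may jump at the endpoints, so its translates are shown to converge pointwise only off the
   null set [|x| = N]. *)
pose w := g \_ (I N).
have mg : measurable_fun setT g by exact: continuous_measurable_fun.
have mw : measurable_fun setT w.
  by apply/(measurable_restrict _ (mI N) measurableT); rewrite setTI; exact: measurable_funTS.
have huw : (\int[leb]_x (`|u x - w x|)%:E <= (e / 2)%:E)%E.
  have -> : (e / 2)%:E = ((e / 4)%:E + (e / 4)%:E)%E by rewrite -EFinD; congr EFin; field.
  apply: le_trans (leeD hN hg).
  rewrite [X in (_ + X)%E]integral_mkcond -ge0_integralD//; last 3 first.
  - apply/measurable_EFinP/(measurableT_comp (@normr_measurable _ setT)).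
    apply: measurable_funB => //.
    by apply/(measurable_restrict _ (mI N) measurableT); rewrite setTI; exact: measurable_funTS.
  - by move=> x _; rewrite patchE; case: ifPn.
  - apply/(measurable_restrict _ (mI N) measurableT); rewrite setTI.
    by apply: measurable_funTS; meas.
  apply: ge0_le_integral => //.
  - by meas.
  - apply: emeasurable_funD.
      apply/measurable_EFinP/(measurableT_comp (@normr_measurable _ setT)).
      apply: measurable_funB => //.
      by apply/(measurable_restrict _ (mI N) measurableT); rewrite setTI; exact: measurable_funTS.
    apply/(measurable_restrict _ (mI N) measurableT); rewrite setTI.
    by apply: measurable_funTS; meas.
  - move=> x _; rewrite /w !patchE; case: ifPn => _.
      by rewrite subrr normr0 add0e.
    by rewrite adde0.
have [H hH] : exists H, forall n, `|h n| <= H.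
  have [B [_ hB]] := cvg_seq_bounded (cvgP _ h0).
  by exists (B + 1) => n; apply: (hB (B + 1)) => //; rewrite ltrDl.
exists (fun n => \int[leb]_x (`|w (h n + 1 * x)%R - w x|)%:E)%E; last first.
  move=> n.
  have mt (f : R -> R) : measurable_fun setT f -> measurable_fun setT (fun x : R => f (h n + 1
    * x)).
    by move=> mf; meas.
  have muh := mt _ mu; have mwh := mt _ mw.
  have -> : e%:E = ((e / 2)%:E + (e / 2)%:E)%E by rewrite -EFinD; congr EFin; field.
  apply: le_trans (leeD (leeD huw huw) (lexx _)).
  rewrite -[X in (_ <= X + _ + _)%E](@ge0_integral_translation1 (h n) (fun x => (`|u x - w
    x|)%:E))//; last by repeat meas_step.
  rewrite -ge0_integralD//; [|by repeat meas_step|by repeat meas_step].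
  rewrite -ge0_integralD//; try by repeat meas_step.
  2: by move=> x _; rewrite adde_ge0.
  apply: ge0_le_integralT => //; [by repeat meas_step|by repeat meas_step|].
  move=> x; rewrite -!EFinD lee_fin.
  set A := u _; set B := u x; set C := w _; set D := w x.
  rewrite (_ : A - B = (A - C) + (D - B) + (C - D)); last by ring.
  rewrite (le_trans (ler_normD _ _))// lerD2r (le_trans (ler_normD _ _))// lerD2l.
  by rewrite distrC.
rewrite [X in _ --> X](_ : _ = \int[leb]_x (cst 0%E) x)%E; last by rewrite integral0.
have [K gK] : exists K, forall x, x \in I N -> `|g x| <= K.
  have NN : (- N%:R : R) <= N%:R by rewrite (@le_trans _ _ 0)// oppr_le0.
  have cag : {within `[- N%:R, N%:R], continuous (fun x => `|g x|)}.
    apply: continuous_subspaceT => x; apply: continuous_comp; first exact: cg.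
    exact: norm_continuous.
  have [c _ hc] := EVT_max NN cag.
  by exists `|g c| => x; rewrite inE => /hc.
have wK x : `|w x| <= `|K|.
  rewrite /w patchE; case: ifPn => [/gK|_]; last by rewrite normr0.
  by move=> /le_trans; apply; exact: ler_norm.
have wE x : `|x| <= N%:R -> w x = g x.
  by move=> xN; rewrite /w patchE mem_set// /I /= in_itv/= -ler_norml.
(* All shifts are bounded by [H], so [w] and its translates vanish outside [J]; this yields the
   integrable majorant. *)
pose J : set R := `[- (N%:R + `|H|), N%:R + `|H|]%classic.
have w0 x : N%:R < `|x| -> w x = 0.
  move=> Nx; rewrite /w patchE memNset// /I /= in_itv/= -ler_norml.
  by apply/negP; rewrite -ltNge.
apply: (@cvg_integral_dominated _ _ _ leb _ _ (fun x => (2 * `|K| * \1_J x)%:E)) => //.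
- by move=> n; meas.
- have : {ae leb, forall x : measurableTypeR R, `|x : R| <> N%:R}.
    exists [set x | `|x| = N%:R]; split.
    + rewrite (_ : [set x | _] = [set N%:R] `|` [set - N%:R]); first exact: measurableU.
      apply/seteqP; split => x /=.
        by move=> <-; case: (ler0P x) => _; [right; rewrite opprK|left].
      by move=> [|] ->; rewrite ?normrN ger0_norm.
    + apply: countable_lebesgue_measure0; apply: (@sub_countable _ _ _ [set N%:R; - N%:R]).
        apply: subset_card_le => x /=.
        by move=> <-; case: (ler0P x) => _; [right; rewrite opprK|left].
      exact: finite_set_countable.
    + by move=> x /= /contrapT.
  apply: filterS => x /eqP; rewrite neq_lt => /orP[xN|Nx].
  +
    rewrite [X in _ --> X](_ : _ = (`|g (0 + 1 * x) - g x|)%:E); last first.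
      by rewrite add0r mul1r subrr normr0.
    have hx : h n + 1 * x @[n --> \oo] --> 0 + 1 * x by apply: cvgD => //; exact: cvg_cst.
    apply: (@cvg_trans _ ((fun n => (`|g (h n + 1 * x) - g x|)%:E) @ \oo)).
      apply: near_eq_cvg.
      have : \forall n \near \oo, `|h n + 1 * x| < N%:R.
        have : `|h n + 1 * x| @[n --> \oo] --> `|0 + 1 * x| by exact: cvg_norm.
        move=> /cvgr_lt; apply; by rewrite add0r mul1r.
      by apply: filterS => n hn; rewrite !wE// ltW.
    apply: cvg_EFin; first exact: nearW.
    apply: cvg_norm; apply: cvgB; last exact: cvg_cst.
    by apply: continuous_cvg; [exact: cg|].
  + apply: cvg_near_cst.
    have hx : `|h n + 1 * x| @[n --> \oo] --> `|0 + 1 * x|.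
      by apply: cvg_norm; apply: cvgD => //; exact: cvg_cst.
    have : \forall n \near \oo, N%:R < `|h n + 1 * x|.
      by move: hx => /cvgr_gt; apply; rewrite add0r mul1r.
    by apply: filterS => n hn; rewrite !w0// subrr normr0.
- have mJ : measurable J by exact: measurable_itv.
  have Joo : (leb J < +oo)%E.
    by rewrite lebesgue_measure_itv/=; case: ifPn => _; rewrite ?ltry// -EFinD ltry.
  have iJ : leb.-integrable setT (fun x => (\1_J x)%:E).
    apply/integrableP; split; first by apply/measurable_EFinP; exact: measurable_indic.
    under eq_integral do rewrite gee0_abs ?lee_fin//.
    by rewrite integral_indic// setIT.
  exact: (integrableZl measurableT (2 * `|K|) iJ).
- move=> x n; rewrite gee0_abs ?lee_fin// indicE; case: (boolP (x \in J)) => [_|].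
    rewrite mulr1 (le_trans (ler_normB _ _))// mulr_natl mulr2n lerD//.
  rewrite notin_setE /J /= in_itv/= -ler_norml => /negP; rewrite -ltNge => xJ.
  rewrite mulr0 !w0 ?subrr ?normr0//.
    by apply: le_lt_trans xJ; rewrite lerDl.
  have := ler_normB (h n + 1 * x) (h n); rewrite mul1r addrAC subrr add0r => hx.
  have := hH n; have := ler_norm H; move: xJ; lra.
Qed.


Lemma le_integral_translation1 (c : R) (u : R -> R) : measurable_fun setT u ->
  (\int[leb]_x (`|u (c + 1 * x)%R - u x|)%:E <= 2%:E * \int[leb]_x (`|u x|)%:E)%E.
Proof.
move=> mu.
have muc : measurable_fun setT (fun x : R => u (c + 1 * x)) by repeat meas_step.
have -> : (2%:E * \int[leb]_x (`|u x|)%:E = \int[leb]_x (`|u x|)%:E + \int[leb]_x (`|u x|)%:E)%E.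
  by rewrite -[2%:E]/(1 + 1)%E ge0_muleDl// !mul1e.
rewrite -[X in (_ <= X + _)%E](@ge0_integral_translation1 c (fun x => (`|u x|)%:E))//;
  last by repeat meas_step.
rewrite -ge0_integralD//; [|by repeat meas_step|by repeat meas_step].
apply: ge0_le_integralT => //; [by repeat meas_step|by repeat meas_step|].
by move=> x; rewrite -EFinD lee_fin ler_normB.
Qed.

End translation1.

Section translation_Rn.
Context {R : realType}.
Local Notation leb := (@lebesgue_measure R).

Lemma ge0_integral_translation d (c : Rn R d) (F : Rn R d -> \bar R) :
  measurable_fun setT F -> (forall x, 0 <= F x)%E ->
  (\int[lebesgue_Rn R d]_x F (affine 1 c x) = \int[lebesgue_Rn R d]_x F x)%E.
Proof. by move=> mF F0; rewrite [RHS](@ge0_integral_affine _ _ _ c 1)// expr1n mul1e. Qed.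

Lemma le_integral_translation d (c : Rn R d) (u : Rn R d -> R) : measurable_fun setT u ->
  (\int[lebesgue_Rn R d]_x (`|u (affine 1 c x) - u x|)%:E <=
   2%:E * \int[lebesgue_Rn R d]_x (`|u x|)%:E)%E.
Proof.
move=> mu.
have muc : measurable_fun setT (fun x => u (affine 1 c x)) by repeat meas_step.
have -> : (2%:E * \int[lebesgue_Rn R d]_x (`|u x|)%:E =
   \int[lebesgue_Rn R d]_x (`|u x|)%:E + \int[lebesgue_Rn R d]_x (`|u x|)%:E)%E.
  by rewrite -[2%:E]/(1 + 1)%E ge0_muleDl// !mul1e.
rewrite -[X in (_ <= X + _)%E](@ge0_integral_translation _ c (fun x => (`|u x|)%:E))//;
  last by repeat meas_step.
rewrite -ge0_integralD//; [|by repeat meas_step|by repeat meas_step].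
apply: ge0_le_integralT => //; [by repeat meas_step|by repeat meas_step|].
by move=> x; rewrite -EFinD lee_fin ler_normB.
Qed.

(** Induction on the dimension: the shift is made first in the remaining coordinates ([Psi], by
    induction) and then in the first one ([Phi], by the result on the line). Both apply to almost
    every section, since almost every section is integrable, and twice the L^1 norm of the section
    dominates. *)
Lemma cvg_translation d (u : Rn R d -> R) (h : nat -> Rn R d) :
  (lebesgue_Rn R d).-integrable setT (fun x => (u x)%:E) ->
  (forall i, (tnth (h n) i : R) @[n --> \oo] --> (0 : R)) ->
  (\int[lebesgue_Rn R d]_x (`|u (affine 1 (h n) x) - u x|)%:E @[n --> \oo] --> 0)%E.
Proof.
elim: d u h => [|d IH] u h iu h0.
  apply: cvg_near_cst; apply: nearW => n; rewrite integral_Rn0.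
  rewrite (_ : affine 1 (h n) [tuple] = [tuple]) ?subrr ?normr0//.
  by apply: eq_from_tnth => -[].
have mu : measurable_fun setT u by have /integrableP[/measurable_EFinP] := iu.
have [_ fu] := integrableP _ _ _ iu.
pose v (a : R) (x : Rn R d) := u (cons_point (a, x)).
have mv : measurable_fun setT (fun z : R * Rn R d => v z.1 z.2).
  apply: (measurableT_comp mu (g := fun z : R * Rn R d => cons_point (z.1, z.2))).
  rewrite (_ : (fun z => _) = @cons_point R d); first exact: measurable_cons_point.
  by apply/funext => -[].
have mva dX (X : measurableType dX) (f : X -> R) (g : X -> Rn R d) :
    measurable_fun setT f -> measurable_fun setT g -> measurable_fun setT (fun z => v (f z) (g
      z)).
  move=> mf mg; apply: (measurableT_comp mv (g := fun z => (f z, g z))).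
  exact: measurable_fun_pair.
pose a n : R := thead (h n); pose y n : Rn R d := [tuple of behead (h n)].
have hE n : h n = cons_point (a n, y n).
  by rewrite /cons_point [LHS]tuple_eta; exact/val_inj.
have a0 : a @ \oo --> 0 by have := h0 ord0; apply: cvg_trans.
have y0 i : (tnth (y n) i : R) @[n --> \oo] --> (0 : R).
  have := h0 (lift ord0 i).
  by under eq_fun do rewrite hE tnth_consS.
have vE : (\int[leb]_a \int[lebesgue_Rn R d]_x (`|v a x|)%:E < +oo)%E.
  rewrite ge0_integral_cons// in fu; last by repeat meas_step.
have mnv : measurable_fun setT (fun z : R * Rn R d => (`|v z.1 z.2|)%:E).
  by apply/measurable_EFinP/(measurableT_comp (@normr_measurable _ setT)).
pose g2 a := (2%:E * \int[lebesgue_Rn R d]_x (`|v a x|)%:E)%E.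
pose g1 x := (2%:E * \int[leb]_a (`|v a x|)%:E)%E.
have mg2 : measurable_fun setT g2.
  by apply: measurable_funeM; exact: (ge0_measurable_integral2 (fun a x => (`|v a x|)%:E)).
have mg1 : measurable_fun setT g1.
  apply: measurable_funeM.
  exact: (@ge0_measurable_integral1 _ _ _ _ _ leb (fun a x => (`|v a x|)%:E)).
have ig2 : leb.-integrable setT g2.
  apply/integrableP; split => //; under eq_integral do rewrite gee0_abs ?mule_ge0//
    ?integral_ge0//.
  rewrite ge0_integralZl//; first by rewrite lte_mul_pinfty.
    exact: (ge0_measurable_integral2 (fun a x => (`|v a x|)%:E)).
  by move=> x _; exact: integral_ge0.
have ig1 : (lebesgue_Rn R d).-integrable setT g1.
  apply/integrableP; split => //; under eq_integral do rewrite gee0_abs ?mule_ge0//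
    ?integral_ge0//.
  rewrite ge0_integralZl//; first last.
  - by move=> x _; exact: integral_ge0.
  - exact: (@ge0_measurable_integral1 _ _ _ _ _ leb (fun a x => (`|v a x|)%:E)).
  rewrite -(@ge0_integral_swap _ _ _ _ _ leb (lebesgue_Rn R d) (fun a x => (`|v a x|)%:E))//.
  by rewrite lte_mul_pinfty.
pose Phi n x := (\int[leb]_b (`|v (a n + 1 * b)%R x - v b x|)%:E)%E.
pose Psi n b := (\int[lebesgue_Rn R d]_x (`|v b (affine 1 (y n) x) - v b x|)%:E)%E.
have mPhi2 n : measurable_fun setT (fun z : R * Rn R d => (`|v (a n + 1 * z.1)%R z.2 - v z.1
  z.2|)%:E).
  apply/measurable_EFinP/(measurableT_comp (@normr_measurable _ setT)).
  by apply: measurable_funB => //; apply: mva; repeat meas_step.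
have mPsi2 n : measurable_fun setT (fun z : R * Rn R d => (`|v z.1 (affine 1 (y n) z.2) - v z.1
  z.2|)%:E).
  apply/measurable_EFinP/(measurableT_comp (@normr_measurable _ setT)).
  by apply: measurable_funB => //; apply: mva; repeat meas_step.
have mPhi n : measurable_fun setT (Phi n).
  exact: (@ge0_measurable_integral1 _ _ _ _ _ leb (fun b x => (`|v (a n + 1 * b)%R x - v b
    x|)%:E) (mPhi2 n)).
have mPsi n : measurable_fun setT (Psi n).
  exact: (ge0_measurable_integral2 (fun b x => (`|v b (affine 1 (y n) x) - v b x|)%:E)).
have Phi0 n x : (0 <= Phi n x)%E by exact: integral_ge0.
have Psi0 n x : (0 <= Psi n x)%E by exact: integral_ge0.
have mv2 b : measurable_fun setT (v b) by apply: mva.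
have mv1 x : measurable_fun setT (v^~ x) by apply: mva.
have cPhi : (\int[lebesgue_Rn R d]_x Phi n x @[n --> \oo] --> 0)%E.
  rewrite [X in _ --> X](_ : _ = \int[lebesgue_Rn R d]_x (cst 0%E) x)%E;
    last by rewrite integral0.
  apply: (@cvg_integral_dominated _ _ _ _ _ _ g1) => //.
  - apply: filterS (integrable_ae measurableT ig1) => x /(_ I) fg1.
    apply: cvg_translation1 => //; apply/integrableP; split; first by apply/measurable_EFinP;
      first [exact: mv1|exact: mv2].
    move: fg1; rewrite /g1 ge0_fin_numE ?mule_ge0 ?integral_ge0//.
    apply: le_lt_trans; rewrite -[leLHS]mul1e; apply: lee_wpmul2r; first exact: integral_ge0.
    by rewrite lee_fin ler1n.
  - by move=> x n; rewrite gee0_abs//; exact: le_integral_translation1.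
have cPsi : (\int[leb]_x Psi n x @[n --> \oo] --> 0)%E.
  rewrite [X in _ --> X](_ : _ = \int[leb]_x (cst 0%E) x)%E; last by rewrite integral0.
  apply: (@cvg_integral_dominated _ _ _ leb _ _ g2) => //.
  - apply: filterS (integrable_ae measurableT ig2) => x /(_ I) fg2.
    apply: IH => //; apply/integrableP; split; first by apply/measurable_EFinP;
      first [exact: mv1|exact: mv2].
    move: fg2; rewrite /g2 ge0_fin_numE ?mule_ge0 ?integral_ge0//.
    apply: le_lt_trans; rewrite -[leLHS]mul1e; apply: lee_wpmul2r; first exact: integral_ge0.
    by rewrite lee_fin ler1n.
  - by move=> x n; rewrite gee0_abs//; exact: le_integral_translation.
have cS : ((\int[lebesgue_Rn R d]_x Phi n x + \int[leb]_b Psi n b) @[n --> \oo] --> 0)%E.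
  by rewrite -[X in _ --> X]adde0; apply: cvgeD.
apply: (squeeze_cvge _ (cvg_cst _) cS); apply: nearW => n; apply/andP; split;
  first exact: integral_ge0.
rewrite ge0_integral_cons//; last by repeat meas_step.
(* The triangle inequality produces the oscillation in the first coordinate at the shifted point
   [affine 1 (y n) x]; translation invariance brings [Phi] there. *)
rewrite -(@ge0_integral_translation _ (y n) (Phi n))//.
rewrite /Phi -(@ge0_integral_swap _ _ _ _ _ leb (lebesgue_Rn R d)
  (fun b x => (`|v (a n + 1 * b)%R (affine 1 (y n) x) - v b (affine 1 (y n) x)|)%:E))//;
    last first.
  apply/measurable_EFinP/(measurableT_comp (@normr_measurable _ setT)).
  by apply: measurable_funB; apply: mva; repeat meas_step.
have m1 : measurable_fun setT (fun z : R * Rn R d =>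
    (`|v (a n + 1 * z.1)%R (affine 1 (y n) z.2) - v z.1 (affine 1 (y n) z.2)|)%:E).
  apply/measurable_EFinP/(measurableT_comp (@normr_measurable _ setT)).
  by apply: measurable_funB; apply: mva; repeat meas_step.
have m2 : measurable_fun setT (fun z : R * Rn R d =>
    (`|v (a n + 1 * z.1)%R (affine 1 (y n) z.2) - v z.1 z.2|)%:E).
  apply/measurable_EFinP/(measurableT_comp (@normr_measurable _ setT)).
  by apply: measurable_funB => //; apply: mva; repeat meas_step.
have mI1 : measurable_fun setT (fun b : R => \int[lebesgue_Rn R d]_x
    (`|v (a n + 1 * b)%R (affine 1 (y n) x) - v b (affine 1 (y n) x)|)%:E)%E.
  exact: (ge0_measurable_integral2 (fun (b : R) x =>
    (`|v (a n + 1 * b)%R (affine 1 (y n) x) - v b (affine 1 (y n) x)|)%:E)).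
have I1_ge0 b : (0 <= \int[lebesgue_Rn R d]_x
    (`|v (a n + 1 * b)%R (affine 1 (y n) x) - v b (affine 1 (y n) x)|)%:E)%E.
  exact: integral_ge0.
have <- := ge0_integralDT leb mI1 (mPsi n) I1_ge0 (Psi0 n).
have E b x : u (affine 1 (h n) (cons_point (b, x))) - u (cons_point (b, x)) =
    v (a n + 1 * b) (affine 1 (y n) x) - v b x by rewrite hE affine_cons.
have mI2 : measurable_fun setT (fun b : R => \int[lebesgue_Rn R d]_x
    (`|v (a n + 1 * b)%R (affine 1 (y n) x) - v b x|)%:E)%E.
  exact: (ge0_measurable_integral2 (fun (b : R) x =>
    (`|v (a n + 1 * b)%R (affine 1 (y n) x) - v b x|)%:E)).
have mI3 := emeasurable_funD mI1 (mPsi n).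
rewrite [leLHS](_ : _ = \int[leb]_b \int[lebesgue_Rn R d]_x
    (`|v (a n + 1 * b)%R (affine 1 (y n) x) - v b x|)%:E)%E; last first.
  by apply: eq_integral => b _; apply: eq_integral => x _; rewrite E.
apply: (ge0_le_integralT leb mI2 mI3) => [b|b]; first exact: integral_ge0.
have m1b := measurableT_comp m1 (measurable_pair1 b).
have m2b := measurableT_comp m2 (measurable_pair1 b).
have m3b := measurableT_comp (mPsi2 n) (measurable_pair1 b).
rewrite /Psi -(ge0_integralDT _ m1b m3b); [|by move=> x; rewrite lee_fin|by move=> x;
  rewrite lee_fin].
apply: (ge0_le_integralT _ m2b (emeasurable_funD m1b m3b)) => x; first by rewrite lee_fin.
by rewrite /= -EFinD lee_fin ler_distD.
Qed.

End translation_Rn.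

(** * Parseval's inequality *)

Ltac meas_tuple ::= lazymatch goal with
    | |- measurable_fun _ (fun x => affine ?r (@?f x) (@?g x)) =>
        apply: (measurable_affine_comp r (f := f) (g := g))
    | |- measurable_fun _ (fun x => subp (@?f x) (@?g x)) =>
        apply: (measurable_affine_comp (-1) (f := f) (g := g))
    | |- measurable_fun _ (fun x => dotp (@?f x) (@?g x)) =>
        apply: (measurable_dotp_comp (f := f) (g := g))
    | |- measurable_fun _ (fun x => enorm (@?f x)) => apply: (measurable_enorm_comp (f := f))
    | |- measurable_fun _ (fun x => heat ?t (@?f x) (@?g x)) =>
        apply: (measurable_heat t (f := f) (g := g))
    | |- measurable_fun _ (heat ?t ?x) => apply: (measurable_heat t (f := fun=> x) (g := id))
    | |- measurable_fun _ (ft _ _) => apply: measurable_ft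
    end.
Ltac meas0 := repeat meas_step.

Lemma le_Rintegral_ge0 d (T : measurableType d) (R : realType)
    (mu : {measure set T -> \bar R}) (f : T -> R) : measurable_fun setT f ->
  ((\int[mu]_x f x)%:E <= \int[mu]_x (`|f x|)%:E)%E.
Proof.
move=> mf; apply: le_trans (le_normr_Rintegral_ge0 mu mf).
by rewrite lee_fin ler_norm.
Qed.

(** The order of the limits is what counts: with [eps] fixed, Fatou removes [D n] in spite of the
    factor [eps^-1]; then [eps] tends to 0, which removes the finite [S]. *)
Lemma ge0_integral_le_eps d (T : measurableType d) (R : realType)
    (mu : {measure set T -> \bar R}) (f_ : nat -> T -> \bar R) (f : T -> \bar R)
    (C S : \bar R) (D : nat -> \bar R) :
  (forall n, measurable_fun setT (f_ n)) -> (forall n x, 0 <= f_ n x)%E ->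
  (forall x, f_ ^~ x @ \oo --> f x) ->
  (0 <= C)%E -> (0 <= S)%E -> (S < +oo)%E -> D @ \oo --> 0%E ->
  (forall n (eps : R), (0 < eps)%R ->
    (\int[mu]_x f_ n x <= C + (eps%:E * S + eps^-1%:E * D n))%E) ->
  (\int[mu]_x f x <= C)%E.
Proof.
move=> mf f0 ff C0 S0 Soo D0 fCSD.
have Sfin : S \is a fin_num by rewrite ge0_fin_numE.
have [->|Cfin] := eqVneq C +oo%E; first by rewrite leey.
have step (eps : R) : 0 < eps -> (\int[mu]_x f x <= C + eps%:E * S)%E.
  move=> eps0.
  apply: (@ge0_integral_le_cvg _ _ _ mu f_ _
    (fun n => C + (eps%:E * S + eps^-1%:E * D n))%E) => //.
  - by move=> n; exact: fCSD.
  - have CF : C \is a fin_num by rewrite ge0_fin_numE// ltey.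
    have ESF : (eps%:E * S)%E \is a fin_num by rewrite fin_numM.
    apply: cvgeD; [by rewrite fin_num_adde_defr|exact: cvg_cst|].
    rewrite -[X in _ --> X]adde0; apply: cvgeD; [by rewrite fin_num_adde_defr|exact: cvg_cst|].
    by rewrite -(mule0 eps^-1%:E); apply: cvgeZl.
apply/lee_addgt0Pr => eps eps0.
pose s := fine S; have s0 : 0 <= s by rewrite fine_ge0.
(* Dividing by [s + 1] keeps the product with [s] below [eps] and allows [s = 0]. *)
have d0 : 0 < eps / (s + 1) by rewrite divr_gt0// ltr_wpDl.
apply: le_trans (step _ d0) _; apply: leeD => //.
rewrite -(fineK Sfin) -EFinM lee_fin -/s mulrAC ler_pdivrMr ?ltr_wpDl//.
by rewrite ler_wpM2l ?ltW// ltrDl.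
Qed.

(** * Approximation by the heat kernel and the pairing inequality *)

Section heat_approximation.
Context {R : realType} {d : nat}.
Local Notation mu := (lebesgue_Rn R d).
Local Notation I f := (mu.-integrable setT (fun x => (f x)%:E)).
Implicit Types (a b v : Rn R d -> R).

(** The signed square p |p| carries L^2 into L^1, so continuity of translations in L^2 reduces to
    the case of L^1. *)
Lemma sqrB_le (p q : R) : (p - q) ^+ 2 <= 2 * `|p * `|p| - q * `|q| |.
Proof.
wlog pq : p q / q <= p.
  move=> H; case: (lerP q p) => [/H//|/ltW/H].
  by rewrite [X in _ <= 2 * X]distrC -[X in X <= _]sqrrN opprB.
apply: le_trans (_ : 2 * (p * `|p| - q * `|q|) <= _); last first.
  by rewrite ler_wpM2l// ler_norm.
case: (ler0P p) => p0; case: (ler0P q) => q0; last 2 first.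
- have := sqr_ge0 (p + q); nra.
- have h1 : 0 <= p - q by rewrite subr_ge0.
  have h2 : 0 <= p + 3 * q by lra.
  have := mulr_ge0 h1 h2; nra.
- have h1 : 0 <= p - q by rewrite subr_ge0.
  have h2 : 0 <= - 3 * p - q by lra.
  have := mulr_ge0 h1 h2; nra.
- by have := le_lt_trans p0 q0; rewrite ltNge pq.
Qed.

Lemma measurable_EFin_heat (t : R) (x : Rn R d) :
  measurable_fun setT (fun y => (heat t x y)%:E).
Proof. by apply/measurable_EFinP; exact: (measurable_heat t (f := fun=> x) (g := id)). Qed.

Lemma EFin_heat_ge0 (t : R) (x y : Rn R d) : (0 <= (heat t x y)%:E)%E.
Proof. by rewrite lee_fin heat_ge0. Qed.

Lemma cvg_translation_sqr v (h : nat -> Rn R d) :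
  measurable_fun setT v -> I (fun x => v x ^+ 2) ->
  (forall i, (tnth (h n) i : R) @[n --> \oo] --> (0 : R)) ->
  (\int[mu]_x ((v (affine 1 (h n) x) - v x) ^+ 2)%:E @[n --> \oo] --> 0)%E.
Proof.
move=> mv iv h0.
pose u x := v x * `|v x|.
have mu_ : measurable_fun setT u by rewrite /u; meas0.
have iu : I u.
  apply: le_integrable iv => //; first exact/measurable_EFinP.
  by move=> x _; rewrite /= lee_fin /u normrM normr_id normrX expr2.
have c0 := cvg_translation iu h0.
have c1 : (2%:E * \int[mu]_x (`|u (affine 1 (h n) x) - u x|)%:E @[n --> \oo] --> 0)%E.
  by rewrite -(mule0 2%:E); apply: cvgeZl.
apply: (squeeze_cvge _ (cvg_cst _) c1); apply: nearW => n; apply/andP; split.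
  by apply: integral_ge0 => x _; rewrite lee_fin sqr_ge0.
have mvh : measurable_fun setT (fun x => v (affine 1 (h n) x)) by meas0.
have muh : measurable_fun setT (fun x => u (affine 1 (h n) x)) by meas0.
rewrite -ge0_integralZl//; last by meas0.
apply: ge0_le_integralT => [||x|x]; [by meas0|by meas0| |].
  by rewrite lee_fin sqr_ge0.
by rewrite -EFinM lee_fin sqrB_le.
Qed.

(** After y = x + sqrt t z, the double integral is the average, against a fixed Gaussian in z, of
    the squared L^2 distance [Q n z] between [v] and its translate by sqrt t z. That distance tends
    to 0 and is at most four times the squared norm of [v]. *)
Lemma cvg_heat_sqr v : measurable_fun setT v -> I (fun x => v x ^+ 2) ->
  (\int[mu]_x \int[mu]_y (heat n.+1%:R^-1 x y * (v x - v y) ^+ 2)%:E @[n --> \oo] --> 0)%E.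
Proof.
move=> mv iv.
pose t n : R := n.+1%:R^-1.
have t0 n : 0 < t n by rewrite invr_gt0.
pose h n z : Rn R d := scalep (Num.sqrt (t n)) z.
have hE n (x z : Rn R d) : affine (Num.sqrt (t n)) x z = affine 1 (h n z) x.
  by apply: eq_from_tnth => i; rewrite !tnth_affine tnth_mktuple; ring.
pose Q n z := (\int[mu]_x ((v (affine 1 (h n z) x) - v x) ^+ 2)%:E)%E.
pose S := (\int[mu]_x (v x ^+ 2)%:E)%E.
have mh n : measurable_fun setT (h n).
  apply/measurable_fun_tnthP => i.
  rewrite (_ : _ \o _ = fun x => Num.sqrt (t n) * (tnth x i : R)); last first.
    by apply/funext => x /=; rewrite tnth_mktuple.
  by meas0.
have mQ2 n : measurable_fun setT (fun z : Rn R d * Rn R d => ((v (affine 1 (h n z.1) z.2) - v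
  z.2) ^+ 2)%:E).
  by have mhn := mh n; meas0.
have mQ n : measurable_fun setT (Q n).
  apply: (ge0_measurable_integral2 (fun z x => ((v (affine 1 (h n z) x) - v x) ^+ 2)%:E)) => //.
  by move=> x y; rewrite lee_fin sqr_ge0.
have Q0 n z : (0 <= Q n z)%E by apply: integral_ge0 => x _; rewrite lee_fin sqr_ge0.
have QS n z : (Q n z <= 4%:E * S)%E.
  have mvh : measurable_fun setT (fun x => v (affine 1 (h n z) x)) by meas0.
  have -> : (4%:E * S = 2%:E * S + 2%:E * S)%E.
    have S0 : (0 <= S)%E by apply: integral_ge0 => x _; rewrite lee_fin sqr_ge0.
    by rewrite -ge0_muleDl//; congr (_ * _)%E; rewrite -EFinD; congr EFin; ring.
  rewrite -[X in (_ <= _ * X + _)%E](@ge0_integral_translation _ _ (h n z) (fun x => (v x ^+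
    2)%:E)); last 2 first.
  - by meas0.
  - by move=> x; rewrite lee_fin sqr_ge0.
  have sq0 (w : Rn R d -> R) x : (0 <= (w x ^+ 2)%:E)%E by rewrite lee_fin sqr_ge0.
  have mv2 : measurable_fun setT (fun x => (v x ^+ 2)%:E) by meas0.
  have mvh2 : measurable_fun setT (fun x => (v (affine 1 (h n z) x) ^+ 2)%:E) by meas0.
  rewrite -(ge0_integralZlT mu mv2 (sq0 v))// -(ge0_integralZlT mu mvh2 (sq0 _))//.
  rewrite -ge0_integralDT; [|by meas0|by meas0| |]; last 2 first.
  - by move=> x; rewrite mule_ge0// lee_fin sqr_ge0.
  - by move=> x; rewrite mule_ge0// lee_fin sqr_ge0.
  apply: ge0_le_integralT => [||x|x]; [by meas0|by meas0| |].
    by rewrite lee_fin sqr_ge0.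
  rewrite -!EFinM -EFinD lee_fin.
  by have := sqr_ge0 (v (affine 1 (h n z) x) + v x); nra.
have Soo : (S < +oo)%E.
  case/integrableP: iv => _; apply: le_lt_trans.
  apply: ge0_le_integralT => [||x|x]; [by meas0|by meas0| |].
    by rewrite lee_fin sqr_ge0.
  by rewrite gee0_abs// lee_fin sqr_ge0.
have S0 : (0 <= S)%E by apply: integral_ge0 => x _; rewrite lee_fin sqr_ge0.
have E n : (\int[mu]_x \int[mu]_y (heat (t n) x y * (v x - v y) ^+ 2)%:E =
    \int[mu]_z ((heat 1 (origin d) z)%:E * Q n z))%E.
  transitivity (\int[mu]_x \int[mu]_z (heat 1 (origin d) z * (v (affine 1 (h n z) x) - v x) ^+
    2)%:E)%E.
    apply: eq_integral => x _.
    rewrite (@ge0_integral_heat_affine _ _ (t n) x (fun y => (v x - v y) ^+ 2))//; last 2 first.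
    - by meas0.
    - by move=> y; rewrite sqr_ge0.
    by apply: eq_integral => z _; rewrite hE -sqrrN opprB.
  have mhn := mh n.
  rewrite (@ge0_integral_swap _ _ _ _ _ mu mu (fun x z =>
     (heat 1 (origin d) z * (v (affine 1 (h n z) x) - v x) ^+ 2)%:E)); last 2 first.
  - by meas0.
  - by move=> x z; rewrite lee_fin mulr_ge0 ?heat_ge0 ?sqr_ge0.
  apply: eq_integral => z _; rewrite /Q -ge0_integralZl//.
  - by meas0.
  - by move=> x _; rewrite lee_fin sqr_ge0.
  - by rewrite lee_fin heat_ge0.
rewrite (_ : (fun n => _) = (fun n => \int[mu]_z ((heat 1 (origin d) z)%:E * Q n z))%E);
  last first.
  by apply/funext => n; exact: E.
rewrite [X in _ --> X](_ : _ = \int[mu]_x (cst 0%E) x)%E; last by rewrite integral0.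
apply: (@cvg_integral_dominated _ _ _ mu _ _ (fun z => (heat 1 (origin d) z)%:E * (4%:E *
  S))%E) => //.
- move=> n; apply: emeasurable_funM; last exact: mQ.
  apply/measurable_EFinP.
  exact: (measurable_heat 1 (f := fun=> origin d) (g := id)).
- apply: aeW => z; rewrite -(mule0 (heat 1 (origin d) z)%:E); apply: cvgeZl => //.
  apply: cvg_translation_sqr => // i; under eq_fun do rewrite tnth_mktuple.
  rewrite -(mul0r (tnth z i : R)); apply: cvgM; last exact: cvg_cst.
  rewrite -sqrtr0; apply: continuous_cvg; first exact: sqrt_continuous.
  exact: cvg_harmonic.
- apply/integrableP; split.
    apply: emeasurable_funM; last exact: measurable_cst.
    by apply/measurable_EFinP; exact: (measurable_heat 1 (f := fun=> origin d) (g := id)).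
  under eq_integral do rewrite gee0_abs ?mule_ge0 ?lee_fin ?heat_ge0//.
  under eq_integral do rewrite muleC.
  rewrite (ge0_integralZlT mu (measurable_EFin_heat _ _) (EFin_heat_ge0 _ _)) ?mule_ge0//.
  by rewrite integral_heat// mule1 lte_mul_pinfty.
- move=> x n; rewrite gee0_abs ?mule_ge0 ?lee_fin ?heat_ge0//.
  by apply: lee_wpmul2l => //; rewrite lee_fin heat_ge0.
Qed.

Lemma amgm_eps (e p q : R) : 0 < e -> `|p| * `|q| <= e * p ^+ 2 + e^-1 * q ^+ 2.
Proof.
move=> e0; have := amgm_norm (e * p) q; rewrite normrM (gtr0_norm e0) => h.
rewrite -(ler_pM2l e0) mulrDr mulVKf ?gt_eqF//.
have : 0 <= e * (`|p| * `|q|) by rewrite !mulr_ge0// ltW.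
by move: h; rewrite exprMn; nra.
Qed.

Lemma heat_le (t : R) (x y : Rn R d) : 0 < t -> heat t x y <= (Num.sqrt (4 * pi * t) ^+ d)^-1
  :> R.
Proof.
move=> t0; rewrite /heat ler_piMr ?invr_ge0 ?exprn_ge0 ?sqrtr_ge0// -expR0 ler_expR oppr_le0.
by rewrite divr_ge0 ?dotp_ge0// mulr_ge0// ltW.
Qed.

Lemma integrable_heat (t : R) (x : Rn R d) : 0 < t -> I (heat t x).
Proof.
move=> t0; apply/integrableP; split.
  by apply/measurable_EFinP; exact: (measurable_heat t (f := fun=> x) (g := id)).
under eq_integral do rewrite gee0_abs ?lee_fin ?heat_ge0//.
by rewrite integral_heat// ltry.
Qed.

Section pairing.
Variables (a b a' b' : Rn R d -> R).
Hypotheses (ia : I a) (ib : I b) (ia' : I a') (ib' : I b').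
Hypotheses (ia2 : I (fun x => a x ^+ 2)) (ib2 : I (fun x => b x ^+ 2)).
Hypotheses (ia'2 : I (fun x => a' x ^+ 2)) (ib'2 : I (fun x => b' x ^+ 2)).
Hypothesis r0 : forall x, 0 <= a' x * a x + b' x * b x.

Let ma : measurable_fun setT a. Proof. by have /integrableP[/measurable_EFinP] := ia. Qed.
Let mb : measurable_fun setT b. Proof. by have /integrableP[/measurable_EFinP] := ib. Qed.
Let ma' : measurable_fun setT a'. Proof. by have /integrableP[/measurable_EFinP] := ia'. Qed.
Let mb' : measurable_fun setT b'. Proof. by have /integrableP[/measurable_EFinP] := ib'. Qed.

Let C := (\int[mu]_xi (`|ft a' b' xi| * `|ft a b xi| +
   `|ft b' (fun x => - a' x) xi| * `|ft b (fun x => - a x) xi|)%:E)%E.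
Let e t x := (\int[mu]_y (heat t x y * (`|a' x| * `|a x - a y| + `|b' x| * `|b x - b y|))%:E)%E.
Let S := (\int[mu]_x (a' x ^+ 2 + b' x ^+ 2)%:E)%E.

(** Replacing [a x] and [b x] by their heat averages costs at most [e t x]. The averaged pairing [G]
    integrates, by [ft_pairing], to the pairing of the transforms with a Gaussian weight, which is
    at most 1. *)
Lemma heat_pairing_le (t : R) : 0 < t ->
  (\int[mu]_x (a' x * a x + b' x * b x)%:E <= C + \int[mu]_x e t x)%E.
Proof.
move=> t0.
pose K : R := (Num.sqrt (4 * pi * t) ^+ d)^-1.
have K0 : 0 <= K by rewrite invr_ge0 exprn_ge0 ?sqrtr_ge0.
have hK (x y : Rn R d) : `|heat t x y| <= K.
  by rewrite ger0_norm ?heat_ge0//; exact: (heat_le x y t0).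
have mhx (x : Rn R d) : measurable_fun setT (heat t x) by have /integrableP[/measurable_EFinP]
  := integrable_heat x t0.
pose G x := \int[mu]_y (heat t x y * (a' x * a y + b' x * b y)).
have mH : measurable_fun setT (fun z : Rn R d * Rn R d => heat t z.1 z.2 * (a' z.1 * a z.2 + b'
  z.1 * b z.2)).
  by meas0.
have iab : I (fun x => `|a x| + `|b x|) by apply: integrable_addr; exact: integrable_normr.
have iab' : I (fun x => K * (`|a' x| + `|b' x|)).
  have iab0 : I (fun x => `|a' x| + `|b' x|) by apply: integrable_addr; exact: integrable_normr.
  exact: (integrableZl measurableT K iab0).
have HAB x y : `|heat t x y * (a' x * a y + b' x * b y)| <= (K * (`|a' x| + `|b' x|)) * (`|a y|
  + `|b y|).
  rewrite normrM -mulrA ler_pM// (le_trans (ler_normD _ _))// !normrM.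
  have := normr_ge0 (a' x); have := normr_ge0 (b' x); have := normr_ge0 (a y);
    have := normr_ge0 (b y).
  nra.
have iG : I G := dominated_integrable_Rintegral2 mH iab' iab HAB.
have mG : measurable_fun setT G by have /integrableP[/measurable_EFinP] := iG.
have m1 := measurable_ft ma mb.
have m2 : measurable_fun setT (ft b (fun x => - a x)) by apply: measurable_ft => //; meas0.
have m1' := measurable_ft ma' mb'.
have m2' : measurable_fun setT (ft b' (fun x => - a' x)) by apply: measurable_ft => //; meas0.
have JC : ((\int[mu]_x G x)%:E <= C)%E.
  rewrite -(ft_pairing t0 ia' ib' ia ib).
  apply: le_trans (le_Rintegral_ge0 _ _) _; first by meas0.
  apply: ge0_le_integralT => [||xi|xi]; [by meas0|by meas0|by rewrite lee_fin|].
  rewrite lee_fin normrM ger0_norm ?expR_ge0//.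
  apply: le_trans (ler_piMl (normr_ge0 _) _) _.
    by rewrite -expR0 ler_expR mulNr oppr_le0 mulr_ge0 ?dotp_ge0// ltW.
  by rewrite (le_trans (ler_normD _ _))// !normrM.
have me2 : measurable_fun setT (fun z : Rn R d * Rn R d =>
   (heat t z.1 z.2 * (`|a' z.1| * `|a z.1 - a z.2| + `|b' z.1| * `|b z.1 - b z.2|))%:E) by meas0.
have e20 x y : (0 <= (heat t x y * (`|a' x| * `|a x - a y| + `|b' x| * `|b x - b y|))%:E)%E.
  by rewrite lee_fin mulr_ge0 ?heat_ge0// addr_ge0// mulr_ge0.
have me : measurable_fun setT (e t).
  exact: (ge0_measurable_integral2 (fun x y => (heat t x y * (`|a' x| * `|a x - a y| + `|b' x|
    * `|b x - b y|))%:E)).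
have e0 x : (0 <= e t x)%E by exact: integral_ge0.
have rGe x : ((a' x * a x + b' x * b x)%:E <= (G x)%:E + e t x)%E.
  have ih := integrable_heat x t0.
  have iHx := dominated_integrable2 mH iab HAB x.
  have -> : ((a' x * a x + b' x * b x)%:E = (G x)%:E + (a' x * a x + b' x * b x - G x)%:E)%E.
    by rewrite -EFinD; congr EFin; ring.
  apply: leeD => //.
  have -> : (a' x * a x + b' x * b x - G x)%:E =
    (\int[mu]_y (heat t x y * (a' x * (a x - a y) + b' x * (b x - b y))))%:E.
    congr EFin.
    have -> : a' x * a x + b' x * b x = \int[mu]_y ((a' x * a x + b' x * b x) * heat t x y).
      by rewrite RintegralZl// /Rintegral integral_heat//= mulr1.
    rewrite -RintegralB//; last exact: (integrableZl measurableT (a' x * a x + b' x * b x) ih).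
    by apply: eq_Rintegral => y _; ring.
  apply: le_trans (le_Rintegral_ge0 _ _) _; first by meas0.
  apply: ge0_le_integralT => [||y|y]; [by meas0|by meas0|by rewrite lee_fin|].
  rewrite lee_fin normrM ger0_norm ?heat_ge0// ler_wpM2l ?heat_ge0//.
  by rewrite (le_trans (ler_normD _ _))// !normrM.
have mr : measurable_fun setT (fun x => (a' x * a x + b' x * b x)%:E) by meas0.
(* With an infinite error there is nothing to prove. Otherwise [e t] is integrable, so its integral
   can be split from that of [G], whose sign is unknown. *)
have [ioo|] := ltP (\int[mu]_x e t x)%E +oo%E; last first.
  rewrite leye_eq => /eqP ->; rewrite addey ?leey// -ltNye.
  by apply: lt_le_trans (integral_ge0 _ _) => // xi _; rewrite lee_fin addr_ge0// mulr_ge0.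
have ie : mu.-integrable setT (e t).
  apply/integrableP; split => //.
  by under eq_integral do rewrite gee0_abs//.
have mGe : measurable_fun setT (fun x => ((G x)%:E + e t x)%E).
  by apply: emeasurable_funD => //; exact/measurable_EFinP.
apply: le_trans (_ : _ <= \int[mu]_x ((G x)%:E + e t x))%E _.
  by apply: ge0_le_integralT => // x; rewrite lee_fin.
rewrite integralD//; apply: leeD => //.
by rewrite -ge0_EFin_Rintegral.
Qed.

(** AM-GM with weight [eps] separates the fixed factors [a'], [b'], which by unit mass of the kernel
    contribute [eps * S], from the oscillation of [a], [b], which vanishes with [t] by
    [cvg_heat_sqr]. *)
Lemma heat_error_le (t eps : R) : 0 < t -> 0 < eps ->
  (\int[mu]_x e t x <= eps%:E * S + eps^-1%:E *
    (\int[mu]_x \int[mu]_y (heat t x y * (a x - a y) ^+ 2)%:E +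
     \int[mu]_x \int[mu]_y (heat t x y * (b x - b y) ^+ 2)%:E))%E.
Proof.
move=> t0 eps0.
have eps1 : 0 <= eps^-1 by rewrite invr_ge0 ltW.
pose s x := a' x ^+ 2 + b' x ^+ 2.
have s0 x : 0 <= s x by rewrite addr_ge0// sqr_ge0.
have ms_ : measurable_fun setT s by rewrite /s; meas0.
pose E1 x := (\int[mu]_y (heat t x y * (eps * s x))%:E)%E.
pose F v x := (\int[mu]_y (heat t x y * (v x - v y) ^+ 2)%:E)%E.
have h0 x y : 0 <= heat t x y by exact: heat_ge0.
have mF2 v : measurable_fun setT v -> measurable_fun setT (fun z : Rn R d * Rn R d => (heat t
  z.1 z.2 * (v z.1 - v z.2) ^+ 2)%:E).
  by move=> mv; meas0.
have F20 v x y : (0 <= (heat t x y * (v x - v y) ^+ 2)%:E)%E by rewrite lee_fin mulr_ge0//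
  sqr_ge0.
have mF v : measurable_fun setT v -> measurable_fun setT (F v).
  move=> mv; exact: (ge0_measurable_integral2 (fun x y => (heat t x y * (v x - v y) ^+ 2)%:E)
    (mF2 v mv)).
have F0 v x : (0 <= F v x)%E by exact: integral_ge0.
have mE1 : measurable_fun setT E1.
  apply: (ge0_measurable_integral2 (fun x y => (heat t x y * (eps * s x))%:E)).
    by meas0.
  by move=> x y; rewrite lee_fin !mulr_ge0// ltW.
have E10 x : (0 <= E1 x)%E by apply: integral_ge0 => y _; rewrite lee_fin !mulr_ge0// ltW.
have -> : (eps%:E * S = \int[mu]_x E1 x)%E.
  have eS : (0 <= eps%:E)%E by rewrite lee_fin ltW.
  rewrite /S -ge0_integralZlT//; [|by meas0].
  apply: eq_integral => x _; rewrite /E1.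
  transitivity (\int[mu]_y ((eps * s x)%:E * (heat t x y)%:E))%E; last first.
    by apply: eq_integral => y _; rewrite -EFinM mulrC.
  have es0 : (0 <= (eps * s x)%:E)%E by rewrite lee_fin mulr_ge0// ltW.
  rewrite (ge0_integralZlT mu (measurable_EFin_heat _ _) (EFin_heat_ge0 _ _) es0).
  by rewrite integral_heat// mule1 EFinM.
have meps := mF _ ma; have mepsb := mF _ mb.
have inv0 : (0 <= eps^-1%:E)%E by rewrite lee_fin.
have mFD := emeasurable_funD meps mepsb.
have FD0 x : (0 <= F a x + F b x)%E by rewrite adde_ge0.
have mFE := measurable_funeM eps^-1%:E mFD.
have FE0 x : (0 <= eps^-1%:E * (F a x + F b x))%E by rewrite mule_ge0.
rewrite -[X in (_ <= _ + _ * X)%E](ge0_integralDT mu meps mepsb (F0 a) (F0 b)).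
have <- := ge0_integralZlT mu mFD FD0 inv0.
have <- := ge0_integralDT mu mE1 mFE E10 FE0.
have mhx (x : Rn R d) : measurable_fun setT (heat t x) by have /integrableP[/measurable_EFinP]
  := integrable_heat x t0.
apply: ge0_le_integralT => [||x|x].
- apply: (ge0_measurable_integral2 (fun x y => (heat t x y * (`|a' x| * `|a x - a y| + `|b' x|
  * `|b x - b y|))%:E)).
    by meas0.
  by move=> x y; rewrite lee_fin mulr_ge0// addr_ge0// mulr_ge0.
- exact: emeasurable_funD.
- by apply: integral_ge0 => y _; rewrite lee_fin mulr_ge0// addr_ge0// mulr_ge0.
have mfa : measurable_fun setT (fun y => (heat t x y * (a x - a y) ^+ 2)%:E) by meas0.
have mfb : measurable_fun setT (fun y => (heat t x y * (b x - b y) ^+ 2)%:E) by meas0.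
have mfs : measurable_fun setT (fun y => (heat t x y * (eps * s x))%:E) by meas0.
have fs0 y : (0 <= (heat t x y * (eps * s x))%:E)%E by rewrite lee_fin !mulr_ge0// ltW.
have mfD := emeasurable_funD mfa mfb.
have fD0 y : (0 <= (heat t x y * (a x - a y) ^+ 2)%:E + (heat t x y * (b x - b y) ^+ 2)%:E)%E.
  by rewrite adde_ge0.
have mfE := measurable_funeM eps^-1%:E mfD.
have fE0 y : (0 <= eps^-1%:E * ((heat t x y * (a x - a y) ^+ 2)%:E +
    (heat t x y * (b x - b y) ^+ 2)%:E))%E by rewrite mule_ge0.
rewrite /F -(ge0_integralDT mu mfa mfb (F20 a x) (F20 b x)).
rewrite -(ge0_integralZlT mu mfD fD0 inv0) -(ge0_integralDT mu mfs mfE fs0 fE0).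
apply: ge0_le_integralT => [||y|y].
- by meas0.
- exact: emeasurable_funD.
- by rewrite lee_fin mulr_ge0// addr_ge0// mulr_ge0.
rewrite -[leRHS]/((heat t x y * (eps * s x) + eps^-1 *
  (heat t x y * (a x - a y) ^+ 2 + heat t x y * (b x - b y) ^+ 2))%:E) lee_fin.
rewrite -mulrDr [eps^-1 * _]mulrCA -mulrDr ler_wpM2l// /s.
have := amgm_eps (a' x) (a x - a y) eps0; have := amgm_eps (b' x) (b x - b y) eps0.
lra.
Qed.

Lemma pairing_le : (\int[mu]_x (a' x * a x + b' x * b x)%:E <= C)%E.
Proof.
have mr : measurable_fun setT (fun x => (a' x * a x + b' x * b x)%:E) by meas0.
pose D n := (\int[mu]_x \int[mu]_y (heat n.+1%:R^-1 x y * (a x - a y) ^+ 2)%:E +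
     \int[mu]_x \int[mu]_y (heat n.+1%:R^-1 x y * (b x - b y) ^+ 2)%:E)%E.
(* Here the integrand does not vary; only the error does, with [t = 1 / (n + 1)]. *)
apply: (@ge0_integral_le_eps _ _ _ mu (fun _ x => (a' x * a x + b' x * b x)%:E) _ C S D) => //.
- by move=> x; exact: cvg_cst.
- by apply: integral_ge0 => x _; rewrite lee_fin addr_ge0// mulr_ge0.
- by apply: integral_ge0 => x _; rewrite lee_fin addr_ge0// sqr_ge0.
- have /integrableP[_] := integrable_addr ia'2 ib'2.
  by under eq_integral do rewrite gee0_abs ?lee_fin ?addr_ge0 ?sqr_ge0//.
- by rewrite -[X in _ --> X]adde0; apply: cvgeD => //; exact: cvg_heat_sqr.
- move=> n eps eps0; have t0 : (0 : R) < n.+1%:R^-1 by rewrite invr_gt0.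
  apply: le_trans (heat_pairing_le t0) _; apply: leeD => //.
  exact: heat_error_le.
Qed.

End pairing.

End heat_approximation.

(** * Truncations, and Parseval's inequality for the Fourier-Plancherel transform *)

Section truncation.
Context {R : realType} {d : nat}.
Local Notation mu := (lebesgue_Rn R d).
Local Notation I f := (mu.-integrable setT (fun x => (f x)%:E)).
Implicit Types (a b v : Rn R d -> R).

Definition trunc (n : nat) a (x : Rn R d) : R := if enorm x <= n%:R then a x else 0.

Lemma measurable_trunc n a : measurable_fun setT a -> measurable_fun setT (trunc n a).
Proof.
move=> ma; apply: measurable_fun_ifT => //.
by apply: measurable_fun_ler => //; apply: measurable_enorm_comp.
Qed.

Lemma norm_trunc_le n a x : `|trunc n a x| <= `|a x|.
Proof. by rewrite /trunc; case: ifP => // _; rewrite normr0. Qed.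

Lemma cvg_trunc a x : trunc n a x @[n --> \oo] --> a x.
Proof.
apply: cvg_near_cst; exists (Num.truncn (enorm x)).+1 => // n /= xn.
rewrite /trunc ifT// (le_trans (ltW (truncnS_gt (enorm x))))//.
by rewrite ler_nat.
Qed.

(** |a| <= 1 + a^2, and on the ball of radius [n] the constant 1 is below the integrable Gaussian
    e^(n^2 - |x|^2). *)
Lemma integrable_trunc n a : measurable_fun setT a -> I (fun x => a x ^+ 2) ->
  I (trunc n a).
Proof.
move=> ma ia2.
have ig : I (fun x => expR (n%:R ^+ 2) * expR (- 1 * dotp x x)).
  exact: (integrableZl measurableT (expR (n%:R ^+ 2)) (@integrable_gauss_Rn R d 1 ltr01)).
apply: (le_integrable measurableT _ _ (integrable_addr ig ia2)).
  by apply/measurable_EFinP; exact: measurable_trunc.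
move=> x _; rewrite /= lee_fin /trunc.
have e0 : 0 <= expR (n%:R ^+ 2) * expR (- 1 * dotp x x) by rewrite mulr_ge0 ?expR_ge0.
rewrite [leRHS]ger0_norm ?addr_ge0 ?sqr_ge0//.
case: ifP => [xn|_]; last by rewrite normr0 addr_ge0 ?sqr_ge0.
have e1 : 1 <= expR (n%:R ^+ 2) * expR (- 1 * dotp x x).
  rewrite -expRD -[leLHS]expR0 ler_expR mulN1r subr_ge0 -enorm_sqr.
  by rewrite ler_sqr ?nnegrE ?enorm_ge0.
have := amgm_norm 1 (a x); rewrite normr1 expr1n mul1r.
have := sqr_ge0 (a x); lra.
Qed.

Lemma integrable_trunc_sqr n a : measurable_fun setT a -> I (fun x => a x ^+ 2) ->
  I (fun x => trunc n a x ^+ 2).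
Proof.
move=> ma ia2; have mt := measurable_trunc n ma.
apply: (le_integrable measurableT _ _ ia2); first by meas0.
move=> x _; rewrite /= lee_fin !normrX ler_sqr ?nnegrE//.
exact: norm_trunc_le.
Qed.

(** [a + i b] is only in L^2, and [p + i q] is the L^2 limit of the transforms of its truncations.
    Each truncation satisfies [pairing_le]; replacing its transform by the limit costs [eps] times
    the energy of a' + i b', bounded by Bessel, plus [eps^-1] times the squared L^2 error. The sign
    conditions allow Fatou on the left. *)
Lemma parseval_le (a b p q a' b' : Rn R d -> R) :
  measurable_fun setT a -> measurable_fun setT b ->
  measurable_fun setT p -> measurable_fun setT q ->
  I (fun x => a x ^+ 2) -> I (fun x => b x ^+ 2) -> I a' -> I b' ->
  I (fun x => a' x ^+ 2) -> I (fun x => b' x ^+ 2) ->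
  (forall x, 0 <= a' x * a x) -> (forall x, 0 <= b' x * b x) ->
  (\int[mu]_xi ((ft (trunc n a) (trunc n b) xi - p xi) ^+ 2 +
     (ft (trunc n b) (fun x => - trunc n a x) xi - q xi) ^+ 2)%:E @[n --> \oo] --> 0)%E ->
  (\int[mu]_x (a' x * a x + b' x * b x)%:E <=
   \int[mu]_xi (`|ft a' b' xi| * `|p xi| + `|ft b' (fun x => - a' x) xi| * `|q xi|)%:E)%E.
Proof.
move=> ma mb mp mq ia2 ib2 ia' ib' ia'2 ib'2 ra rb D0.
have ma' : measurable_fun setT a' by have /integrableP[/measurable_EFinP] := ia'.
have mb' : measurable_fun setT b' by have /integrableP[/measurable_EFinP] := ib'.
have mta n := measurable_trunc n ma; have mtb n := measurable_trunc n mb.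
have rta n x : 0 <= a' x * trunc n a x by rewrite /trunc; case: ifP; rewrite ?mulr0.
have rtb n x : 0 <= b' x * trunc n b x by rewrite /trunc; case: ifP; rewrite ?mulr0.
pose P' := ft a' b'; pose Q' := ft b' (fun x => - a' x).
pose P n := ft (trunc n a) (trunc n b); pose Q n := ft (trunc n b) (fun x => - trunc n a x).
have mP' : measurable_fun setT P' by apply: measurable_ft.
have mQ' : measurable_fun setT Q' by apply: measurable_ft => //; meas0.
have mP n : measurable_fun setT (P n) by apply: measurable_ft.
have mQ n : measurable_fun setT (Q n) by apply: measurable_ft => //; have := mta n => ?; meas0.
apply: (@ge0_integral_le_eps _ _ _ mu (fun n x => (a' x * trunc n a x + b' x * trunc n b x)%:E)
  _ _
  (\int[mu]_x (a' x ^+ 2 + b' x ^+ 2)%:E)%E _ _ _ _ _ _ _ D0).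
- by move=> n; have := mta n; have := mtb n => ? ?; meas0.
- by move=> n x; rewrite lee_fin addr_ge0.
- move=> x; apply: cvg_EFin; first exact: nearW.
  by apply: cvgD; apply: cvgM; (exact: cvg_cst || exact: cvg_trunc).
- by apply: integral_ge0 => x _; rewrite lee_fin addr_ge0// mulr_ge0.
- by apply: integral_ge0 => x _; rewrite lee_fin addr_ge0// sqr_ge0.
- have /integrableP[_] := integrable_addr ia'2 ib'2.
  by under eq_integral do rewrite gee0_abs ?lee_fin ?addr_ge0 ?sqr_ge0//.
move=> n eps eps0.
have eps1 : 0 <= eps^-1 by rewrite invr_ge0 ltW.
apply: le_trans (pairing_le (integrable_trunc n ma ia2) (integrable_trunc n mb ib2) ia' ib'
  (integrable_trunc_sqr n ma ia2) (integrable_trunc_sqr n mb ib2) ia'2 ib'2 _) _.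
  by move=> x; rewrite addr_ge0.
rewrite -/(P n) -/(Q n) -/P' -/Q'.
have e0 : (0 <= eps%:E)%E by rewrite lee_fin ltW.
apply: le_trans (_ : _ <= \int[mu]_xi (`|P' xi| * `|p xi| + `|Q' xi| * `|q xi|)%:E +
   (eps%:E * \int[mu]_xi (P' xi ^+ 2 + Q' xi ^+ 2)%:E +
    eps^-1%:E * \int[mu]_xi ((P n xi - p xi) ^+ 2 + (Q n xi - q xi) ^+ 2)%:E))%E _; last first.
  apply: leeD => //; apply: leeD => //; apply: lee_wpmul2l => //.
  exact: ft_bessel.
have mn := mP n; have mqn := mQ n.
have m1 : measurable_fun setT (fun xi => (P' xi ^+ 2 + Q' xi ^+ 2)%:E) by meas0.
have m2 : measurable_fun setT (fun xi => ((P n xi - p xi) ^+ 2 + (Q n xi - q xi) ^+ 2)%:E) by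
  meas0.
have m3 : measurable_fun setT (fun xi => (`|P' xi| * `|p xi| + `|Q' xi| * `|q xi|)%:E) by meas0.
have p1 xi : (0 <= (P' xi ^+ 2 + Q' xi ^+ 2)%:E)%E by rewrite lee_fin addr_ge0// sqr_ge0.
have p2 xi : (0 <= ((P n xi - p xi) ^+ 2 + (Q n xi - q xi) ^+ 2)%:E)%E by rewrite lee_fin
  addr_ge0// sqr_ge0.
have p3 xi : (0 <= (`|P' xi| * `|p xi| + `|Q' xi| * `|q xi|)%:E)%E by rewrite lee_fin
  addr_ge0// mulr_ge0.
have inv0 : (0 <= eps^-1%:E)%E by rewrite lee_fin.
have <- := ge0_integralZlT mu m1 p1 e0.
have <- := ge0_integralZlT mu m2 p2 inv0.
have m1e := measurable_funeM eps%:E m1; have m2e := measurable_funeM eps^-1%:E m2.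
have p1e xi := mule_ge0 e0 (p1 xi); have p2e xi := mule_ge0 inv0 (p2 xi).
have <- := ge0_integralDT mu m1e m2e p1e p2e.
have m4 := emeasurable_funD m1e m2e; have p4 xi := adde_ge0 (p1e xi) (p2e xi).
have <- := ge0_integralDT mu m3 m4 p3 p4.
apply: ge0_le_integralT => [||xi|xi].
- by meas0.
- exact: emeasurable_funD.
- by rewrite lee_fin addr_ge0// mulr_ge0.
rewrite -[leRHS]/((`|P' xi| * `|p xi| + `|Q' xi| * `|q xi| + (eps * (P' xi ^+ 2 + Q' xi ^+ 2) +
   eps^-1 * ((P n xi - p xi) ^+ 2 + (Q n xi - q xi) ^+ 2)))%:E) lee_fin.
have hP := amgm_eps (P' xi) (P n xi - p xi) eps0; have hQ := amgm_eps (Q' xi) (Q n xi - q xi)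
  eps0.
have tP : `|P n xi| <= `|p xi| + `|P n xi - p xi| by rewrite -{1}(subrKC (p xi) (P n xi))
  ler_normD.
have tQ : `|Q n xi| <= `|q xi| + `|Q n xi - q xi| by rewrite -{1}(subrKC (q xi) (Q n xi))
  ler_normD.
have := ler_wpM2l (normr_ge0 (P' xi)) tP; have := ler_wpM2l (normr_ge0 (Q' xi)) tQ.
lra.
Qed.

End truncation.

(** * The Gamma function and the Riesz kernel *)

Section gamma.
Context {R : realType}.
Local Notation leb := (@lebesgue_measure R).

Lemma powR_continuous_pos (p x : R) : 0 < x -> {for x, continuous (fun t : R => t `^ p)}.
Proof.
move=> x0; apply: differentiable_continuous; apply/derivable1_diffP.
by have [] := is_derive1_powR p x0.
Qed.

(** Reduces integrals over the positive half-line to compact intervals, where calculus is available.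
    [n.+2] makes these intervals nondegenerate, and they are invariant under inversion. *)
Lemma ge0_integral_itv_le (G : R -> R) (l : \bar R) :
  measurable_fun setT G -> (forall t, 0 <= G t) -> (forall t, t <= 0 -> G t = 0) ->
  (forall n : nat, (\int[leb]_(t in `[n.+2%:R^-1%R, n.+2%:R%R]) (G t)%:E <= l)%E) ->
  (\int[leb]_t (G t)%:E <= l)%E.
Proof.
move=> mG G0 Gneg Gl.
pose D n : set R := `[n.+2%:R^-1, n.+2%:R]%classic.
have mD n : measurable (D n : set (measurableTypeR R)) by exact: measurable_itv.
pose f_ n t := ((\1_(D n) t : R) * G t)%:E.
apply: (@ge0_integral_le_cvg _ _ _ leb f_ _ (fun=> l)).
- by move=> n; apply/measurable_EFinP/measurable_funM => //; exact: measurable_indic.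
- by move=> n x; rewrite lee_fin mulr_ge0.
- move=> t; have [t0|t0] := leP t 0.
    rewrite /f_ Gneg//; under eq_fun do rewrite mulr0.
    exact: cvg_cst.
  apply: cvg_near_cst.
  exists (Num.truncn (Num.max t t^-1)).+1 => // n /= tn.
  have mn : Num.max t t^-1 <= n.+2%:R.
    rewrite (le_trans (ltW (truncnS_gt (Num.max t t^-1))))// ler_nat.
    by rewrite (leq_trans tn)// -addn2 leq_addr.
  rewrite /f_ indicE mem_set ?mul1r// /D /= in_itv/=; apply/andP; split.
    by rewrite invf_ple ?posrE// (le_trans _ mn)// le_max lexx orbT.
  by rewrite (le_trans _ mn)// le_max lexx.
- move=> n; apply: le_trans (Gl n).
  rewrite le_eqVlt; apply/orP; left; apply/eqP.
  rewrite [RHS]integral_mkcond; apply: eq_integral => t _.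
  rewrite /f_ indicE patchE; case: ifP => /= _; first by rewrite mul1r.
  by rewrite mul0r.
- exact: cvg_cst.
Qed.

(** Extended by zero to the whole line, so that Tonelli and changes of scale involve no domain of
    integration. *)
Definition gamma_density (s c t : R) : R :=
  if 0 < t then t `^ (s - 1) * expR (- (c * t)) else 0.

Lemma gamma_density_ge0 s c t : 0 <= gamma_density s c t.
Proof. by rewrite /gamma_density; case: ifP => // _; rewrite mulr_ge0 ?powR_ge0 ?expR_ge0. Qed.

Lemma measurable_gamma_density s c : measurable_fun setT (gamma_density s c).
Proof. by apply: measurable_fun_ifT => //; [exact: measurable_fun_ltr|meas]. Qed.

(** From t / (2 s) <= e^(t / (2 s)), raised to the power [s]. The exponent t / 2 is chosen so that
    the square of the bound is of order e^t. *)
Lemma powR_le_expR (s t : R) : 0 < s -> 0 <= t -> t `^ s <= (2 * s) `^ s * expR (t / 2).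
Proof.
move=> s0 t0.
have s20 : 0 < 2 * s by rewrite mulr_gt0.
have h : t <= 2 * s * expR (t / (2 * s)).
  rewrite mulrC -ler_pdivrMr// (le_trans _ (expR_ge1Dx _))// lerDr//.
apply: le_trans (ge0_ler_powR (ltW s0) _ _ h) _.
- by rewrite nnegrE.
- by rewrite nnegrE mulr_ge0 ?expR_ge0// ltW.
rewrite powRM ?expR_ge0 ?(ltW s20)//.
by rewrite -expRM (_ : t / (2 * s) * s = t / 2)//; field; rewrite gt_eqF.
Qed.

(* [- (1 + t^s)^-1] is bounded, and its derivative dominates [t^(s-1) e^-t] up
   to a constant, both near [0] and near infinity. *)
Lemma integral_gamma_density_lty s : 0 < s ->
  (\int[leb]_t (gamma_density s 1 t)%:E < +oo)%E.
Proof.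
move=> s0.
(* Chosen so that (1 + t^s)^2 <= M e^t: both 1 and t^s / (2 s)^s are at most e^(t/2). *)
pose M := (1 + (2 * s) `^ s) ^+ 2.
pose F (t : R) := - (1 + t `^ s)^-1.
pose f (t : R) := (1 + t `^ s) ^- 2 * (s * t `^ (s - 1)).
have p0 (t : R) : 0 < 1 + t `^ s by rewrite ltr_pwDl// powR_ge0.
have f0 t : 0 <= f t.
  by rewrite mulr_ge0 ?invr_ge0 ?sqr_ge0// mulr_ge0 ?powR_ge0// ltW.
have dF (t : R) : 0 < t -> is_derive t 1 F (f t).
  move=> t0; have dp := is_derive1_powR s t0.
  have d1 : is_derive t (1:R) (fun t : R => 1 + t `^ s) (0 + s * t `^ (s - 1)) by exact:
    is_deriveD.
  have H := is_deriveN (@is_deriveV _ (fun t : R => 1 + t `^ s) _ _ _ (lt0r_neq0 (p0 t)) d1).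
  rewrite (_ : f t = - (- (1 + t `^ s) ^- 2 *: (0 + s * t `^ (s - 1)))); first exact: H.
  by rewrite add0r scaleNr opprK.
have cf (t : R) : 0 < t -> {for t, continuous f}.
  move=> t0; have c1 := powR_continuous_pos (p := s) t0; have c2 := powR_continuous_pos (p := s
    - 1) t0.
  apply: cvgM; last by apply: cvgM => //; exact: cvg_cst.
  apply: cvgV; first by rewrite expf_neq0// gt_eqF.
  by apply: cvgM; apply: cvgD => //; exact: cvg_cst.
have le_f t : gamma_density s 1 t <= M / s * f t.
  rewrite /gamma_density; case: ifP => t0; last first.
    by rewrite mulr_ge0// divr_ge0// ?sqr_ge0// ltW.
  rewrite mul1r /f.
  have -> : M / s * ((1 + t `^ s) ^- 2 * (s * t `^ (s - 1))) = t `^ (s - 1) * (M / (1 + t `^ s)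
    ^+ 2).
    by field; rewrite !gt_eqF.
  rewrite ler_wpM2l ?powR_ge0// ler_pdivlMr ?exprn_gt0//.
  rewrite mulrC expRN ler_pdivrMr ?expR_gt0//.
  have -> : expR t = expR (t / 2) ^+ 2 by rewrite -expRM_natl; congr expR; field.
  rewrite /M -exprMn ler_sqr ?nnegrE; last 2 first.
  - exact: ltW.
  - by rewrite mulr_ge0 ?expR_ge0// addr_ge0// powR_ge0.
  rewrite mulrDl mul1r lerD//; last by rewrite powR_le_expR// ltW.
  by rewrite -expR0 ler_expR divr_ge0// ltW.
apply: (@le_lt_trans _ _ (M / s)%:E); last exact: ltry.
apply: ge0_integral_itv_le.
- exact: measurable_gamma_density.
- exact: gamma_density_ge0.
- by move=> t; rewrite leNgt /gamma_density => /negbTE ->.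
move=> n; have n0 : (0 : R) < n.+2%:R^-1 by rewrite invr_gt0.
have nn : n.+2%:R^-1 < n.+2%:R :> R.
  by rewrite (@lt_le_trans _ _ 1)// ?invf_lt1// ?ltr1n// ler1n.
have Ms : 0 <= M / s by rewrite divr_ge0// ?sqr_ge0// ltW.
have cfM : {within `[n.+2%:R^-1, n.+2%:R], continuous f}.
  apply: continuous_in_subspaceT => t; rewrite inE/= in_itv/= => /andP[t0 _].
  by apply: cf; exact: lt_le_trans t0.
have mf : measurable_fun `[n.+2%:R^-1 : R, n.+2%:R] f by exact:
  subspace_continuous_measurable_fun.
apply: le_trans (_ : _ <= \int[leb]_(t in `[n.+2%:R^-1%R, n.+2%:R%R]) ((M / s)%:E * (f
  t)%:E))%E _.
  apply: ge0_le_integral => //.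
  - by move=> t _; rewrite lee_fin gamma_density_ge0.
  - by apply/measurable_EFinP; apply: measurable_funTS; exact: measurable_gamma_density.
  - by apply: measurable_funeM; exact/measurable_EFinP.
  - by move=> t _; rewrite -EFinM lee_fin.
rewrite ge0_integralZl//; last 2 first.
- exact/measurable_EFinP.
- by move=> t _; rewrite lee_fin.
rewrite -[leRHS]mule1; apply: lee_wpmul2l; first by rewrite lee_fin.
rewrite (@continuous_FTC2 _ _ F)//.
- rewrite -EFinB lee_fin /F opprK.
  have h (t : R) : 0 < (1 + t `^ s)^-1 <= 1.
    by rewrite invr_gt0 p0 invf_le1// lerDl powR_ge0.
  have /andP[? ?] := h n.+2%:R; have /andP[? ?] := h n.+2%:R^-1; lra.
- have cF (t : R) : 0 < t -> {for t, continuous F}.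
    by move=> t0; apply/differentiable_continuous/derivable1_diffP; have [] := dF _ t0.
  split.
  + by move=> t; rewrite in_itv/= => /andP[t0 _]; have [] := dF _ (lt_trans n0 t0).
  + by apply: cvg_at_right_filter; exact: cF.
  + by apply: cvg_at_left_filter; apply: cF.
- move=> t; rewrite in_itv/= => /andP[t0 _]; have t0' := lt_trans n0 t0.
  by rewrite derive1E; have [] := dF _ t0'.
Qed.

Lemma integral_gamma_density1 s : 0 < s ->
  (\int[leb]_t (gamma_density s 1 t)%:E = (Gamma s)%:E)%E.
Proof.
move=> s0; rewrite /Gamma fineK.
  rewrite integral_mkcond; apply: eq_integral => t _; rewrite patchE.
  have -> : (t \in `]0, +oo[%classic) = (0 < t).
    by apply/idP/idP; rewrite inE/= in_itv/= andbT.
  by rewrite /gamma_density mul1r; case: ifP.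
rewrite ge0_fin_numE; last by apply: integral_ge0 => t _; rewrite lee_fin mulr_ge0 ?powR_ge0
  ?expR_ge0.
apply: le_lt_trans (integral_gamma_density_lty s0).
rewrite integral_mkcond; apply: ge0_le_integral => //.
- by move=> t _; rewrite patchE; case: ifP => // _; rewrite lee_fin mulr_ge0 ?powR_ge0 ?expR_ge0.
- apply/(measurable_restrictT _ (measurable_itv _)).
  by apply: measurable_funTS; meas.
- by apply/measurable_EFinP; exact: measurable_gamma_density.
move=> t _; rewrite patchE.
have -> : (t \in `]0, +oo[%classic) = (0 < t).
  by apply/idP/idP; rewrite inE/= in_itv/= andbT.
by rewrite /gamma_density mul1r; case: ifP.
Qed.

Lemma Gamma_gt0 (s : R) : 0 < s -> 0 < Gamma s.
Proof.
move=> s0; rewrite -lte_fin -integral_gamma_density1//.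
(* On [[1, 2]] the density is at least this value, since t^(s-1) >= t^(-1) >= 1/2 there. *)
apply: (@lt_le_trans _ _ (expR (- 2) / 2)%:E); first by rewrite lte_fin divr_gt0 ?expR_gt0.
have -> : (expR (- 2) / 2 : R)%:E = (\int[leb]_(t in `[1%R, 2%R]) (cst (expR (- 2) / 2)%:E t))%E.
  rewrite integral_cst//= lebesgue_measure_itv/= lte_fin ltr1n -EFinB.
  by rewrite (_ : 2 - 1 = 1) ?mule1//; lra.
rewrite integral_mkcond; apply: ge0_le_integral => //.
- by move=> t _; rewrite patchE; case: ifP => // _; rewrite lee_fin divr_ge0 ?expR_ge0.
- by apply/(measurable_restrictT _ (measurable_itv _)); exact: measurable_cst.
- by apply/measurable_EFinP; exact: measurable_gamma_density.
move=> t _; rewrite patchE; case: ifP => [|_]; last by rewrite lee_fin gamma_density_ge0.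
rewrite inE/= in_itv/= => /andP[t1 t2].
have t0 : 0 < t by exact: lt_le_trans t1.
rewrite /gamma_density t0 lee_fin mulrC ler_pM// ?invr_ge0 ?expR_ge0//; last first.
  by rewrite ler_expR mul1r lerN2.
apply: le_trans (_ : t `^ (- 1) <= _); last by rewrite ler_powR// lerBrDr addrC subrr ltW.
by rewrite (powR_inv1 (ltW t0)) lef_pV2// posrE.
Qed.

Lemma integral_gamma_density s c : 0 < s -> 0 < c ->
  (\int[leb]_t (gamma_density s c t)%:E = (c `^ (- s) * Gamma s)%:E)%E.
Proof.
move=> s0 c0; have ci0 : 0 < c^-1 by rewrite invr_gt0.
rewrite (@ge0_integral_affine1 _ _ 0 c^-1)//; last 2 first.
- by apply/measurable_EFinP; exact: measurable_gamma_density.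
- by move=> t; rewrite lee_fin gamma_density_ge0.
rewrite [RHS]EFinM; have <- := integral_gamma_density1 s0.
have -> : c `^ (- s) = c^-1 * c `^ (- (s - 1)).
  rewrite -[X in X * _](powR_inv1 (ltW c0)) -powRD; last by rewrite (gt_eqF c0) implybT.
  by congr (c `^ _); ring.
rewrite EFinM -muleA; congr (_ * _)%E.
rewrite -ge0_integralZlT//; last 3 first.
- by apply/measurable_EFinP; exact: measurable_gamma_density.
- by move=> t; rewrite lee_fin gamma_density_ge0.
- by rewrite lee_fin powR_ge0.
apply: eq_integral => t _; rewrite -EFinM; congr EFin.
rewrite /gamma_density add0r pmulr_rgt0//; case: ifP => t0; last by rewrite mulr0.
rewrite powRM ?(ltW ci0) ?(ltW t0)//.
rewrite -(powR_inv1 (ltW c0)) -powRrM mulN1r mul1r -mulrA; congr (_ * (_ * expR (- _))).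
by rewrite powR_inv1 ?(ltW c0)// mulVKf// gt_eqF.
Qed.

(** The substitution t -> 1 / t, made on intervals that inversion maps onto themselves. It turns the
    factor e^(-c / t) of the heat kernel into the exponential of a Gamma integral. *)
Lemma integral_gamma_inversion_le (b c : R) :
  (\int[leb]_t (if (0 < t)%R then t `^ (- b - 1) * expR (- (c * t `^ (-1))) else 0)%:E <=
   \int[leb]_t (gamma_density b c t)%:E)%E.
Proof.
pose G (t : R) := if 0 < t then t `^ (- b - 1) * expR (- (c * t `^ (-1))) else 0.
have mG : measurable_fun setT G.
  by apply: measurable_fun_ifT => //; [exact: measurable_fun_ltr|meas].
have G0 t : 0 <= G t by rewrite /G; case: ifP => // _; rewrite mulr_ge0 ?powR_ge0 ?expR_ge0.
apply: ge0_integral_itv_le; [exact: mG|exact: G0| |].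
  by move=> t; rewrite leNgt /G => /negbTE ->.
move=> n; have n0 : (0 : R) < n.+2%:R^-1 by rewrite invr_gt0.
have n1 : (0 : R) < n.+2%:R by [].
have nn : n.+2%:R^-1 <= n.+2%:R :> R.
  by rewrite (@le_trans _ _ 1)// ?invf_le1// ?ler1n.
have dV (t : R) : 0 < t -> is_derive t 1 (@GRing.inv R) (- t ^- 2).
  move=> t0; apply: is_derive_eq (is_deriveV (lt0r_neq0 t0) (is_derive_id t 1)) _.
  by rewrite /GRing.scale /= mulr1.
have dVE (t : R) : 0 < t -> (derive1 (@GRing.inv R)) t = - t ^- 2.
  by move=> t0; rewrite derive1E; have [] := dV _ t0.
have cdV (t : R) : 0 < t -> {for t, continuous (derive1 (@GRing.inv R))}.
  move=> t0.
  have E : {near t, (fun t => - t ^- 2) =1 (derive1 (@GRing.inv R))}.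
    near=> u; rewrite dVE//; near: u; exact: lt_nbhsr.
  apply: cvg_trans (_ : (fun t : R => - t ^- 2) @ t --> _).
    by apply: near_eq_cvg.
  rewrite dVE//; apply: cvgN; apply: cvgV; first by rewrite expf_neq0// gt_eqF.
  by apply: cvgM; exact: cvg_id.
have cV (t : R) : 0 < t -> {for t, continuous (@GRing.inv R)}.
  by move=> t0; apply: inv_continuous; rewrite gt_eqF.
have cG (t : R) : 0 < t -> {for t, continuous G}.
  move=> t0.
  have E : {near t, (fun t => t `^ (- b - 1) * expR (- (c * t `^ (-1)))) =1 G}.
    near=> u; rewrite /G ifT//; near: u; exact: lt_nbhsr.
  apply: cvg_trans (_ : (fun t : R => t `^ (- b - 1) * expR (- (c * t `^ (-1)))) @ t --> _).
    by apply: near_eq_cvg.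
  rewrite [X in _ --> X](_ : G t = t `^ (- b - 1) * expR (- (c * t `^ (-1))));
    last by rewrite /G t0.
  apply: cvgM; first exact: powR_continuous_pos.
  apply: continuous_cvg; first exact: continuous_expR.
  apply: cvgN; apply: cvgM; first exact: cvg_cst.
  exact: powR_continuous_pos.
have GE (t : R) : 0 < t -> ((G \o GRing.inv) * - derive1 (@GRing.inv R)) t = gamma_density b c t.
  move=> t0; rewrite !fctE dVE// opprK /G /gamma_density invr_gt0 t0.
  have t1 : t^-1 `^ (-1) = t by rewrite powR_inv1 ?invrK// invr_ge0 ltW.
  rewrite t1 mulrAC; congr (_ * _).
  rewrite -(powR_inv1 (ltW t0)) -powRrM -(powR_mulrn 2 (ltW t0)) -powRN.
  rewrite -powRD; last by rewrite (gt_eqF t0) implybT.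
  by congr (t `^ _); ring.
have := @integration_by_substitution_decreasing R (@GRing.inv R) G _ _ nn.
rewrite invrK => -> //.
- rewrite integral_mkcond; apply: ge0_le_integral => //.
  + move=> t _; rewrite patchE; case: ifP => //; rewrite inE/= in_itv/= => /andP[t1 _].
    have t0 := lt_le_trans n0 t1.
    by rewrite lee_fin; rewrite !fctE dVE// opprK mulr_ge0// invr_ge0 sqr_ge0.
  + apply/(measurable_restrictT _ (measurable_itv _)); apply/measurable_EFinP.
    apply: (@eq_measurable_fun _ _ _ _ _ (gamma_density b c)).
      by move=> t; rewrite inE/= in_itv/= => /andP[t1 _]; rewrite GE// (lt_le_trans n0).
    by apply: measurable_funTS; exact: measurable_gamma_density.
  + by apply/measurable_EFinP; exact: measurable_gamma_density.
  move=> t _; rewrite patchE; case: ifP => [|_]; last by rewrite lee_fin gamma_density_ge0.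
  by rewrite inE/= in_itv/= => /andP[t1 _]; rewrite GE// (lt_le_trans n0).
- move=> x y; rewrite !in_itv/= => /andP[x0 _] /andP[y0 _] xy.
  by rewrite ltf_pV2// posrE (lt_le_trans n0).
- by move=> t; rewrite in_itv/= => /andP[t0 _]; apply: cdV; exact: lt_trans t0.
- by apply/cvg_ex; eexists; apply: cvg_at_right_filter; exact: cdV.
- by apply/cvg_ex; eexists; apply: cvg_at_left_filter; exact: cdV.
- split.
  + by move=> t; rewrite in_itv/= => /andP[t0 _]; have [] := dV _ (lt_trans n0 t0).
  + by apply: cvg_at_right_filter; exact: cV.
  + by apply: cvg_at_left_filter; exact: cV.
- apply: continuous_in_subspaceT => t; rewrite inE/= in_itv/= => /andP[t0 _].
  by apply: cG; exact: lt_le_trans t0.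
Unshelve. all: by end_near.
Qed.

End gamma.

(** * Riesz energy as a superposition of heat energies *)

Section riesz.
Context {R : realType} {d : nat}.
Local Notation mu := (lebesgue_Rn R d).
Local Notation leb := (@lebesgue_measure R).
Local Notation I f := (mu.-integrable setT (fun x => (f x)%:E)).
Variable alpha : R.
Implicit Types (a b : Rn R d -> R) (x y z xi : Rn R d) (t : R).

(* [t^(alpha/2-1) heat t x y] for [t > 0], written without [t^-1] so that it is
   jointly measurable. *)
Definition heat_weight t x y : R :=
  if 0 < t then (4 * pi) `^ (- (d%:R / 2)) *
    (t `^ (- ((d%:R - alpha) / 2) - 1) *
     expR (- (dotp (subp x y) (subp x y) / 4 * t `^ (-1))))
  else 0.

Lemma heat_weight_ge0 t x y : 0 <= heat_weight t x y.
Proof. by rewrite /heat_weight; case: ifP => // _; rewrite !mulr_ge0 ?powR_ge0 ?expR_ge0. Qed.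

Lemma heat_weightE t x y : 0 < t ->
  heat_weight t x y = t `^ (alpha / 2 - 1) * heat t x y.
Proof.
move=> t0; rewrite /heat_weight t0 /heat mulrA [RHS]mulrA.
have t4 : 0 <= 4 * pi * t by rewrite !mulr_ge0 ?pi_ge0// ltW.
congr (_ * expR (- _)); last first.
  by rewrite powR_inv1 ?(ltW t0)// invfM mulrA.
have -> : (Num.sqrt (4 * pi * t) ^+ d)^-1 = (4 * pi * t) `^ (- (d%:R / 2)).
  rewrite powRN (_ : d%:R / 2 = 2^-1 * d%:R :> R); last by rewrite mulrC.
  by rewrite powRrM powR12_sqrt// powR_mulrn// sqrtr_ge0.
rewrite (@powRM _ (4 * pi) t) ?(ltW t0) ?mulr_ge0 ?pi_ge0//.
rewrite mulrCA -powRD ?(gt_eqF t0) ?implybT//.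
by congr (_ * _ `^ _); field.
Qed.

Lemma measurable_heat_weight dX (X : measurableType dX) (e : X -> R) (f g : X -> Rn R d) :
  measurable_fun setT e -> measurable_fun setT f -> measurable_fun setT g ->
  measurable_fun setT (fun s => heat_weight (e s) (f s) (g s)).
Proof.
move=> me mf mg; apply: measurable_fun_ifT => //; first exact: measurable_fun_ltr.
by meas0.
Qed.

(** After inversion this is a Gamma integral of parameter b = (d - alpha) / 2 and scale |x - y|^2 /
    4. The Riesz constant arises here: (4 pi)^(-d/2) 4^b = pi^(-d/2) 2^(-alpha). *)
Lemma integral_heat_weight_le x y : 0 < alpha -> alpha < d%:R -> x <> y ->
  (\int[leb]_t (heat_weight t x y)%:E <=
   (Gamma (alpha / 2) * riesz_constant d alpha * enorm (subp x y) `^ (alpha - d%:R))%:E)%E.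
Proof.
move=> a0 ad xy.
set r := enorm (subp x y).
have r0 : 0 < r.
  rewrite lt_neqAle enorm_ge0 andbT eq_sym enorm_eq0; apply/eqP => h; apply: xy.
  apply: eq_from_tnth => i; have := congr1 (fun z => tnth z i) h.
  by rewrite tnth_subp tnth_origin => /eqP; rewrite subr_eq0 => /eqP.
pose b := (d%:R - alpha) / 2; pose c := r ^+ 2 / 4.
have b0 : 0 < b by rewrite divr_gt0// subr_gt0.
have c0 : 0 < c by rewrite divr_gt0// exprn_gt0.
have p4 : 0 <= 4 * pi :> R by rewrite mulr_ge0// pi_ge0.
pose G t := if 0 < t then t `^ (- b - 1) * expR (- (c * t `^ (-1))) else 0.
have mG : measurable_fun setT (fun t => (G t)%:E).
  by apply/measurable_EFinP; apply: measurable_fun_ifT => //; [exact: measurable_fun_ltr|meas0].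
have G0 t : (0 <= (G t)%:E)%E.
  by rewrite lee_fin /G; case: ifP => // _; rewrite mulr_ge0 ?powR_ge0 ?expR_ge0.
have -> : (\int[leb]_t (heat_weight t x y)%:E =
   ((4 * pi) `^ (- (d%:R / 2)))%:E * \int[leb]_t (G t)%:E)%E.
  rewrite -ge0_integralZlT//; last by rewrite lee_fin powR_ge0.
  apply: eq_integral => t _; rewrite -EFinM /heat_weight /G -enorm_sqr; congr EFin.
  by case: ifP => // _; rewrite mulr0.
have k0 : (0 <= ((4 * pi) `^ (- (d%:R / 2)) : R)%:E)%E by rewrite lee_fin powR_ge0.
have h1 : (\int[leb]_t (G t)%:E <= (c `^ (- b) * Gamma b)%:E)%E.
  by rewrite -integral_gamma_density//; exact: integral_gamma_inversion_le.
apply: le_trans (lee_wpmul2l k0 h1) _.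
rewrite -EFinM lee_fin le_eqVlt; apply/orP; left; apply/eqP.
have cb : c `^ (- b) = r `^ (alpha - d%:R) * 4 `^ b.
  rewrite /c powRM ?invr_ge0 ?sqr_ge0// -powR_inv1// -powRrM -powR_mulrn ?(ltW r0)// -powRrM.
  by congr (_ `^ _ * _ `^ _); rewrite /b; field.
have p1 : 0 < pi `^ (d%:R / 2) :> R by rewrite powR_gt0// pi_gt0.
have p2 : 0 < 2 `^ alpha :> R by rewrite powR_gt0.
have g1 : 0 < Gamma (alpha / 2) :> R by rewrite Gamma_gt0// divr_gt0.
have E : (4 * pi) `^ (- (d%:R / 2)) * 4 `^ b = (pi `^ (d%:R / 2) * 2 `^ alpha)^-1 :> R.
  rewrite powRM ?pi_ge0// mulrAC -powRD ?(gt_eqF (ltr0Sn R 3)) ?implybT// invfM -!powRN mulrC.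
  congr (_ * _); rewrite (_ : 4 = 2 `^ 2%:R :> R).
    by rewrite -powRrM; congr (_ `^ _); rewrite /b; field.
  by rewrite powR_mulrn//; ring.
(* Variables stand for the powers and Gamma values, so that [field] sees a purely algebraic
   identity. *)
have alg (K B P T u1 u2 X : R) : 0 < P -> 0 < T -> 0 < u1 -> K * B = (P * T)^-1 ->
    K * (X * B * u2) = u1 * (u2 / (P * T * u1)) * X.
  move=> P0 T0 u10 KB; rewrite (_ : K * (X * B * u2) = X * u2 * (K * B)); last by ring.
  by rewrite KB; field; rewrite !gt_eqF.
by rewrite cb; exact: alg.
Qed.

Lemma riesz_constant_gt0 : 0 < alpha -> alpha < d%:R -> 0 < riesz_constant d alpha :> R.
Proof.
move=> a0 ad; apply: divr_gt0; first by apply: Gamma_gt0; rewrite divr_gt0// subr_gt0.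
apply: mulr_gt0; last by apply: Gamma_gt0; rewrite divr_gt0.
by apply: mulr_gt0; apply: powR_gt0 => //; exact: pi_gt0.
Qed.

(** The squared modulus of the transform of a + i b. *)
Definition ft_energy a b xi : R := ft a b xi ^+ 2 + ft b (fun x => - a x) xi ^+ 2.

Lemma ft_energy_ge0 a b xi : 0 <= ft_energy a b xi.
Proof. by rewrite addr_ge0// sqr_ge0. Qed.

Lemma measurable_ft_energy a b : measurable_fun setT a -> measurable_fun setT b ->
  measurable_fun setT (ft_energy a b).
Proof.
move=> ma mb.
have m1 := measurable_ft ma mb.
have m2 : measurable_fun setT (ft b (fun x => - a x)) by apply: measurable_ft => //; meas0.
by rewrite /ft_energy; meas0.
Qed.

Lemma heat_weight_energy_le t a b : I a -> I b ->
  (\int[mu]_xi (gamma_density (alpha / 2) (dotp xi xi) t * ft_energy a b xi)%:E <=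
   \int[mu]_x \int[mu]_y (heat_weight t x y * (`|a x| * `|a y| + `|b x| * `|b y|))%:E)%E.
Proof.
move=> ia ib; have [t0|t0] := ltP 0 t; last first.
  rewrite (_ : (fun xi => _) = fun=> 0%E); last first.
    by apply/funext => xi; rewrite /gamma_density ltNge t0 mul0r.
  rewrite integral0; apply: integral_ge0 => x _; apply: integral_ge0 => y _.
  by rewrite lee_fin mulr_ge0 ?heat_weight_ge0// addr_ge0// mulr_ge0.
have ma : measurable_fun setT a by have /integrableP[/measurable_EFinP] := ia.
have mb : measurable_fun setT b by have /integrableP[/measurable_EFinP] := ib.
have mQ := measurable_ft_energy ma mb.
have k0 : (0 <= (t `^ (alpha / 2 - 1))%:E)%E by rewrite lee_fin powR_ge0.
pose A x y := `|a x| * `|a y| + `|b x| * `|b y|.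
have A0 x y : 0 <= A x y by rewrite addr_ge0// mulr_ge0.
have mhA : measurable_fun setT (fun z : Rn R d * Rn R d => (heat t z.1 z.2 * A z.1 z.2)%:E).
  by rewrite /A; meas0.
have hA0 x y : (0 <= (heat t x y * A x y)%:E)%E by rewrite lee_fin mulr_ge0 ?heat_ge0.
have -> : (\int[mu]_x \int[mu]_y (heat_weight t x y * A x y)%:E =
   (t `^ (alpha / 2 - 1))%:E * \int[mu]_x \int[mu]_y (heat t x y * A x y)%:E)%E.
  rewrite -(ge0_integralZlT mu (ge0_measurable_integral2 (fun x y => (heat t x y * A x y)%:E)
    mhA hA0) _ k0); last first.
    by move=> x; exact: integral_ge0.
  apply: eq_integral => x _.
  have mx : measurable_fun setT (fun y => (heat t x y * A x y)%:E) by rewrite /A; meas0.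
  rewrite -(ge0_integralZlT mu mx (hA0 x) k0).
  by apply: eq_integral => y _; rewrite heat_weightE// -mulrA.
apply: le_trans (lee_wpmul2l k0 (le_ft_energy t0 ia ib)).
have m2 : measurable_fun setT (fun xi => (expR (- t * dotp xi xi) * ft_energy a b xi)%:E) by
  meas0.
rewrite -(ge0_integralZlT mu m2 _ k0); last first.
  by move=> xi; rewrite lee_fin mulr_ge0 ?expR_ge0 ?ft_energy_ge0.
rewrite le_eqVlt; apply/orP; left; apply/eqP; apply: eq_integral => xi _.
rewrite -EFinM; congr EFin.
by rewrite /gamma_density t0 mulrA [dotp xi xi * t]mulrC mulNr.
Qed.

Lemma riesz_energy_le a b : 0 < alpha -> alpha < d%:R -> I a -> I b ->
  (\int[mu]_xi (enorm xi `^ (- alpha) * ft_energy a b xi)%:E <=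
   (riesz_constant d alpha)%:E * \int[mu]_x \int[mu]_y
     (enorm (subp x y) `^ (alpha - d%:R) * (`|a x| * `|a y| + `|b x| * `|b y|))%:E)%E.
Proof.
move=> alpha0 alphad ia ib.
have ma : measurable_fun setT a by have /integrableP[/measurable_EFinP] := ia.
have mb : measurable_fun setT b by have /integrableP[/measurable_EFinP] := ib.
have mQ := measurable_ft_energy ma mb.
have Q0 := ft_energy_ge0 a b.
have s0 : 0 < alpha / 2 by rewrite divr_gt0.
have d0 : (0 < d)%N by rewrite -(@ltr_nat R) (lt_trans alpha0).
have G0 := Gamma_gt0 s0; have G0' : (0 <= (Gamma (alpha / 2) : R)%:E)%E by rewrite lee_fin ltW.
pose A x y := `|a x| * `|a y| + `|b x| * `|b y|.
have A0 x y : 0 <= A x y by rewrite addr_ge0// mulr_ge0.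
have ne : measurable_fun setT (fun xi : Rn R d => enorm xi) by apply: measurable_enorm_comp.
have mL : measurable_fun setT (fun xi => (enorm xi `^ (- alpha) * ft_energy a b xi)%:E).
  by apply/measurable_EFinP/measurable_funM => //; exact: (measurableT_comp (measurable_powR _)
    ne).
(* The factor makes the multiplier an integral: Gamma(alpha/2) |xi|^(-alpha) is that of
   t^(alpha/2-1) e^(-t |xi|^2). It cancels against the same factor in [integral_heat_weight_le]. *)
rewrite -(@lee_pmul2l _ (Gamma (alpha / 2))%:E)//.
rewrite -(ge0_integralZlT mu mL _ G0'); last first.
  by move=> xi; rewrite lee_fin mulr_ge0 ?powR_ge0.
pose gd (xi : Rn R d) (t : measurableTypeR R) := (gamma_density (alpha / 2) (dotp xi xi) t *
  ft_energy a b xi)%:E.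
have mgd : measurable_fun setT (fun z : Rn R d * measurableTypeR R => gd z.1 z.2).
  apply/measurable_EFinP/measurable_funM; last by meas0.
  by apply: measurable_fun_ifT => //; [exact: measurable_fun_ltr|meas0].
have gd0 xi t : (0 <= gd xi t)%E by rewrite lee_fin mulr_ge0 ?gamma_density_ge0.
apply: le_trans (_ : _ <= \int[mu]_xi \int[leb]_t gd xi t)%E _.
  apply: ge0_le_integralT => [||xi|xi].
  - exact: measurable_funeM.
  - exact: (ge0_measurable_integral2 (m2 := leb) gd mgd gd0).
  - by rewrite mule_ge0// lee_fin mulr_ge0 ?powR_ge0.
  (* At frequency 0 the negative power is 0 by the convention of [powR], so the left-hand side
     vanishes. *)
  have [x0|x0] := eqVneq (enorm xi) 0.
    rewrite x0 powR0 ?oppr_eq0 ?gt_eqF// mul0r mule0; exact: integral_ge0.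
  have c0 : 0 < dotp xi xi by rewrite -enorm_sqr exprn_gt0// lt_neqAle eq_sym x0 enorm_ge0.
  rewrite (_ : (fun t => gd xi t) = fun t => ((ft_energy a b xi)%:E * (gamma_density (alpha /
    2) (dotp xi xi) t)%:E)%E); last first.
    by apply/funext => t; rewrite /gd mulrC.
  rewrite ge0_integralZlT ?lee_fin//; last 2 first.
  - by apply/measurable_EFinP; exact: measurable_gamma_density.
  - by move=> t; rewrite lee_fin gamma_density_ge0.
  rewrite integral_gamma_density// -!EFinM lee_fin.
  rewrite -enorm_sqr -powR_mulrn ?enorm_ge0// -powRrM.
  rewrite (_ : 2%:R * - (alpha / 2) = - alpha); last by field.
  by rewrite le_eqVlt; apply/orP; left; apply/eqP; ring.
rewrite (@ge0_integral_swap _ _ _ _ _ mu leb gd mgd gd0).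
pose W (t : R) x y := (heat_weight t x y * A x y)%:E.
have W0 t x y : (0 <= W t x y)%E by rewrite lee_fin mulr_ge0 ?heat_weight_ge0.
have mW : measurable_fun setT (fun z : (measurableTypeR R * Rn R d) * Rn R d => W z.1.1 z.1.2
  z.2).
  apply/measurable_EFinP/measurable_funM; last by rewrite /A; meas0.
  by apply: measurable_heat_weight; meas0.
have mW2 : measurable_fun setT (fun z : measurableTypeR R * Rn R d => \int[mu]_y W z.1 z.2 y)%E.
  exact: (ge0_measurable_integral2 (fun (z : measurableTypeR R * Rn R d) y => W z.1 z.2 y)).
apply: le_trans (_ : _ <= \int[leb]_t \int[mu]_x \int[mu]_y W t x y)%E _.
  apply: ge0_le_integralT => [||t|t].
  - exact: (ge0_measurable_integral1 (m1 := mu) gd mgd gd0).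
  - by apply: (ge0_measurable_integral2 (fun (t : measurableTypeR R) x => \int[mu]_y W t x
    y)%E) => // t x; exact: integral_ge0.
  - exact: integral_ge0.
  exact: heat_weight_energy_le.
rewrite (@ge0_integral_swap _ _ _ _ _ leb mu (fun t x => \int[mu]_y W t x y)%E mW2); last first.
  by move=> t x; exact: integral_ge0.
pose K x y := (enorm (subp x y) `^ (alpha - d%:R) * A x y)%:E.
have K0 x y : (0 <= K x y)%E by rewrite lee_fin mulr_ge0 ?powR_ge0.
have mK : measurable_fun setT (fun z : Rn R d * Rn R d => K z.1 z.2) by rewrite /K /A; meas0.
have C0 := ltW (riesz_constant_gt0 alpha0 alphad).
have CG0 : (0 <= (Gamma (alpha / 2) * riesz_constant d alpha : R)%:E)%E by rewrite lee_fin
  mulr_ge0// ltW.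
rewrite muleA -EFinM.
have mKx := ge0_measurable_integral2 (m2 := mu) K mK K0.
rewrite -(ge0_integralZlT mu mKx _ CG0); last by move=> x; exact: integral_ge0.
have mWtx x : measurable_fun setT (fun z : measurableTypeR R * Rn R d => W z.1 x z.2).
  apply/measurable_EFinP/measurable_funM; last by rewrite /A; meas0.
  by apply: measurable_heat_weight; meas0.
apply: ge0_le_integralT => [||x|x].
- apply: (ge0_measurable_integral1 (fun (t : measurableTypeR R) x => \int[mu]_y W t x y)%E) =>
  // t x; exact: integral_ge0.
- exact: measurable_funeM.
- by apply: integral_ge0 => t _; exact: integral_ge0.
rewrite (@ge0_integral_swap _ _ _ _ _ leb mu (fun t y => W t x y) (mWtx x))//.
have mKy : measurable_fun setT (K x) by rewrite /K /A; meas0.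
rewrite -(ge0_integralZlT mu mKy (K0 x) CG0).
(* The comparison is only almost everywhere: at [y = x] the kernel is 0 by the convention of [powR],
   whereas the integral of the heat weight is not bounded by it. *)
apply: ae_ge0_le_integral => //.
- by move=> y _; exact: integral_ge0.
- exact: (ge0_measurable_integral1 (fun (t : measurableTypeR R) y => W t x y)).
- by move=> y _; rewrite mule_ge0.
- exact: measurable_funeM.
exists [set x]; split; [exact: measurable_point|exact: lebesgue_Rn_set1|].
move=> y /= h; apply: contrapT => yx; apply: h => _.
have mwt : measurable_fun setT (fun t : measurableTypeR R => (heat_weight t x y)%:E).
  by apply/measurable_EFinP; apply: measurable_heat_weight; meas0.
rewrite (_ : (fun t => W t x y) = fun t => ((A x y)%:E * (heat_weight t x y)%:E)%E); last first.
  by apply/funext => t; rewrite /W mulrC.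
rewrite ge0_integralZlT ?lee_fin//; last by move=> t; rewrite lee_fin heat_weight_ge0.
apply: le_trans (lee_wpmul2l _ (integral_heat_weight_le alpha0 alphad (fun e => yx (esym e)))) _.
  by rewrite lee_fin.
by rewrite -!EFinM lee_fin le_eqVlt; apply/orP; left; apply/eqP; ring.
Qed.

End riesz.

(** * The Schur test *)

Section schur.
Context {R : realType} {d : nat}.
Local Notation mu := (lebesgue_Rn R d).
Variable alpha : R.
Hypotheses (d0 : (0 < d)%N) (alpha0 : 0 < alpha) (alphad : alpha < d%:R).
Implicit Types (x y : Rn R d) (W : Rn R d -> R).

Definition riesz_kernel x y : R := enorm (subp x y) `^ (alpha - d%:R).

Lemma riesz_kernel_ge0 x y : 0 <= riesz_kernel x y. Proof. exact: powR_ge0. Qed.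

Lemma riesz_kernelC x y : riesz_kernel x y = riesz_kernel y x.
Proof. by rewrite /riesz_kernel /enorm dotp_subpC. Qed.

Let rho : R := 2^-1.
Let q : R := rho `^ alpha.
(** The sum of a geometric series: the annulus of index k contributes at most omega / d times 2^(d -
    alpha) q^k. *)
Let A : R := sphere_area R d / d%:R * (rho `^ (alpha - d%:R) / (1 - q)).

Lemma sphere_area_ge0 : 0 <= sphere_area R d.
Proof. by rewrite fine_ge0// /surface_measure mule_ge0. Qed.

Let rho0 : 0 < rho. Proof. by rewrite invr_gt0. Qed.

Let q0 : 0 < q. Proof. exact: powR_gt0. Qed.

Lemma two_powR_gt1 : 1 < 2 `^ alpha :> R.
Proof.
have l2 : 0 < ln 2 :> R by apply: ln_gt0; rewrite ltr1n.
rewrite (_ : 2 `^ alpha = expR (alpha * ln 2)); last by rewrite /powR pnatr_eq0.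
by rewrite -[ltLHS]expR0 ltr_expR; exact: mulr_gt0.
Qed.

Let q1 : q < 1.
Proof.
rewrite /q /rho -powR_inv1// -powRrM mulN1r powRN invf_lt1 ?powR_gt0//.
exact: two_powR_gt1.
Qed.

Lemma powR_le_neg (p s t : R) : p <= 0 -> 0 < s -> s <= t -> t `^ p <= s `^ p.
Proof.
move=> p0 s0 st; rewrite -[p]opprK powRN [leRHS]powRN lef_pV2 ?posrE ?powR_gt0 ?(lt_le_trans
  s0)//.
by rewrite ge0_ler_powR ?oppr_ge0 ?nnegrE// ltW// (lt_le_trans s0).
Qed.

(* Dyadic annuli: on [2^-(k+1) < |x - y| <= 2^-k] the kernel is at most
   [2^((k+1)(d-alpha))], and the ball of radius [2^-k] has volume
   [2^(-kd) omega / d]. *)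
Lemma integral_riesz_kernel_annuli x n :
  (\int[mu]_y (if rho ^+ n < enorm (subp x y) <= 1 then riesz_kernel x y else 0)%:E <=
   (A * (1 - q ^+ n))%:E)%E.
Proof.
have md : measurable_fun setT (fun y => enorm (subp x y)) by meas0.
have mk : measurable_fun setT (riesz_kernel x) by rewrite /riesz_kernel; meas0.
pose f n y := if rho ^+ n < enorm (subp x y) <= 1 then riesz_kernel x y else 0.
have mf k : measurable_fun setT (fun y => (f k y)%:E).
  apply/measurable_EFinP; apply: measurable_fun_ifT => //.
  by apply: measurable_and; [exact: measurable_fun_ltr|exact: measurable_fun_ler].
have f0 k y : 0 <= f k y by rewrite /f; case: ifP => // _; exact: riesz_kernel_ge0.
suff H : (\int[mu]_y (f n y)%:E <= (A * (1 - q ^+ n))%:E)%E by exact: H.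
elim: n => [|n IH].
  rewrite expr0 subrr mulr0 (_ : (fun y => _) = fun=> 0%E) ?integral0//.
  by apply/funext => y; rewrite /f expr0; case: (ltP 1 (enorm (subp x y))).
have rn0 : 0 < rho ^+ n by rewrite exprn_gt0.
have rn1 : 0 < rho ^+ n.+1 by rewrite exprn_gt0.
pose B := [set y | enorm (subp x y) <= rho ^+ n].
have mB : measurable B by exact: measurable_subp_le.
pose c := (rho ^+ n.+1) `^ (alpha - d%:R).
have c0 : (0 <= c%:E)%E by rewrite lee_fin powR_ge0.
have m1 : measurable_fun setT (fun y => (\1_B y : R)%:E).
  by apply/measurable_EFinP; exact: measurable_indic.
have m2 := measurable_funeM c%:E m1.
have i0 y : (0 <= (\1_B y : R)%:E)%E by rewrite lee_fin.
have i1 y : (0 <= c%:E * (\1_B y : R)%:E)%E by rewrite mule_ge0.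
have f0' y : (0 <= (f n y)%:E)%E by rewrite lee_fin.
apply: (@le_trans _ _ (\int[mu]_y ((f n y)%:E + c%:E * (\1_B y)%:E))%E).
  apply: ge0_le_integralT => [||y|y].
  - exact: mf.
  - exact: emeasurable_funD.
  - by rewrite lee_fin.
  rewrite -EFinM -EFinD lee_fin /f.
  case: (leP (enorm (subp x y)) (rho ^+ n)) => h; last first.
    rewrite (_ : rho ^+ n.+1 < _); last first.
      apply: le_lt_trans h; rewrite exprS; apply: ler_piMl; first exact: ltW.
      by rewrite invf_le1 ?ler1n.
    by rewrite lerDl mulr_ge0// powR_ge0.
  rewrite /= add0r indicE mem_set// mulr1.
  case: ifP => [/andP[h1 _]|_]; last exact: powR_ge0.
  by apply: powR_le_neg (ltW h1) => //; rewrite subr_le0 ltW.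
rewrite (ge0_integralDT mu (mf n) m2 f0' i1).
rewrite (ge0_integralZlT mu m1 i0 c0).
have -> : (\int[mu]_y (\1_B y)%:E = (rho ^+ n ^+ d * (sphere_area R d / d%:R))%:E)%E.
  by rewrite integral_indic// setIT; exact: ball_volume.
apply: le_trans (leeD IH (lexx _)) _.
rewrite -EFinM -EFinD lee_fin le_eqVlt; apply/orP; left; apply/eqP.
have -> : c = rho `^ (alpha - d%:R) * (q ^+ n / rho ^+ n ^+ d).
  rewrite /c exprS powRM ?ltW//; congr (_ * _).
  have -> : q ^+ n = (rho ^+ n) `^ alpha.
    by rewrite -powR_mulrn ?powR_ge0// -powRrM mulrC powRrM powR_mulrn// ltW.
  by rewrite powRB ?(gt_eqF rn0) ?implybT// powR_mulrn// ltW.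
rewrite /A exprS; field.
by rewrite !gt_eqF ?subr_gt0// ?ltr0n// exprn_gt0.
Qed.

Let AE : A = 2 ^+ d * sphere_area R d / (d%:R * (2 `^ alpha - 1)).
Proof.
have hq : rho `^ alpha = (2 `^ alpha)^-1 by rewrite /rho -powR_inv1// -powRrM mulN1r powRN.
have hd : rho `^ (alpha - d%:R) = 2 ^+ d / 2 `^ alpha.
  by rewrite powRB ?(gt_eqF rho0) ?implybT// hq powR_mulrn ?ltW// exprVn invrK mulrC.
have u1 := two_powR_gt1.
have u0 : 0 < 2 `^ alpha :> R by exact: powR_gt0.
have u2 : 0 < 2 `^ alpha - 1 :> R by rewrite subr_gt0.
rewrite /A hd /q hq.
move: (2 `^ alpha) u1 u0 u2 => u u1 u0 u2.
field; rewrite !gt_eqF//= ?ltr0n// invf_lt1//.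
Qed.

Lemma integral_riesz_kernel_le W (v w : R) x :
  measurable_fun setT W -> (forall y, 0 <= W y <= v) ->
  (\int[mu]_y (W y)%:E <= w%:E)%E ->
  (\int[mu]_y (riesz_kernel x y * W y)%:E <=
   (2 ^+ d * sphere_area R d / (d%:R * (2 `^ alpha - 1)) * v + w)%:E)%E.
Proof.
rewrite -AE.
move=> mW Wv Ww.
have md : measurable_fun setT (fun y => enorm (subp x y)) by meas0.
have mk : measurable_fun setT (riesz_kernel x) by rewrite /riesz_kernel; meas0.
pose f n y := (if rho ^+ n < enorm (subp x y) <= 1 then riesz_kernel x y else 0)%:E.
pose g y := if enorm (subp x y) <= 1 then riesz_kernel x y else 0.
have mf k : measurable_fun setT (f k).
  apply/measurable_EFinP; apply: measurable_fun_ifT => //.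
  by apply: measurable_and; [exact: measurable_fun_ltr|exact: measurable_fun_ler].
have mg : measurable_fun setT (fun y => (g y)%:E).
  apply/measurable_EFinP; apply: measurable_fun_ifT => //.
  exact: measurable_fun_ler.
have W0 y : 0 <= W y by case/andP : (Wv y).
have v0 : (0 <= v%:E)%E by rewrite lee_fin; case/andP : (Wv x) => /le_trans h /h.
have g0 y : (0 <= (g y)%:E)%E by rewrite lee_fin /g; case: ifP => // _; exact: riesz_kernel_ge0.
have A0 : 0 <= A.
  rewrite mulr_ge0// divr_ge0// ?sphere_area_ge0 ?powR_ge0//.
  by rewrite subr_ge0 ltW.
have gA : (\int[mu]_y (g y)%:E <= A%:E)%E.
  apply: (@ge0_integral_le_cvg _ _ _ mu f _ (fun=> A%:E)) => //.
  - by move=> n y; rewrite lee_fin; case: ifP => // _; exact: riesz_kernel_ge0.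
  (* At [y = x] all the cut-off kernels are 0, and so is [g], because [powR] sends 0 to 0 for the
     nonzero exponent alpha - d. Elsewhere 2^(-n) drops below |x - y| and the sequence is eventually
     constant. *)
  - move=> y; have [y0|y0] := leP (enorm (subp x y)) 0.
      have gy : g y = 0.
        have e0 : enorm (subp x y) = 0 by apply/eqP; rewrite eq_le y0 enorm_ge0.
        by rewrite /g /riesz_kernel e0 powR0 ?if_same// subr_eq0 lt_eqF.
      rewrite gy (_ : (fun n => _) = fun=> 0%E); first exact: cvg_cst.
      apply/funext => n; rewrite /f ltNge (le_trans y0)//.
      by rewrite exprn_ge0// ltW.
    have := @cvg_geometric R 1 rho; rewrite ger0_norm ?ltW// invf_lt1// ltr1n => /(_ isT).
    move=> hr; have := cvgr_lt _ hr _ y0 => -[N _ hN].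
    apply: cvg_near_cst; exists N => // n /= Nn; rewrite /f /g.
    by have := hN _ Nn; rewrite /= mul1r => ->.
  - move=> n; apply: le_trans (integral_riesz_kernel_annuli x n) _.
    by rewrite lee_fin ler_piMr// lerBlDr lerDl exprn_ge0// ltW.
  - exact: cvg_cst.
have mW' : measurable_fun setT (fun y => (W y)%:E) by exact/measurable_EFinP.
have W0' y : (0 <= (W y)%:E)%E by rewrite lee_fin.
have mvg := measurable_funeM v%:E mg.
have vg0 y : (0 <= v%:E * (g y)%:E)%E by rewrite mule_ge0.
apply: (@le_trans _ _ (\int[mu]_y (v%:E * (g y)%:E + (W y)%:E))%E).
  apply: ge0_le_integralT => [||y|y].
  - by meas0.
  - exact: emeasurable_funD.
  - by rewrite lee_fin mulr_ge0// riesz_kernel_ge0.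
  rewrite -EFinM -EFinD lee_fin /g; have /andP[_ Wvy] := Wv y.
  case: ifP => h; first by rewrite ler_wpDr// mulrC ler_wpM2r// riesz_kernel_ge0.
  rewrite mulr0 add0r ler_piMl//.
  have <- : 1 `^ (alpha - d%:R) = 1 :> R by rewrite powR1.
  apply: powR_le_neg => //; first by rewrite subr_le0 ltW.
  by rewrite ltW// ltNge h.
rewrite (ge0_integralDT mu mvg mW' vg0 W0') (ge0_integralZlT mu mg g0 v0).
rewrite EFinD mulrC EFinM; apply: leeD => //.
exact: lee_wpmul2l.
Qed.

(** AM-GM under the weight W x W y gives two terms, which the symmetry of the kernel makes equal; in
    each, one variable integrates out to at most [M]. Only the moduli of [a1], [b1] are prescribed,
    so that V f and |V| f are both covered. *)
Lemma schur_le W (M : R) (a b a1 b1 : Rn R d -> R) :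
  measurable_fun setT W -> measurable_fun setT a -> measurable_fun setT b ->
  measurable_fun setT a1 -> measurable_fun setT b1 ->
  (forall x, 0 <= W x) ->
  (forall x, \int[mu]_y (riesz_kernel x y * W y)%:E <= M%:E)%E ->
  (forall x, `|a1 x| = W x * `|a x|) -> (forall x, `|b1 x| = W x * `|b x|) ->
  (\int[mu]_x \int[mu]_y (riesz_kernel x y * (`|a1 x| * `|a1 y| + `|b1 x| * `|b1 y|))%:E <=
   M%:E * \int[mu]_x (W x * (a x ^+ 2 + b x ^+ 2))%:E)%E.
Proof.
move=> mW ma mb ma1 mb1 W0 WM a1E b1E.
have mk : measurable_fun setT (fun z : Rn R d * Rn R d => riesz_kernel z.1 z.2).
  by rewrite /riesz_kernel; meas0.
have k0 := riesz_kernel_ge0.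
have mkx x : measurable_fun setT (riesz_kernel x) by rewrite /riesz_kernel; meas0.
pose r x := 2^-1 * (W x * (a x ^+ 2 + b x ^+ 2)).
have r0 x : 0 <= r x by rewrite !mulr_ge0// addr_ge0// sqr_ge0.
have mr : measurable_fun setT r by rewrite /r; meas0.
pose F x y := (riesz_kernel x y * W y * r x)%:E.
have F0 x y : (0 <= F x y)%E by rewrite lee_fin mulr_ge0// mulr_ge0.
have mF : measurable_fun setT (fun z : Rn R d * Rn R d => F z.1 z.2) by rewrite /F; meas0.
have mF' : measurable_fun setT (fun z : Rn R d * Rn R d => F z.2 z.1).
  apply: (measurableT_comp (f := fun z : Rn R d * Rn R d => F z.1 z.2)
    (g := fun z : Rn R d * Rn R d => (z.2, z.1))) => //; exact: measurable_fun_pair.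
have FM : (\int[mu]_x \int[mu]_y F x y <= M%:E * \int[mu]_x (r x)%:E)%E.
  have M0 : (0 <= M%:E)%E.
    apply: le_trans (WM (origin d)); apply: integral_ge0 => y _.
    by rewrite lee_fin mulr_ge0.
  have r0' x : (0 <= (r x)%:E)%E by rewrite lee_fin.
  have mr' : measurable_fun setT (fun x => (r x)%:E) by exact/measurable_EFinP.
  rewrite -(ge0_integralZlT mu mr' r0' M0).
  apply: ge0_le_integralT => [||x|x].
  - exact: (ge0_measurable_integral2 (m2 := mu) F mF F0).
  - exact: measurable_funeM.
  - exact: integral_ge0.
  rewrite (_ : (fun y => F x y) = fun y => ((r x)%:E * (riesz_kernel x y * W y)%:E)%E);
    last first.
    by apply/funext => y; rewrite /F mulrC.
  have mkW : measurable_fun setT (fun y => (riesz_kernel x y * W y)%:E) by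
    apply/measurable_EFinP/measurable_funM.
  rewrite (ge0_integralZlT mu mkW _ (r0' x)); last by move=> y; rewrite lee_fin mulr_ge0.
  by rewrite muleC; apply: lee_wpmul2r => //; rewrite lee_fin.
have FE : (\int[mu]_x \int[mu]_y F y x = \int[mu]_x \int[mu]_y F x y)%E.
  exact: (@ge0_integral_swap _ _ _ _ _ mu mu (fun x y => F y x) mF' (fun x y => F0 y x)).
have mG : measurable_fun setT (fun z : Rn R d * Rn R d =>
   (riesz_kernel z.1 z.2 * (`|a1 z.1| * `|a1 z.2| + `|b1 z.1| * `|b1 z.2|))%:E) by meas0.
have G0 x y : (0 <= (riesz_kernel x y * (`|a1 x| * `|a1 y| + `|b1 x| * `|b1 y|))%:E)%E.
  by rewrite lee_fin mulr_ge0// addr_ge0// mulr_ge0.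
have mFx x : measurable_fun setT (F x) by exact: (measurableT_comp mF (measurable_pair1 x)).
have mFx' x : measurable_fun setT (F ^~ x) by exact: (measurableT_comp mF' (measurable_pair1 x)).
have mF1 := ge0_measurable_integral2 (m2 := mu) F mF F0.
have mF2 := ge0_measurable_integral2 (m2 := mu) (fun x y => F y x) mF' (fun x y => F0 y x).
apply: (@le_trans _ _ (\int[mu]_x (\int[mu]_y F x y + \int[mu]_y F y x))%E).
  apply: ge0_le_integralT => [||x|x].
  - exact: (ge0_measurable_integral2 (m2 := mu) _ mG G0).
  - exact: emeasurable_funD.
  - exact: integral_ge0.
  rewrite -(ge0_integralDT mu (mFx x) (mFx' x) (F0 x) (F0 ^~ x)).
  apply: ge0_le_integralT => [||y|y].
  - exact: (measurableT_comp mG (measurable_pair1 x)).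
  - exact: emeasurable_funD.
  - exact: G0.
  rewrite -EFinD lee_fin (riesz_kernelC y x) -!mulrA -mulrDr ler_wpM2l// /r !a1E !b1E.
  have W00 := mulr_ge0 (W0 x) (W0 y).
  have := ler_wpM2l W00 (amgm_norm (a x) (a y)); have := ler_wpM2l W00 (amgm_norm (b x) (b y)).
  lra.
rewrite (ge0_integralDT mu mF1 mF2); last 2 first.
- by move=> x; exact: integral_ge0.
- by move=> x; exact: integral_ge0.
rewrite FE; apply: le_trans (leeD FM FM) _.
have r0' x : (0 <= (r x)%:E)%E by rewrite lee_fin.
have mr' : measurable_fun setT (fun x => (r x)%:E) by exact/measurable_EFinP.
have r00 : (0 <= \int[mu]_x (r x)%:E)%E by exact: integral_ge0.
have YY := ge0_integralDT mu mr' mr' r0' r0'.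
move: r00 YY; set Y := (\int[mu]_x (r x)%:E)%E => Y0 YY.
rewrite -ge0_muleDr// -YY.
rewrite le_eqVlt; apply/orP; left; apply/eqP; congr (_ * _)%E.
apply: eq_integral => x _; rewrite -[LHS]/((r x + r x)%:E); congr EFin.
by rewrite /r; field.
Qed.

End schur.

(** * Eigenfunctions *)

Lemma ge0_integral_eq0 d (T : measurableType d) (R : realType)
    (mu : {measure set T -> \bar R}) (f : T -> R) :
  measurable_fun setT f -> (forall x, 0 <= f x) ->
  (\int[mu]_x (f x)%:E <= 0)%E -> {ae mu, forall x, f x = 0}.
Proof.
move=> mf f0 If.
have mf' : measurable_fun setT (fun x => (f x)%:E) by exact/measurable_EFinP.
have [+ _] := ae_eq_integral_abs mu measurableT mf'.
move=> /(_ _) H.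
have : ae_eq mu setT (fun x => (f x)%:E) (cst 0%E).
  apply: H; apply/eqP; rewrite eq_le integral_ge0//= andbT.
  by under eq_integral do rewrite ger0_norm//.
by apply: filterS => x /= /(_ I) [].
Qed.

(** * The smallness argument, for an eigenfunction a + i b with transform p + i q *)

Section weak_coupling.
Context {R : realType} {d : nat}.
Local Notation mu := (lebesgue_Rn R d).
Local Notation I f := (mu.-integrable setT (fun x => (f x)%:E)).
Variables (alpha lambda v w : R).
Hypotheses (d0 : (0 < d)%N) (alpha0 : 0 < alpha) (alphad : alpha < d%:R).
Hypothesis lambda0 : lambda <= 0.
Variables (V a b p q : Rn R d -> R).
Hypotheses (mV : measurable_fun setT V) (ma : measurable_fun setT a)
  (mb : measurable_fun setT b) (mp : measurable_fun setT p) (mq : measurable_fun setT q).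
Hypotheses (Vv : forall x, `|V x| <= v) (Vw : (\int[mu]_x (`|V x|)%:E <= w%:E)%E).
Hypotheses (ia2 : I (fun x => a x ^+ 2)) (ib2 : I (fun x => b x ^+ 2)).

Lemma enorm_neq0_ae : {ae mu, forall xi : Rn R d, 0 < enorm xi}.
Proof.
exists [set origin d]; split; [exact: measurable_point|exact: lebesgue_Rn_set1|].
move=> x /= /negP; rewrite -leNgt => x0.
by apply/eqP; rewrite -enorm_eq0 eq_le x0 enorm_ge0.
Qed.

Lemma integrable_potential : I V.
Proof.
apply/integrableP; split; first exact/measurable_EFinP.
by apply: le_lt_trans Vw _; exact: ltry.
Qed.

(** Stated for [U] with the same modulus as [V], to serve both [V] and its absolute value. From |c|
    <= 1 + c^2 one gets |U c| <= |V| + v c^2. *)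
Lemma integrable_mul_potential (U c : Rn R d -> R) : measurable_fun setT U ->
  measurable_fun setT c -> (forall x, `|U x| = `|V x|) -> I (fun x => c x ^+ 2) ->
  I (fun x => U x * c x) /\ I (fun x => (U x * c x) ^+ 2).
Proof.
move=> mU mc UV ic2; have v0 : 0 <= v by exact: le_trans (Vv (origin d)).
split.
  have iv : I (fun x => v * c x ^+ 2) by exact: (integrableZl measurableT v ic2).
  apply: (le_integrable measurableT _ _ (integrable_addr (integrable_normr
    integrable_potential) iv)).
    by meas0.
  move=> x _; rewrite /= lee_fin normrM UV [leRHS]ger0_norm; last first.
    by rewrite addr_ge0// mulr_ge0// sqr_ge0.
  have := amgm_norm 1 (c x); rewrite normr1 expr1n mul1r => h.
  have h1 : `|c x| <= 1 + c x ^+ 2 by have := sqr_ge0 (c x); lra.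
  have := ler_wpM2l (normr_ge0 (V x)) h1.
  have := ler_wpM2r (sqr_ge0 (c x)) (Vv x).
  lra.
have iv : I (fun x => v ^+ 2 * c x ^+ 2) by exact: (integrableZl measurableT (v ^+ 2) ic2).
apply: (le_integrable measurableT _ _ iv); first by meas0.
move=> x _; rewrite -[leLHS]/((`|(U x * c x) ^+ 2|)%:E) -[leRHS]/((`|v ^+ 2 * c x ^+ 2|)%:E)
  lee_fin.
rewrite (ger0_norm (sqr_ge0 _)) ger0_norm; last by rewrite mulr_ge0 ?sqr_ge0.
rewrite exprMn; apply: ler_wpM2r; first exact: sqr_ge0.
by rewrite -(real_normK (num_real (U x))) UV ler_sqr ?nnegrE// Vv.
Qed.

Hypothesis ap : (\int[mu]_xi ((ft (trunc n a) (trunc n b) xi - p xi) ^+ 2 +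
   (ft (trunc n b) (fun x => - trunc n a x) xi - q xi) ^+ 2)%:E @[n --> \oo] --> 0)%E.
Let g1 x := V x * a x.
Let g2 x := V x * b x.
Let m (xi : Rn R d) := enorm xi `^ alpha.
Hypothesis gp : {ae mu, forall xi, ft g1 g2 xi = (lambda - m xi) * p xi}.
Hypothesis gq : {ae mu, forall xi, ft g2 (fun x => - g1 x) xi = (lambda - m xi) * q xi}.

Let M := 2 ^+ d * sphere_area R d / (d%:R * (2 `^ alpha - 1)) * v + w.
Hypothesis small : riesz_constant d alpha * M < 1.

Let m_gt0 xi : 0 < enorm xi -> 0 < m xi.
Proof. by move=> x0; exact: powR_gt0. Qed.

(** The sign of [lambda] enters here: |lambda - xi| = xi - lambda >= xi. The number [xi] stands for
    the value [m xi] of the symbol. *)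
Let le_multiplier (s t xi : R) : 0 < xi -> s = (lambda - xi) * t -> `|t| <= xi^-1 * `|s|.
Proof.
move=> xi0 ->; rewrite normrM mulrA ler_peMl// mulrC ler_pdivlMr// mul1r.
rewrite ler0_norm; last by rewrite subr_le0 (le_trans lambda0)// ltW.
by rewrite opprB lerDl oppr_ge0.
Qed.

Let W x := `|V x|.
Let N := (\int[mu]_x (W x * (a x ^+ 2 + b x ^+ 2))%:E)%E.

Lemma weighted_mass_le : (N <= (riesz_constant d alpha * M)%:E * N)%E.
Proof.
have mW : measurable_fun setT W by rewrite /W; meas0.
have [iWa iWa2] := integrable_mul_potential mW ma (fun x => normr_id _) ia2.
have [iWb iWb2] := integrable_mul_potential mW mb (fun x => normr_id _) ib2.
have [ig1 ig12] := integrable_mul_potential mV ma (fun x => erefl) ia2.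
have [ig2 ig22] := integrable_mul_potential mV mb (fun x => erefl) ib2.
(* |V| f, and not V f, is paired with f, to meet the sign conditions of [parseval_le]. *)
pose a' x := W x * a x; pose b' x := W x * b x.
have ra x : 0 <= a' x * a x by rewrite -mulrA -expr2 mulr_ge0 ?sqr_ge0 ?normr_ge0.
have rb x : 0 <= b' x * b x by rewrite -mulrA -expr2 mulr_ge0 ?sqr_ge0 ?normr_ge0.
have NE : N = (\int[mu]_x (a' x * a x + b' x * b x)%:E)%E.
  by apply: eq_integral => x _; congr EFin; rewrite /a' /b'; ring.
rewrite {1}NE; apply: le_trans (parseval_le ma mb mp mq ia2 ib2 iWa iWb iWa2 iWb2 ra rb ap) _.
have mg1 : measurable_fun setT g1 by rewrite /g1; meas0.
have mg2 : measurable_fun setT g2 by rewrite /g2; meas0.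
have ma' : measurable_fun setT a' by rewrite /a'; meas0.
have mb' : measurable_fun setT b' by rewrite /b'; meas0.
have m1 := measurable_ft ma' mb'.
have m2 : measurable_fun setT (ft b' (fun x => - a' x)) by apply: measurable_ft => //; meas0.
have mEg := measurable_ft_energy mg1 mg2.
have mEa := measurable_ft_energy ma' mb'.
have Eg0 := ft_energy_ge0 g1 g2.
have Ea0 := ft_energy_ge0 a' b'.
pose e (xi : Rn R d) := enorm xi `^ (- alpha).
have me : measurable_fun setT e.
  have ne : measurable_fun setT (fun xi : Rn R d => enorm xi) by apply: measurable_enorm_comp.
  exact: (measurableT_comp (measurable_powR _) ne).
have e0 xi : 0 <= e xi by exact: powR_ge0.
have me1 : measurable_fun setT (fun xi => (e xi * ft_energy a' b' xi)%:E) by meas0.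
have me2 : measurable_fun setT (fun xi => (e xi * ft_energy g1 g2 xi)%:E) by meas0.
have e10 xi : (0 <= (e xi * ft_energy a' b' xi)%:E)%E by rewrite lee_fin mulr_ge0.
have e20 xi : (0 <= (e xi * ft_energy g1 g2 xi)%:E)%E by rewrite lee_fin mulr_ge0.
have half : (0 <= (2^-1 : R)%:E)%E by rewrite lee_fin.
have me3 := emeasurable_funD me1 me2.
have e30 xi : (0 <= (e xi * ft_energy a' b' xi)%:E + (e xi * ft_energy g1 g2 xi)%:E)%E.
  by rewrite adde_ge0.
have C0 := riesz_constant_gt0 alpha0 alphad.
have C0' : (0 <= (riesz_constant d alpha : R)%:E)%E by rewrite lee_fin ltW.
have Wb x : 0 <= W x <= v by rewrite normr_ge0 Vv.
have schurM x : (\int[mu]_y (riesz_kernel alpha x y * W y)%:E <= M%:E)%E.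
  exact: integral_riesz_kernel_le.
have W0 x : 0 <= W x by exact: normr_ge0.
have bound (a1 b1 : Rn R d -> R) : I a1 -> I b1 ->
    (forall x, `|a1 x| = W x * `|a x|) -> (forall x, `|b1 x| = W x * `|b x|) ->
    (\int[mu]_xi (e xi * ft_energy a1 b1 xi)%:E <= (riesz_constant d alpha * M)%:E * N)%E.
  move=> ia1 ib1 a1E b1E.
  have ma1 : measurable_fun setT a1 by have /integrableP[/measurable_EFinP] := ia1.
  have mb1 : measurable_fun setT b1 by have /integrableP[/measurable_EFinP] := ib1.
  apply: le_trans (riesz_energy_le alpha0 alphad ia1 ib1) _.
  have -> : ((riesz_constant d alpha * M)%:E * N = (riesz_constant d alpha)%:E * (M%:E * N))%E.
    by rewrite EFinM muleA.
  apply: (lee_wpmul2l C0').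
  exact: schur_le.
have ba : (\int[mu]_xi (e xi * ft_energy a' b' xi)%:E <= (riesz_constant d alpha * M)%:E * N)%E.
  by apply: bound => // x; rewrite normrM /W normr_id.
have bg : (\int[mu]_xi (e xi * ft_energy g1 g2 xi)%:E <= (riesz_constant d alpha * M)%:E * N)%E.
  by apply: bound => // x; rewrite normrM.
apply: (@le_trans _ _ (\int[mu]_xi ((2^-1)%:E *
   ((e xi * ft_energy a' b' xi)%:E + (e xi * ft_energy g1 g2 xi)%:E)))%E).
  apply: ae_ge0_le_integral; first exact: measurableT.
  - by move=> xi _; rewrite lee_fin addr_ge0// mulr_ge0.
  - by meas0.
  - by move=> xi _; rewrite mule_ge0.
  - exact: measurable_funeM.
  apply: filterS3 enorm_neq0_ae gp gq => xi x0 hp hq _.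
  rewrite -[leRHS]/((2^-1 * (e xi * ft_energy a' b' xi + e xi * ft_energy g1 g2 xi))%:E) lee_fin.
  have lp := le_multiplier (m_gt0 x0) hp; have lq := le_multiplier (m_gt0 x0) hq.
  have eE : e xi = (m xi)^-1 by rewrite /e powRN.
  have h1 := ler_wpM2l (normr_ge0 (ft a' b' xi)) lp.
  have h2 := ler_wpM2l (normr_ge0 (ft b' (fun x => - a' x) xi)) lq.
  apply: le_trans (lerD h1 h2) _; rewrite -eE /ft_energy.
  have := ler_wpM2l (e0 xi) (amgm_norm (ft a' b' xi) (ft g1 g2 xi)).
  have := ler_wpM2l (e0 xi) (amgm_norm (ft b' (fun x => - a' x) xi) (ft g2 (fun x => - g1 x) xi)).
  lra.
rewrite (ge0_integralZlT mu me3 e30 half) (ge0_integralDT mu me1 me2 e10 e20).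
apply: le_trans (lee_wpmul2l half (leeD ba bg)) _.
set X := ((riesz_constant d alpha * M)%:E * N)%E.
have X0 : (0 <= X)%E by apply: le_trans ba; exact: integral_ge0.
rewrite ge0_muleDr// -ge0_muleDl// (_ : (2^-1)%:E + (2^-1)%:E = 1)%E ?mul1e//.
by rewrite -[LHS]/((2^-1 + 2^-1)%:E); congr EFin; field.
Qed.

Lemma eigenfunction_eq0 : (\int[mu]_x (a x ^+ 2 + b x ^+ 2)%:E <= 0)%E.
Proof.
have mW : measurable_fun setT W by rewrite /W; meas0.
have W0 x : 0 <= W x by exact: normr_ge0.
have r0 x : 0 <= W x * (a x ^+ 2 + b x ^+ 2) by rewrite mulr_ge0// addr_ge0// sqr_ge0.
have N0 : (0 <= N)%E by apply: integral_ge0 => x _; rewrite lee_fin.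
(* N is at most [v] times the squared L^2 norm of the eigenfunction. Finiteness is what lets a
   factor below 1 force N to vanish. *)
have Noo : N \is a fin_num.
  rewrite ge0_fin_numE//.
  have v0 : 0 <= v by exact: le_trans (Vv (origin d)).
  have iab := integrable_addr ia2 ib2.
  have iv : I (fun x => v * (a x ^+ 2 + b x ^+ 2)) by exact: (integrableZl measurableT v iab).
  have /integrableP[_] := iv; apply: le_lt_trans.
  apply: ge0_le_integralT => [||x|x]; [by meas0|by meas0|by rewrite lee_fin|].
  rewrite lee_fin ger0_norm; last by rewrite mulr_ge0// addr_ge0// sqr_ge0.
  by rewrite ler_wpM2r ?addr_ge0 ?sqr_ge0// Vv.
have Nle : (N <= 0)%E.
  have := weighted_mass_le; rewrite -(fineK Noo) -EFinM !lee_fin => h.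
  have f0 : 0 <= fine N by rewrite fine_ge0.
  rewrite leNgt; apply/negP => Npos.
  have := ltr_pM2r Npos (riesz_constant d alpha * M) 1; rewrite small mul1r.
  by rewrite ltNge h.
have Wae : {ae mu, forall x, W x * (a x ^+ 2 + b x ^+ 2) = 0}.
  by apply: ge0_integral_eq0 => //; meas0.
have gae : {ae mu, forall x, g1 x = 0 /\ g2 x = 0}.
  apply: filterS Wae => x /eqP; rewrite mulf_eq0 normr_eq0 => /orP[/eqP V0|].
    by rewrite /g1 /g2 V0 !mul0r.
  by rewrite paddr_eq0 ?sqr_ge0// !sqrf_eq0 /g1 /g2 => /andP[/eqP -> /eqP ->]; rewrite !mulr0.
have ft0 (c1 c2 : Rn R d -> R) xi : {ae mu, forall x, c1 x = 0 /\ c2 x = 0} ->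
    measurable_fun setT c1 -> measurable_fun setT c2 -> ft c1 c2 xi = 0.
  move=> cae mc1 mc2; rewrite /ft /Rintegral.
  rewrite (ae_eq_integral (cst 0%E)) ?integral0 ?mulr0//; first by meas0.
  by apply: filterS cae => x [-> ->] _; rewrite !mulr0 addr0.
have mg1 : measurable_fun setT g1 by rewrite /g1; meas0.
have mg2 : measurable_fun setT g2 by rewrite /g2; meas0.
have p0 : {ae mu, forall xi, p xi = 0}.
  apply: filterS2 enorm_neq0_ae gp => xi x0 hp.
  have := le_multiplier (m_gt0 x0) hp; rewrite ft0// normr0 mulr0 normr_le0.
  by move=> /eqP.
have q0 : {ae mu, forall xi, q xi = 0}.
  apply: filterS2 enorm_neq0_ae gq => xi x0 hq.
  have := le_multiplier (m_gt0 x0) hq; rewrite ft0//; last 2 first.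
  - by apply: filterS gae => x [-> ->]; rewrite oppr0.
  - by meas0.
  by rewrite normr0 mulr0 normr_le0 => /eqP.
(* Injectivity of the transform, again from Parseval: the function is paired with its own
   truncations, and the bound on this pairing contains the vanishing [p] and [q]. *)
apply: (@ge0_integral_le_cvg _ _ _ mu
  (fun n x => (trunc n a x * a x + trunc n b x * b x)%:E) _ (fun=> 0%E)).
- by move=> n; have ? := measurable_trunc n ma; have ? := measurable_trunc n mb; meas0.
- move=> n x; rewrite lee_fin /trunc; case: ifP => _; last by rewrite !mul0r addr0.
  by rewrite -!expr2 addr_ge0// sqr_ge0.
- move=> x; apply: cvg_EFin; first exact: nearW.
  by rewrite !expr2; apply: cvgD; apply: cvgM; (exact: cvg_cst || exact: cvg_trunc).
- move=> n; have rt (c : Rn R d -> R) x : 0 <= trunc n c x * c x.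
    by rewrite /trunc; case: ifP => _; rewrite ?mul0r// -expr2 sqr_ge0.
  apply: le_trans (parseval_le ma mb mp mq ia2 ib2 (integrable_trunc n ma ia2)
    (integrable_trunc n mb ib2) (integrable_trunc_sqr n ma ia2) (integrable_trunc_sqr n mb ib2)
    (rt a) (rt b) ap) _.
  have mta := measurable_trunc n ma; have mtb := measurable_trunc n mb.
  have m1 := measurable_ft mta mtb.
  have m2 : measurable_fun setT (ft (trunc n b) (fun x => - trunc n a x)).
    by apply: measurable_ft => //; meas0.
  rewrite (ae_eq_integral (cst 0%E)) ?integral0//; first by meas0.
  by apply: filterS2 p0 q0 => xi -> -> _; rewrite normr0 !mulr0 addr0.
- exact: cvg_cst.
Qed.

End weak_coupling.

(** * The eigenvalue equation on the Fourier side *)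

Section transform_of_potential.
Context {R : realType} {d : nat}.
Local Notation mu := (lebesgue_Rn R d).
Local Notation I f := (mu.-integrable setT (fun x => (f x)%:E)).
Implicit Types a b c : Rn R d -> R.

Lemma eq_ft_ae a b a' b' xi :
  measurable_fun setT a -> measurable_fun setT b ->
  measurable_fun setT a' -> measurable_fun setT b' ->
  {ae mu, forall x, a x = a' x /\ b x = b' x} -> ft a b xi = ft a' b' xi.
Proof.
move=> ma mb ma' mb' ab; rewrite /ft /Rintegral; congr (_ * fine _).
apply: ae_eq_integral => //; [by meas0|by meas0|].
by apply: filterS ab => x [-> ->].
Qed.

Lemma ft_lincomb (l : R) a b a' b' xi : I a -> I b -> I a' -> I b' ->
  ft (fun x => l * a x - a' x) (fun x => l * b x - b' x) xi =
  l * ft a b xi - ft a' b' xi.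
Proof.
move=> ia ib ia' ib'; rewrite /ft mulrCA -mulrBr; congr (_ * _).
have i1 := integrable_ft xi ia ib; have i2 := integrable_ft xi ia' ib'.
rewrite -RintegralZl// -RintegralB//; last exact: (integrableZl measurableT l i1).
by apply: eq_Rintegral => x _; ring.
Qed.

Lemma cvg_ft_trunc a b xi : I a -> I b ->
  ft (trunc n a) (trunc n b) xi @[n --> \oo] --> ft a b xi.
Proof.
move=> ia ib.
have ma : measurable_fun setT a by have /integrableP[/measurable_EFinP] := ia.
have mb : measurable_fun setT b by have /integrableP[/measurable_EFinP] := ib.
apply: cvgM; first exact: cvg_cst.
apply: fine_cvg; rewrite ge0_EFin_Rintegral; last exact: integrable_ft.
apply: (cvg_integral_dominated (g := fun x => (`|a x| + `|b x|)%:E)).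
- by move=> n; have ? := measurable_trunc n ma; have ? := measurable_trunc n mb; meas0.
- by meas0.
- apply: aeW => x; apply: cvg_EFin; first exact: nearW.
  by apply: cvgD; apply: cvgM; (exact: cvg_cst || exact: cvg_trunc).
- by apply: integrable_addr; exact: integrable_normr.
- move=> x n; rewrite lee_fin (le_trans (norm_trig_le _ _ _))//.
  by rewrite lerD// norm_trunc_le.
Qed.

(** The transforms of the truncations of g = l f - h converge in two ways: pointwise to the
    transform of g, because g is integrable, and in L^2 to the combination of the transforms of f
    and h. Fatou shows that the two limits agree almost everywhere. *)
Lemma ft_potential_ae (l : R) (a b h k g1 g2 p q r s : Rn R d -> R) :
  measurable_fun setT a -> measurable_fun setT b ->
  measurable_fun setT h -> measurable_fun setT k ->
  measurable_fun setT p -> measurable_fun setT q ->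
  measurable_fun setT r -> measurable_fun setT s ->
  I (fun x => a x ^+ 2) -> I (fun x => b x ^+ 2) ->
  I (fun x => h x ^+ 2) -> I (fun x => k x ^+ 2) -> I g1 -> I g2 ->
  {ae mu, forall x, l * a x - h x = g1 x /\ l * b x - k x = g2 x} ->
  (\int[mu]_xi ((ft (trunc n a) (trunc n b) xi - p xi) ^+ 2 +
     (ft (trunc n b) (fun x => - trunc n a x) xi - q xi) ^+ 2)%:E @[n --> \oo] --> 0)%E ->
  (\int[mu]_xi ((ft (trunc n h) (trunc n k) xi - r xi) ^+ 2 +
     (ft (trunc n k) (fun x => - trunc n h x) xi - s xi) ^+ 2)%:E @[n --> \oo] --> 0)%E ->
  {ae mu, forall xi, ft g1 g2 xi = l * p xi - r xi /\
     ft g2 (fun x => - g1 x) xi = l * q xi - s xi}.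
Proof.
move=> ma mb mh mk mp mq mr ms_ ia2 ib2 ih2 ik2 ig1 ig2 gE D1 D2.
have mg1 : measurable_fun setT g1 by have /integrableP[/measurable_EFinP] := ig1.
have mg2 : measurable_fun setT g2 by have /integrableP[/measurable_EFinP] := ig2.
pose P n := ft (trunc n a) (trunc n b); pose Q n := ft (trunc n b) (fun x => - trunc n a x).
pose H n := ft (trunc n h) (trunc n k); pose K n := ft (trunc n k) (fun x => - trunc n h x).
have mt n c : measurable_fun setT c -> measurable_fun setT (trunc n c) by exact: measurable_trunc.
have mtN n c : measurable_fun setT c -> measurable_fun setT (fun x => - trunc n c x).
  by move=> mc; have ? := measurable_trunc n mc; meas0.
have it n c : measurable_fun setT c -> I (fun x => c x ^+ 2) ->
  I (trunc n c) by exact: integrable_trunc.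
have GE n xi : ft (trunc n g1) (trunc n g2) xi = l * P n xi - H n xi.
  rewrite -ft_lincomb; [|exact: it|exact: it|exact: it|exact: it].
  have := mt n a ma; have := mt n b mb; have := mt n h mh; have := mt n k mk => ? ? ? ?.
  apply: eq_ft_ae; [exact: mt|exact: mt|by meas0|by meas0|].
  apply: filterS gE => x [e1 e2]; rewrite /trunc -e1 -e2.
  by case: ifP; rewrite ?mulr0 ?subr0.
have GE' n xi : ft (trunc n g2) (fun x => - trunc n g1 x) xi = l * Q n xi - K n xi.
  rewrite -ft_lincomb; [|exact: it|exact/integrable_oppr/it|exact: it|exact/integrable_oppr/it].
  have := mt n a ma; have := mt n b mb; have := mt n h mh; have := mt n k mk => ? ? ? ?.
  apply: eq_ft_ae; [exact: mt|exact: mtN|by meas0|by meas0|].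
  apply: filterS gE => x [e1 e2]; rewrite /trunc -e1 -e2.
  by case: ifP; rewrite ?mulr0 ?subr0 ?oppr0 ?mulr0 ?subr0; split => //; ring.
have mP n : measurable_fun setT (P n) by apply: measurable_ft; exact: mt.
have mQ n : measurable_fun setT (Q n) by apply: measurable_ft; [exact: mt|exact: mtN].
have mH n : measurable_fun setT (H n) by apply: measurable_ft; exact: mt.
have mK n : measurable_fun setT (K n) by apply: measurable_ft; [exact: mt|exact: mtN].
pose E (u u' : Rn R d -> R) xi := (u xi - (l * p xi - r xi)) ^+ 2 + (u' xi - (l * q xi - s xi))
  ^+ 2.
have mE u u' : measurable_fun setT u -> measurable_fun setT u' -> measurable_fun setT (E u u').
  by move=> ? ?; rewrite /E; meas0.
have mG : measurable_fun setT (ft g1 g2) by apply: measurable_ft.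
have mG' : measurable_fun setT (ft g2 (fun x => - g1 x)) by apply: measurable_ft => //; meas0.
have mGn n : measurable_fun setT (ft (trunc n g1) (trunc n g2)) by apply: measurable_ft;
  exact: mt.
have mGn' n : measurable_fun setT (ft (trunc n g2) (fun x => - trunc n g1 x)).
  by apply: measurable_ft; [exact: mt|exact: mtN].
have E0 u u' xi : 0 <= E u u' xi by rewrite addr_ge0// sqr_ge0.
have : (\int[mu]_xi (E (ft g1 g2) (ft g2 (fun x => - g1 x)) xi)%:E <= 0)%E.
  pose D n := (\int[mu]_xi ((P n xi - p xi) ^+ 2 + (Q n xi - q xi) ^+ 2)%:E)%E.
  pose D' n := (\int[mu]_xi ((H n xi - r xi) ^+ 2 + (K n xi - s xi) ^+ 2)%:E)%E.
  apply: (@ge0_integral_le_cvg _ _ _ mu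
    (fun n xi => (E (ft (trunc n g1) (trunc n g2)) (ft (trunc n g2) (fun x => - trunc n g1 x))
      xi)%:E) _
    (fun n => (2 * l ^+ 2)%:E * D n + 2%:E * D' n)%E).
  - by move=> n; apply/measurable_EFinP; exact: mE.
  - by move=> n xi; rewrite lee_fin.
  - move=> xi; apply: cvg_EFin; first exact: nearW.
    have c1 := cvg_ft_trunc (xi := xi) ig1 ig2.
    have c2 : ft (trunc n g2) (fun x => - trunc n g1 x) xi @[n --> \oo] -->
      ft g2 (fun x => - g1 x) xi.
      have NE n : (fun x => - trunc n g1 x) = trunc n (fun x => - g1 x).
        by apply/funext => x; rewrite /trunc; case: ifP; rewrite ?oppr0.
      rewrite (_ : (fun n => _) = fun n => ft (trunc n g2) (trunc n (fun x => - g1 x)) xi);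
        last first.
        by apply/funext => n; rewrite NE.
      by apply: cvg_ft_trunc => //; exact: integrable_oppr.
    by rewrite /E; apply: cvgD; apply: cvgM; apply: cvgB => //; exact: cvg_cst.
  - move=> n.
    have l20 : 0 <= 2 * l ^+ 2 by rewrite mulr_ge0// sqr_ge0.
    have l20' : (0 <= (2 * l ^+ 2)%:E)%E by rewrite lee_fin.
    have t0 : (0 <= (2 : R)%:E)%E by rewrite lee_fin.
    have := mP n; have := mQ n; have := mH n; have := mK n => ? ? ? ?.
    have m1 : measurable_fun setT (fun xi => ((P n xi - p xi) ^+ 2 + (Q n xi - q xi) ^+ 2)%:E)
      by meas0.
    have m2 : measurable_fun setT (fun xi => ((H n xi - r xi) ^+ 2 + (K n xi - s xi) ^+ 2)%:E)
      by meas0.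
    have p1 xi : (0 <= ((P n xi - p xi) ^+ 2 + (Q n xi - q xi) ^+ 2)%:E)%E by rewrite lee_fin
      addr_ge0// sqr_ge0.
    have p2 xi : (0 <= ((H n xi - r xi) ^+ 2 + (K n xi - s xi) ^+ 2)%:E)%E by rewrite lee_fin
      addr_ge0// sqr_ge0.
    rewrite /D /D'.
    have <- := ge0_integralZlT mu m1 p1 l20'.
    have <- := ge0_integralZlT mu m2 p2 t0.
    have m1e := measurable_funeM (2 * l ^+ 2)%:E m1; have m2e := measurable_funeM 2%:E m2.
    have p1e xi := mule_ge0 l20' (p1 xi); have p2e xi := mule_ge0 t0 (p2 xi).
    have <- := ge0_integralDT mu m1e m2e p1e p2e.
    apply: ge0_le_integralT => [||xi|xi].
    + by apply/measurable_EFinP; exact: mE.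
    + exact: emeasurable_funD.
    + by rewrite lee_fin.
    rewrite -[leRHS]/((2 * l ^+ 2 * ((P n xi - p xi) ^+ 2 + (Q n xi - q xi) ^+ 2) +
      2 * ((H n xi - r xi) ^+ 2 + (K n xi - s xi) ^+ 2))%:E) lee_fin /E GE GE'.
    (* Applied to x = l (P - p) and y = H - r, and likewise for the second components; hence the
       weights [2 * l ^+ 2] and [2] of the two error sequences. *)
    have sq (x y : R) : (x - y) ^+ 2 <= 2 * x ^+ 2 + 2 * y ^+ 2.
      have -> : 2 * x ^+ 2 + 2 * y ^+ 2 = (x - y) ^+ 2 + (x + y) ^+ 2 by ring.
      by rewrite lerDl sqr_ge0.
    have := sq (l * (P n xi - p xi)) (H n xi - r xi).
    have := sq (l * (Q n xi - q xi)) (K n xi - s xi).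
    have -> : l * (Q n xi - q xi) - (K n xi - s xi) = l * Q n xi - K n xi - (l * q xi - s xi)
      by ring.
    have -> : l * (P n xi - p xi) - (H n xi - r xi) = l * P n xi - H n xi - (l * p xi - r xi)
      by ring.
    rewrite !exprMn => h1 h2; apply: le_trans (lerD h2 h1) _.
    by rewrite le_eqVlt; apply/orP; left; apply/eqP; ring.
  - rewrite -[X in _ --> X]adde0; apply: cvgeD => //.
      by rewrite -(mule0 (2 * l ^+ 2)%:E); apply: cvgeZl.
    by rewrite -(mule0 2%:E); apply: cvgeZl.
move=> h0; have := ge0_integral_eq0 (mE _ _ mG mG') (E0 _ _) h0.
apply: filterS => xi /eqP; rewrite paddr_eq0 ?sqr_ge0// !sqrf_eq0 !subr_eq0.
by move=> /andP[/eqP -> /eqP ->].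
Qed.

End transform_of_potential.

Local Open Scope complex_scope.

(** * From the complex-valued definitions to real and imaginary parts *)

Section plancherel.
Context {R : realType} {d : nat}.
Local Notation mu := (lebesgue_Rn R d).
Local Notation I f := (mu.-integrable setT (fun x => (f x)%:E)).
Implicit Types f g : Rn R d -> R[i].

Lemma normc_ge0 (z : R[i]) : 0 <= Normc.normc z.
Proof. by case: z => x y; exact: sqrtr_ge0. Qed.

Lemma normc_sqr (z : R[i]) : Normc.normc z ^+ 2 = complex.Re z ^+ 2 + complex.Im z ^+ 2.
Proof. by case: z => x y /=; rewrite sqr_sqrtr// addr_ge0// sqr_ge0. Qed.

Lemma L2norm_sqr f :
  (L2norm f `^ 2 = \int[mu]_x (complex.Re (f x) ^+ 2 + complex.Im (f x) ^+ 2)%:E)%E.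
Proof.
rewrite /L2norm poweR_Lnorm//; apply: eq_integral => x _.
by rewrite /= ger0_norm ?normc_ge0// powR_mulrn ?normc_ge0// normc_sqr.
Qed.

Lemma cvg_L2norm (F : nat -> Rn R d -> R[i]) : L2norm (F n) @[n --> \oo] --> 0%E ->
  (\int[mu]_x (complex.Re (F n x) ^+ 2 + complex.Im (F n x) ^+ 2)%:E @[n --> \oo] --> 0)%E.
Proof.
move=> F0.
rewrite (_ : (fun n => _) = fun n => (L2norm (F n) * L2norm (F n))%E); last first.
  apply/funext => n; rewrite -L2norm_sqr (_ : 2 = 1 + 1)// poweRD.
    by rewrite poweRe1// Lnorm_ge0.
  by apply: add_neq0_poweRD_def; rewrite gt_eqF// addr_gt0.
by rewrite -[X in _ --> X](mule0 0%E); apply: cvgeM.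
Qed.

Lemma inL2_integrable f : inL2 f ->
  [/\ measurable_fun setT (fun x => complex.Re (f x)),
      measurable_fun setT (fun x => complex.Im (f x)),
      I (fun x => complex.Re (f x) ^+ 2) & I (fun x => complex.Im (f x) ^+ 2)].
Proof.
move=> [[mre mim] foo].
have iab : (\int[mu]_x (complex.Re (f x) ^+ 2 + complex.Im (f x) ^+ 2)%:E < +oo)%E.
  by rewrite -L2norm_sqr poweR_lty.
have H (c : Rn R d -> R) : measurable_fun setT c ->
    (forall x, c x ^+ 2 <= complex.Re (f x) ^+ 2 + complex.Im (f x) ^+ 2) ->
    I (fun x => c x ^+ 2).
  move=> mc hc; apply/integrableP; split; first by meas0.
  apply: le_lt_trans iab; apply: ge0_le_integralT => [||x|x]; [by meas0|by meas0|by []|].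
  by rewrite /= lee_fin ger0_norm ?sqr_ge0.
by split => //; apply: H => // x; rewrite ?lerDl ?lerDr sqr_ge0.
Qed.

Lemma truncated_fourierE n f xi :
  truncated_fourier n%:R f xi =
  ft (trunc n (fun x => complex.Re (f x))) (trunc n (fun x => complex.Im (f x))) xi +i*
  ft (trunc n (fun x => complex.Im (f x))) (fun x => - trunc n (fun x => complex.Re (f x)) x) xi.
Proof.
rewrite /truncated_fourier /cintegral /ft -/(@fourier_const R d).
have E (F G : Rn R d -> R) : (forall x, (if enorm x <= n%:R then F x else 0) = G x) ->
    \int[mu]_(x in [set x | enorm x <= n%:R]) F x = \int[mu]_x G x.
  move=> FG; rewrite Rintegral_mkcond; apply: eq_Rintegral => x _; rewrite -FG patchE.
  by rewrite (_ : (x \in _) = (enorm x <= n%:R))//; apply/idP/idP; rewrite inE.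
rewrite (E _ (fun x => cos (dotp x xi) * trunc n (fun x => complex.Re (f x)) x +
   sin (dotp x xi) * trunc n (fun x => complex.Im (f x)) x)); last first.
  move=> x; rewrite /trunc; case: ifP => _; last by rewrite !mulr0 addr0.
  by case: (f x) => u w /=; rewrite cosN sinN; ring.
rewrite (E _ (fun x => cos (dotp x xi) * trunc n (fun x => complex.Im (f x)) x +
   sin (dotp x xi) * - trunc n (fun x => complex.Re (f x)) x)); last first.
  move=> x; rewrite /trunc; case: ifP => _; last by rewrite oppr0 !mulr0 addr0.
  by case: (f x) => u w /=; rewrite cosN sinN; ring.
apply/eqP; rewrite eq_complex /=; apply/andP; split; apply/eqP; ring.
Qed.

Lemma is_fourier_cvg f g : is_fourier f g ->
  (\int[mu]_xi ((ft (trunc n (fun x => complex.Re (f x))) (trunc n (fun x => complex.Im (f x)))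
    xi -
        complex.Re (g xi)) ^+ 2 +
     (ft (trunc n (fun x => complex.Im (f x))) (fun x => - trunc n (fun x => complex.Re (f x))
       x) xi -
        complex.Im (g xi)) ^+ 2)%:E @[n --> \oo] --> 0)%E.
Proof.
move=> [_ _ /cvg_L2norm].
rewrite (_ : (fun n => _) = (fun n => \int[mu]_xi ((ft (trunc n (fun x => complex.Re (f x)))
  (trunc n (fun x => complex.Im (f x))) xi -
        complex.Re (g xi)) ^+ 2 +
     (ft (trunc n (fun x => complex.Im (f x))) (fun x => - trunc n (fun x => complex.Re (f x))
       x) xi -
        complex.Im (g xi)) ^+ 2)%:E)%E)//.
apply/funext => n; apply: eq_integral => xi _; rewrite truncated_fourierE.
by case: (g xi) => u w.
Qed.

End plancherel.

Section potential.
Context {R : realType} {d : nat}.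
Local Notation mu := (lebesgue_Rn R d).
Variable V : Rn R d -> R.

Lemma Lp_norm1E : V \in Lfun mu 1%:E ->
  measurable_fun setT V /\ (\int[mu]_x (`|V x|)%:E = (Lp_norm 1%:E V)%:E)%E.
Proof.
move=> V1; have mV : measurable_fun setT V by have := sub_Lfun_mfun V1; rewrite inE.
have fV : finite_norm mu 1%:E V by have := sub_Lfun_finLfun V1; rewrite inE.
split => //; rewrite /Lp_norm fineK; first by rewrite Lnorm1.
by rewrite ge0_fin_numE// Lnorm_ge0.
Qed.

Lemma le_Lp_normoo : V \in Lfun mu +oo%E -> {ae mu, forall x, `|V x| <= Lp_norm +oo%E V}.
Proof.
move=> Voo; have fV : finite_norm mu +oo%E V by have := sub_Lfun_finLfun Voo; rewrite inE.
have E : (Lnorm mu +oo%E (EFin \o V) = (Lp_norm +oo%E V)%:E)%E.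
  by rewrite fineK// ge0_fin_numE// Lnorm_ge0.
(* The norm is an essential supremum when the whole space has positive measure; in the other case
   every property holds almost everywhere. *)
move: E; rewrite unlock; case: ifPn => [mu0 E|]; last first.
  rewrite ltNge negbK => mu0 _.
  have mu00 : mu setT = 0%E by apply/eqP; rewrite eq_le mu0/=.
  by exists setT; split.
have := ess_sup_inf.ess_sup_ge mu (abse \o (EFin \o V)); rewrite E.
by apply: filterS => x /=; rewrite lee_fin.
Qed.

End potential.

(** * Exclusion of non-positive eigenvalues *)

Section eigenvalue.
Context {R : realType} {d : nat}.
Local Notation mu := (lebesgue_Rn R d).
Local Notation I f := (mu.-integrable setT (fun x => (f x)%:E)).
Variables (alpha lambda : R) (V : Rn R d -> R).
Hypotheses (d0 : (0 < d)%N) (alpha0 : 0 < alpha) (alphad : alpha < d%:R).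
Hypothesis lambda0 : lambda <= 0.
Hypotheses (Voo : V \in Lfun mu +oo%E) (V1 : V \in Lfun mu 1%:E).

Lemma no_nonpositive_eigenvalue :
  riesz_constant d alpha *
    (2 ^+ d * sphere_area R d / (d%:R * (2 `^ alpha - 1)) * Lp_norm +oo%E V +
     Lp_norm 1%:E V) < 1 ->
  ~ eigenvalue_of (add_potential (fractional_laplacian alpha) V) lambda%:C.
Proof.
move=> small [f [fL2 fN0 [h [fhat [Ff Fh]] [_ fE]]]]; apply: fN0.
have [ma mb ia2 ib2] := inL2_integrable fL2.
have [_ [[mp mq] _] _] := Ff.
have [hL2 [[mr ms_] _] _] := Fh.
have [mh mk ih2 ik2] := inL2_integrable hL2.
have Df := is_fourier_cvg Ff; have Dh := is_fourier_cvg Fh.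
have [mV VE] := Lp_norm1E V1.
have Vv := le_Lp_normoo Voo.
set v := Lp_norm +oo%E V in Vv small; set w := Lp_norm 1%:E V in VE small.
(* The bound on [V] holds almost everywhere only, so [V] is clipped. *)
pose U x := if `|V x| <= v then V x else 0.
have mU : measurable_fun setT U.
  by apply: measurable_fun_ifT => //; apply: measurable_fun_ler => //; meas0.
have v0 : 0 <= v by rewrite fine_ge0// Lnorm_ge0.
have Uv x : `|U x| <= v by rewrite /U; case: ifP => // _; rewrite normr0.
have Uw : (\int[mu]_x (`|U x|)%:E <= w%:E)%E.
  rewrite -VE; apply: ge0_le_integralT => [||x|x]; [by meas0|by meas0|by rewrite lee_fin|].
  by rewrite lee_fin /U; case: ifP => // _; rewrite normr0.
have [ig1 _] := integrable_mul_potential mU Uv Uw mU ma (fun x => erefl) ia2.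
have [ig2 _] := integrable_mul_potential mU Uv Uw mU mb (fun x => erefl) ib2.
(* [h] is the fractional Laplacian of [f], so the eigenvalue equation reads lambda f - h = V f, and
   [U] agrees with [V] almost everywhere. *)
have gE : {ae mu, forall x, lambda * complex.Re (f x) - complex.Re (h x) = U x * complex.Re (f
  x) /\
    lambda * complex.Im (f x) - complex.Im (h x) = U x * complex.Im (f x)}.
  apply: filterS2 fE Vv => x + Vx; rewrite /U Vx.
  case: (f x) (h x) => [u1 u2] [t1 t2] /= /eqP; rewrite eq_complex /= => /andP[/eqP e1 /eqP e2].
  by split; lra.
have gft := ft_potential_ae ma mb mh mk mp mq mr ms_ ia2 ib2 ih2 ik2 ig1 ig2 gE Df Dh.
have gp : {ae mu, forall xi, ft (fun x => U x * complex.Re (f x)) (fun x => U x * complex.Im (f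
  x)) xi =
    (lambda - enorm xi `^ alpha) * complex.Re (fhat xi)}.
  by apply: filterS gft => xi [-> _]; case: (fhat xi) => u1 u2 /=; ring.
have gq : {ae mu, forall xi, ft (fun x => U x * complex.Im (f x)) (fun x => - (U x * complex.Re
  (f x))) xi =
    (lambda - enorm xi `^ alpha) * complex.Im (fhat xi)}.
  by apply: filterS gft => xi [_ ->]; case: (fhat xi) => u1 u2 /=; ring.
have f0 := eigenfunction_eq0 d0 alpha0 alphad lambda0 mU ma mb mp mq Uv Uw ia2 ib2 Df gp gq small.
have : {ae mu, forall x, complex.Re (f x) ^+ 2 + complex.Im (f x) ^+ 2 = 0}.
  by apply: ge0_integral_eq0 => [|x|//]; [by meas0|by rewrite addr_ge0// sqr_ge0].
apply: filterS => x /eqP; rewrite paddr_eq0 ?sqr_ge0// !sqrf_eq0.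
by case: (f x) => u1 u2 /= /andP[/eqP -> /eqP ->].
Qed.

End eigenvalue.

Theorem corollary4p6 (R : realType) (d : nat) (alpha : R)
    (V : Rn R d -> R)
    (hd : (3 <= d)%N) (halpha0 : 0 < alpha) (halpha2 : alpha < 2)
    (hVoo : V \in Lfun (lebesgue_Rn R d) +oo%E)
    (hV1 : V \in Lfun (lebesgue_Rn R d) 1%:E)
    (hV0 : vanishes_at_infinity V)
    (hsmall :
       2 * riesz_constant d alpha ^+ 2 *
       ((8 * 5 ^+ d * sphere_area R d ^+ 2) /
          (d%:R ^+ 2 * (2 `^ alpha - 1) ^+ 2) * Lp_norm +oo%E V ^+ 2
        + Lp_norm 1%:E V ^+ 2) < 1) :
  let H := add_potential (fractional_laplacian alpha) V in
  (forall lambda : R, lambda <= 0 -> ~ eigenvalue_of H lambda%:C) /\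
  ~ eigenvalue_of H 0.
Proof.
have d0 : (0 < d)%N by exact: leq_trans hd.
have alphad : alpha < d%:R.
  by rewrite (lt_trans halpha2)// ltr_nat.
have C0 := riesz_constant_gt0 halpha0 alphad.
have u1 : 0 < 2 `^ alpha - 1 :> R by rewrite subr_gt0 two_powR_gt1.
suff noev lambda : lambda <= 0 ->
    ~ eigenvalue_of (add_potential (fractional_laplacian alpha) V) lambda%:C.
  by split; [exact: noev|have := noev 0 (lexx 0); rewrite (_ : 0%:C = 0)].
move=> lambda0; apply: no_nonpositive_eigenvalue => //.
set v := Lp_norm +oo%E V in hsmall *; set w := Lp_norm 1%:E V in hsmall *.
set C := riesz_constant d alpha in hsmall C0 *.
set s := sphere_area R d in hsmall *; set u := 2 `^ alpha - 1 in hsmall u1 *.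
have v0 : 0 <= v by rewrite fine_ge0// Lnorm_ge0.
have w0 : 0 <= w by rewrite fine_ge0// Lnorm_ge0.
have s0 : 0 <= s by exact: sphere_area_ge0.
have dR : 0 < d%:R :> R by rewrite ltr0n.
set A := 2 ^+ d * s / (d%:R * u).
have A0 : 0 <= A by rewrite divr_ge0 ?mulr_ge0 ?exprn_ge0// ltW.
(* The dyadic constant [A] has 4^d in its square, and 4^d <= 5^d <= 8 * 5^d. *)
have le45 : A ^+ 2 <= 8 * 5 ^+ d * s ^+ 2 / (d%:R ^+ 2 * u ^+ 2).
  rewrite /A expr_div_n !exprMn; apply: ler_wpM2r; first by rewrite invr_ge0 -exprMn sqr_ge0.
  apply: ler_wpM2r; first exact: sqr_ge0.
  rewrite -exprM mulnC exprM; apply: le_trans (_ : 5 ^+ d <= _).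
    by apply: lerXn2r; rewrite ?nnegrE ?sqr_ge0//; lra.
  by rewrite ler_peMl ?exprn_ge0// ler1n.
(* The factor 2 and the squares of the smallness condition come from (A v + w)^2 <= 2 (A^2 v^2 +
   w^2). *)
have h : (C * (A * v + w)) ^+ 2 < 1.
  apply: le_lt_trans hsmall; rewrite [2 * C ^+ 2]mulrC -[X in _ <= X]mulrA exprMn.
  apply: ler_wpM2l; first exact: sqr_ge0.
  have := ler_wpM2r (sqr_ge0 v) le45; have := sqr_ge0 (A * v - w).
  lra.
rewrite -[ltRHS](expr1n _ 2) ltr_sqr ?nnegrE// in h.
by apply: mulr_ge0; [exact: ltW|apply: addr_ge0 => //; exact: mulr_ge0].
Qed.
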